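(* Let $\lambda$ be an infinite regular cardinal with $\lambda^{<\lambda}=\lambda$, and let $\mathbb{P}$ be a $\lambda^+$-uniform partial order. If $\mathrm{Dl}_\lambda$ holds, then player II has a winning strategy in the genericity game for $\mathbb{P}$.
   Context: **Notation.** $\mathcal{P}_{<\lambda}(A)=\{B\subseteq A:|B|<\lambda\}$; $\mathrm{otp}$ denotes order type. **$\mathrm{Dl}_\lambda$** ($\lambda$ regular) asserts: there are sets $\mathcal{A}_\alpha\subseteq\mathcal{P}(\alpha)$ with $|\mathcal{A}_\alpha|<\lambda$ for every $\alpha<\lambda$, such that for all $A\subseteq\lambda$ the set $\{\alpha\in\lambda: A\cap\alpha\in\mathcal{A}_\alpha\}$ is stationary in $\lambda$. **Uniform partial orders.** A standard $\lambda^+$-uniform partial order is a partial order $\le$ on a subset $\mathbb{P}$ of $\lambda\times\mathcal{P}_{<\lambda}(\lambda^+)$ such that, writing $\operatorname{dom} p=u$ for $p=(\alpha,u)\in\mathbb{P}$: 1. If $p\le q$ then $\operatorname{dom}p\subseteq\operatorname{dom}q$. 2. For all $p,q,r\in\mathbb{P}$ with $p,q\le r$ there is $r'\in\mathbb{P}$ with $p,q\le r'\le r$ and $\operatorname{dom}r'=\operatorname{dom}p\cup\operatorname{dom}q$. 3. If $(p_i)_{i<\delta}$ is an increasing sequence of length $\delta<\lambda$, it has a least upper bound, denoted $\bigcup_{i<\delta}p_i$ or $p_{<\delta}$, with domain $\bigcup_{i<\delta}\operatorname{dom}p_i$. 4. For all $p\in\mathbb{P}$, $\alpha<\lambda^+$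 there is $q\le p$ in $\mathbb{P}$ with $\operatorname{dom}q=\operatorname{dom}p\cap\alpha$, and there is a unique maximal such $q$, denoted $p\restriction\alpha$. 5. For limit ordinals $\delta$, $p\restriction\delta=\bigcup_{\alpha<\delta}p\restriction\alpha$ (least upper bound). 6. If $(p_i)_{i<\delta}$ is increasing of length less than $\lambda$, then $(\bigcup_{i<\delta}p_i)\restriction\alpha=\bigcup_{i<\delta}(p_i\restriction\alpha)$. 7. (Indiscernibility) If $p=(\alpha,v)\in\mathbb{P}$ and $h:v\to v'\subseteq\lambda^+$ is an order-isomorphism, then $h[p]:=(\alpha,v')\in\mathbb{P}$; moreover if $q\le p$ then $h[q]\le h[p]$ (where $h[q]$ is computed with $h$ restricted to $\operatorname{dom} q$). 8. (Amalgamation) For all $p,q\in\mathbb{P}$ and $\alpha<\lambda^+$, if $p\restriction\alpha\le q$ and $\operatorname{dom}p\cap\operatorname{dom}q=\operatorname{dom}p\cap\alpha$, then there is $r\in\mathbb{P}$ with $p,q\le r$. A partial order is $\lambda^+$-uniform if it is isomorphic to a standard $\lambda^+$-uniform one; it then carries the induced domain and restriction functions (and all notions below are transported along the isomorphism). Elements $p,q$ are incompatible ($p\perp q$) if there is no $r\ge p,q$. Put $\mathbb{P}_\alpha=\{p\in\mathbb{P}:\operatorname{dom}p\subseteq\alpha\}$. **Generic ideals.** For $\alpha<\lambda^+$, a $\lambda$-generic ideal in $\mathbb{P}_\alpha$ is a set $G\subseteq\mathbb{P}_\alpha$ that is closed downward, such that every $Q\subseteq G$ with $|Q|<\lambda$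 has an upper bound in $G$, and such that every $p\in\mathbb{P}_\alpha\setminus G$ is incompatible with some $q\in G$. $\mathrm{Gen}(\mathbb{P}_\alpha)$ is the set of these. For $G\in\mathrm{Gen}(\mathbb{P}_\alpha)$, $\mathbb{P}/G=\{p\in\mathbb{P}: p$ is compatible with every $r\in G\}$; for $G=\emptyset$ read $\mathbb{P}/G=\mathbb{P}$. If $(G_i)_{i<\delta}$ ($0<\delta<\lambda^+$) is $\subseteq$-increasing with $G_i\in\mathrm{Gen}(\mathbb{P}_{\alpha_i})$, then $G_{<\delta}$ denotes the unique minimal $\lambda$-generic ideal of $\mathbb{P}_{\sup_i\alpha_i}$ containing $\bigcup_{i<\delta}G_i$ (it exists); $G_{<0}=\emptyset$. **Density systems.** For $\alpha<\lambda^+$ and $G\in\mathrm{Gen}(\mathbb{P}_\alpha)$, or $G=\emptyset$ (then take $\alpha=0$ and $\mathbb{P}/G=\mathbb{P}$), a density system over $G$ is a function $D:\{(u,w):u\subseteq w\in\mathcal{P}_{<\lambda}(\lambda^+)\}\to\mathcal{P}(\mathbb{P})$ such that: (a) $D(u,w)\subseteq\{p\in\mathbb{P}/G:\operatorname{dom}p\subseteq w\}$; (b) for $p,q\in\mathbb{P}/G$, if $p\in D(u,w)$, $p\le q$ and $\operatorname{dom}q\subseteq w$, then $q\in D(u,w)$; (c) for every $(u,w)$ and every $p\in\mathbb{P}/G$ with $\operatorname{dom}p\subseteq w$ there is $q\ge p$ in $D(u,w)$; (d) if $w_1\cap\alpha=w_2\cap\alpha$ and $h:w_1\to w_2$ is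 an order-isomorphism with $h[u_1]=u_2$, then for every $p\in\mathbb{P}/G$ with $\operatorname{dom}p\subseteq w_1$: $p\in D(u_1,w_1)$ iff $h[p]\in D(u_2,w_2)$. $G\in\mathrm{Gen}(\mathbb{P}_\gamma)$ meets a density system $D$ if for all $u\in\mathcal{P}_{<\lambda}(\gamma)$ there is $v\in\mathcal{P}_{<\lambda}(\gamma)$ with $u\subseteq v$ and $G\cap D(u,v)\neq\emptyset$. **The genericity game for $\mathbb{P}$** is a two-player game of length $\lambda^+$. At move $\alpha<\lambda^+$, player II has already chosen an increasing sequence of ordinals $\zeta_\beta<\lambda^+$ and an increasing sequence of $\lambda$-generic ideals $G_\beta\in\mathrm{Gen}(\mathbb{P}_{\zeta_\beta})$ for $\beta<\alpha$. Player I chooses an element $g_\alpha\in\mathbb{P}/G_{<\alpha}$ and at most $\lambda$ density systems $D^\alpha_i$ over $G_{<\alpha}$. Then player II picks an ordinal $\zeta_\alpha<\lambda^+$ and some $G_\alpha\in\mathrm{Gen}(\mathbb{P}_{\zeta_\alpha})$. Player II wins if the sequences $\zeta_\alpha$ and $G_\alpha$ are increasing ($\beta<\alpha$ implies $\zeta_\beta\le\zeta_\alpha$ and $G_\beta\subseteq G_\alpha$) and for all $\alpha<\lambda^+$ and all indices $i$ occurring at stage $\alpha$: $g_\alpha\in G_\alpha$, and for all $\beta\ge\alpha$, $G_\beta$ meets $D^\alpha_i$. *)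

(* Defs.v *)
From mathcomp Require Import all_boot all_order.
From mathcomp Require Import boolp classical_sets functions cardinality.

Set Implicit Arguments.
Unset Strict Implicit.
Unset Printing Implicit Defensive.

Import Order.TTheory.

Local Open Scope card_scope.
Local Open Scope order_scope.
Local Open Scope classical_set_scope.

(* Ordinals are represented by well-ordered types: lambda is an order L whose
   order type is lambda, lambda^+ is an order M whose order type is lambda^+.
   An ordinal alpha < lambda is an element of L, identified with the set
   [below alpha] of its predecessors, and likewise for M. *)

Definition card_lt {T U : Type} (A : set T) (B : set U) : Prop :=
  A #<= B /\ ~ (B #<= A).

Definition below {d : Order.disp_t} {T : orderType d} (a : T) : set T :=
  [set x | x < a].

Definition well_ordered {d : Order.disp_t} (T : orderType d) : Prop :=
  well_founded (fun x y : T => x < y).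

Definition is_cardinal {d : Order.disp_t} (L : orderType d) : Prop :=
  well_ordered L /\ forall a : L, card_lt (below a) [set: L].

Definition unbounded {d : Order.disp_t} {T : orderType d} (A : set T) : Prop :=
  forall x, exists2 a, A a & x <= a.

Definition infinite_regular {d : Order.disp_t} (L : orderType d) : Prop :=
  [/\ is_cardinal L, infinite_set [set: L] &
      forall A : set L, unbounded A -> A #= [set: L]].

(* lambda^{<lambda} = lambda; the left-hand side counts the sequences of
   elements of lambda of length less than lambda. *)
Definition power_below_eq {d : Order.disp_t} (L : orderType d) : Prop :=
  [set: {a : L & below a -> L}] #= [set: L].

(* M has order type lambda^+, the least ordinal of cardinality > lambda. *)
Definition is_successor_cardinal {dL dM : Order.disp_t}
    (L : orderType dL) (M : orderType dM) : Prop :=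
  [/\ well_ordered M, forall a : M, below a #<= [set: L] &
      card_lt [set: L] [set: M]].

Definition is_limit {d : Order.disp_t} {T : orderType d} (a : T) : Prop :=
  (exists x, x < a) /\ forall x, x < a -> exists2 y, x < y & y < a.

Definition is_club {d : Order.disp_t} {T : orderType d} (C : set T) : Prop :=
  unbounded C /\
  forall a, is_limit a ->
    (forall x, x < a -> exists c, [/\ C c, x < c & c < a]) -> C a.

Definition stationary {d : Order.disp_t} {T : orderType d} (S : set T) : Prop :=
  forall C : set T, is_club C -> S `&` C !=set0.

Definition Dl {d : Order.disp_t} (L : orderType d) : Prop :=
  exists AA : L -> set (set L),
    [/\ forall a B, AA a B -> B `<=` below a,
        forall a, card_lt (AA a) [set: L] &
        forall A : set L, stationary [set a | AA a (A `&` below a)]].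

(* [pow_lt L A] is the set of subsets of A of cardinality < lambda. *)
Definition pow_lt {d : Order.disp_t} (L : orderType d) {T : Type} (A : set T) :
    set (set T) :=
  [set B | B `<=` A /\ card_lt B [set: L]].

Definition order_iso {d : Order.disp_t} {M : orderType d}
    (h : M -> M) (v w : set M) : Prop :=
  h @` v = w /\ {in v &, {mono h : x y / x <= y}}.

Section Standard.
Context {dL dM : Order.disp_t} {L : orderType dL} {M : orderType dM}.

Definition cond : Type := (L * set M)%type.
Definition cdom (p : cond) : set M := p.2.
Definition cmap (h : M -> M) (p : cond) : cond := (p.1, h @` p.2).

Context (PP : set cond) (le : cond -> cond -> Prop).

Definition lub_in (A : set cond) (s : cond) : Prop :=
  [/\ PP s, forall a, A a -> le a s &
      forall t, PP t -> (forall a, A a -> le a t) -> le s t].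

Definition restr_candidate (p : cond) (a : M) (q : cond) : Prop :=
  [/\ PP q, le q p & cdom q = cdom p `&` below a].

Definition is_restr (p : cond) (a : M) (q : cond) : Prop :=
  restr_candidate p a q /\
  forall q', restr_candidate p a q' -> le q q' -> q' = q.

(* A sequence of length d < lambda is a function on L, only its values at
   i < d being relevant. *)
Definition increasing_seq (d : L) (p : L -> cond) : Prop :=
  (forall i, i < d -> PP (p i)) /\
  (forall i j, i <= j -> j < d -> le (p i) (p j)).

Record standard_uniform : Prop := StandardUniform {
  su_small : forall p, PP p -> pow_lt L [set: M] (cdom p);
  su_refl : forall p, PP p -> le p p;
  su_trans : forall p q r, PP p -> PP q -> PP r -> le p q -> le q r -> le p r;
  su_antisym : forall p q, PP p -> PP q -> le p q -> le q p -> p = q;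
  su_dom : forall p q, PP p -> PP q -> le p q -> cdom p `<=` cdom q;
  su_bound : forall p q r, PP p -> PP q -> PP r -> le p r -> le q r ->
    exists r', [/\ PP r', le p r', le q r', le r' r &
                   cdom r' = cdom p `|` cdom q];
  su_lub : forall (d : L) p, increasing_seq d p ->
    exists2 s, lub_in (p @` below d) s &
               cdom s = \bigcup_(i in below d) cdom (p i);
  su_restr : forall p (a : M), PP p -> exists! q, is_restr p a q;
  su_restr_limit : forall p (a : M) q, PP p -> is_limit a -> is_restr p a q ->
    lub_in [set r | exists2 b, b < a & is_restr p b r] q;
  su_restr_lub : forall (d : L) p s (a : M) q, increasing_seq d p ->
    lub_in (p @` below d) s -> is_restr s a q ->
    lub_in [set r | exists2 i, i < d & is_restr (p i) a r] q;
  su_indisc : forall p h v', PP p -> order_iso h (cdom p) v' ->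
    PP (cmap h p) /\
    forall q, PP q -> le q p -> le (cmap h q) (cmap h p);
  su_amalg : forall p q (a : M) r, PP p -> PP q -> is_restr p a r -> le r q ->
    cdom p `&` cdom q = cdom p `&` below a ->
    exists s, [/\ PP s, le p s & le q s]
}.

End Standard.

Arguments cond {dL dM} L M.

Section Game.
Context {dL dM dP : Order.disp_t}.
Context {L : orderType dL} {M : orderType dM} {P : porderType dP}.
Context (code : P -> cond L M).

(* [code] is an isomorphism from P onto some standard uniform partial order;
   domains and the action of order-isomorphisms are transported along it. *)
Definition uniform_via : Prop :=
  exists (PP : set (cond L M)) (le : cond L M -> cond L M -> Prop),
    [/\ standard_uniform PP le, injective code, range code = PP &
        forall p q : P, p <= q <-> le (code p) (code q)].

Definition dom (p : P) : set M := cdom (code p).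

(* [is_image h p q] means q = h[p]. *)
Definition is_image (h : M -> M) (p q : P) : Prop := code q = cmap h (code p).

Definition compatible (p q : P) : Prop := exists2 r : P, p <= r & q <= r.

Definition sub_order (a : M) : set P := [set p | dom p `<=` below a].

Definition Gen (a : M) : set (set P) := [set G |
  [/\ G `<=` sub_order a,
      forall p q, G q -> p <= q -> G p,
      forall Q, pow_lt L G Q -> exists2 r, G r & ubound Q r &
      forall p, sub_order a p -> ~ G p -> exists2 q, G q & ~ compatible p q]].

(* For G = set0 this is all of P. *)
Definition quot (G : set P) : set P :=
  [set p | forall r, G r -> compatible p r].

Definition is_minimal (C : set (set P)) (H : set P) : Prop :=
  C H /\ forall H', C H' -> H' `<=` H -> H' = H.

(* [G_below zeta G a c H] means H = G_{<a}, the ordinal c being the sup of the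
   zeta_b for b < a, so that H is in Gen(P_c) if a <> 0, while c = 0 and
   H = set0 if a = 0. *)
Definition G_below (zeta : M -> M) (G : M -> set P) (a c : M) (H : set P) :
    Prop :=
  [/\ isLub (zeta @` below a) c,
      below a = set0 -> H = set0 &
      below a !=set0 -> unique
        (is_minimal [set K | Gen c K /\ \bigcup_(b in below a) G b `<=` K]) H].

(* The values D u w matter only for u `<=` w with w of size < lambda. *)
Definition dsys : Type := set M -> set M -> set P.

Definition in_ddom (u w : set M) : Prop := u `<=` w /\ pow_lt L [set: M] w.

Record density_system (a : M) (G : set P) (D : dsys) : Prop := DensitySystem {
  ds_sub : forall u w, in_ddom u w ->
    D u w `<=` [set p | quot G p /\ dom p `<=` w];
  ds_up : forall u w p q, in_ddom u w -> quot G p -> quot G q ->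
    D u w p -> p <= q -> dom q `<=` w -> D u w q;
  ds_dense : forall u w p, in_ddom u w -> quot G p -> dom p `<=` w ->
    exists2 q, D u w q & p <= q;
  ds_invar : forall u1 w1 u2 w2 h, in_ddom u1 w1 -> in_ddom u2 w2 ->
    w1 `&` below a = w2 `&` below a -> order_iso h w1 w2 -> h @` u1 = u2 ->
    forall p q, quot G p -> dom p `<=` w1 -> is_image h p q ->
      (D u1 w1 p <-> D u2 w2 q)
}.

Definition meets (a : M) (G : set P) (D : dsys) : Prop :=
  forall u, pow_lt L (below a) u ->
    exists v, [/\ pow_lt L (below a) v, u `<=` v & G `&` D u v !=set0].

Definition moveI : Type := (P * set dsys)%type.
Definition moveII : Type := (M * set P)%type.

Definition legalI (x : M -> moveI) (y : M -> moveII) (a : M) : Prop :=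
  exists c H, [/\ G_below (fst \o y) (snd \o y) a c H,
                  quot H (x a).1,
                  (x a).2 #<= [set: L] &
                  forall D, (x a).2 D -> density_system c H D].

(* All requirements on II, sorted by the stage a at which II must meet them. *)
Definition goodII (x : M -> moveI) (y : M -> moveII) (a : M) : Prop :=
  [/\ Gen (y a).1 (y a).2,
      forall b, b < a -> (y b).1 <= (y a).1 /\ (y b).2 `<=` (y a).2,
      (y a).2 (x a).1 &
      forall b D, b <= a -> (x b).2 D -> meets (y a).1 (y a).2 D].

(* II has to meet the requirements of stage a as long as I has obeyed the rules
   up to and including stage a.  Requiring this at each stage, and not only in
   runs where I obeys the rules throughout, keeps II from winning by breaking
   the rules first and so leaving G_{<a} undefined, hence I without a move. *)
Definition winsII (x : M -> moveI) (y : M -> moveII) : Prop :=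
  forall a, (forall b, b <= a -> legalI x y b) -> goodII x y a.

Definition strategyII : Type :=
  forall a : M, ([set b | b <= a] -> moveI) -> (below a -> moveII) -> moveII.

Definition follows (s : strategyII) (x : M -> moveI) (y : M -> moveII) : Prop :=
  forall a, y a = s a (fun b => x (val b)) (fun b => y (val b)).

Definition winning (s : strategyII) : Prop :=
  forall x y, follows s x y -> winsII x y.

End Game.

(* Main.v *)
(* Player II builds each G_a as the ideal generated by a lambda-chain of
   conditions.  At successor stages the dense sets are met directly; the problem
   is G_<a for a of cofinality below lambda, which is determined by the earlier
   G_b although its new conditions have domain cofinal in the supremum.  For
   lambda > omega, Dl_lambda guesses, at each e < lambda, fewer than lambda
   isomorphism types ("shapes") of approximations (w, p) to the future ideals,
   |w| < lambda, each together with an instance of a density system.  A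
   commitment F assigns to every shape guessed at e a stronger condition F e t in
   the relevant dense set, coherently: shapes with the same restriction to an
   ordinal get conditions with the same restriction to it.  Whenever the chain
   generating G_a passes at step e through a shape t, II puts the copy of F e t
   into G_a.  By coherence the commitment is then kept, for almost all e (modulo
   clubs of lambda), by the ideals G_<a at limits, and since each approximation
   is guessed stationarily often, these ideals meet the density systems.
   Coherent commitments exist because a tree of fewer than lambda shapes can be
   laid out in M and amalgamated into one condition, below which a coherent
   system is recovered in omega steps.  New density systems arriving during the
   game lead to a strengthening F' of F; along the game the commitments increase
   modulo clubs, and diagonal least upper bounds continue them at limits.  For
   lambda = omega a finite set is never cofinal in a limit, so it is enough to
   make each G_a generic for the (countably many, up to isomorphism) tasks. *)

Require Import Defs.
From mathcomp Require Import all_boot all_order.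
From mathcomp Require Import boolp classical_sets functions cardinality.

Set Implicit Arguments.
Unset Strict Implicit.
Unset Printing Implicit Defensive.

Import Order.TTheory.

Local Open Scope card_scope.
Local Open Scope order_scope.
Local Open Scope classical_set_scope.

(** * Well-orders *)

(** An element of [Gen] is merely a maximal directed ideal. Hence P/G_<a need not admit
    amalgamation, and a density system played over an earlier G_b need not stay dense in P/G_<a: all
    extensions in D of some condition may be excluded by G_<a. Both defects have one cure. A
    commitment decides: it forces the trace of some q in D(u, W) above two given conditions r and
    r', or it excludes all such q. With r = r' this gives density of D. For the trivial system, in
    which everything is allowed, it decides whether r and r' have a common bound over the ideal, and
    this yields amalgamation. So good behaviour of G_<a is itself a task, posed at stage 0 and never
    dropped. A commitment speaks of collapsed shapes only and mentions no ideal, so the same F can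
    be read over every later pair (c, H); the invariance of density systems under order-isomorphisms
    then moves a decision made over one pair to any later one. Uncountability of lambda provides
    closure points of functions on lambda, and lubs of the omega rounds in which coherence is
    restored. *)

Definition pick_or {X : Type} (x0 : X) (Q : X -> Prop) : X :=
  if pselect (exists x, Q x) is left h then projT1 (cid h) else x0.

Lemma pick_orP {X : Type} (x0 : X) (Q : X -> Prop) :
  (exists x, Q x) -> Q (pick_or x0 Q).
Proof.
by move=> h; rewrite /pick_or; case: pselect => // h'; exact: projT2 (cid h').
Qed.

Lemma le_eq_lt {d : Order.disp_t} {T : porderType d} (x y : T) :
  x <= y -> x = y \/ x < y.
Proof. by rewrite le_eqVlt => /orP[/eqP|]; [left|right]. Qed.

Section WellOrder.
Context {d : Order.disp_t} {T : orderType d} (wf : well_ordered T).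

Lemma wo_ind (Q : T -> Prop) :
  (forall a, (forall b, b < a -> Q b) -> Q a) -> forall a, Q a.
Proof. by move=> h a; elim: (wf a) => {}a _; exact: h. Qed.

Lemma wo_least (S : set T) : S !=set0 ->
  exists2 m, S m & forall x, S x -> m <= x.
Proof.
case=> s; elim/wo_ind: s => s IH Ss.
have [[t tS ts]|h] := pselect (exists2 t, S t & t < s); first exact: IH ts tS.
by exists s => // x Sx; rewrite leNgt; apply/negP => xs; apply: h; exists x.
Qed.

Lemma wo_lub (S : set T) b : (forall x, S x -> x <= b) ->
  exists m, (forall x, S x -> x <= m) /\
            forall y, (forall x, S x -> x <= y) -> m <= y.
Proof.
move=> Sb; have [|m mS mlst] := @wo_least [set y | forall x, S x -> x <= y].
  by exists b.
by exists m; split => // y Sy; exact: mlst.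
Qed.

(** The history is handed over as a total function with value [x0] from [a] on; this keeps dependent
    types out of all later recursions. *)
Lemma wo_rec (X : Type) (x0 : X) (step : T -> (T -> X) -> X) :
  exists z : T -> X,
    forall a, z a = step a (fun b => if b < a then z b else x0).
Proof.
pose F a (rec : forall b, b < a -> X) : X :=
  step a (fun b => if pselect (b < a) is left h then rec b h else x0).
exists (Fix wf (fun _ => X) F) => a.
rewrite Fix_eq.
  by congr (step a); apply/funext => b; case: pselect => [->//|/negP/negPf->].
move=> x f g fg; rewrite /F; congr (step x); apply/funext => b.
by case: pselect.
Qed.

(* The recursion alternates limits [s j] of the [f i], i < j, with
   successor steps [s j <= f j]. *)
Lemma transfinite_chain (X : Type) (x0 : X) (le : X -> X -> Prop)
    (Lim : T -> (T -> X) -> X -> Prop) (V : T -> X -> Prop)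
    (S : T -> X -> X -> Prop) :
  (forall x y z, le x y -> le y z -> le x z) ->
  (forall j f f' s, (forall i, i < j -> f i = f' i) -> Lim j f s ->
     Lim j f' s) ->
  (forall j f s, Lim j f s -> forall i, i < j -> le (f i) s) ->
  (forall j f s, (forall i i', i < i' -> i' < j -> le (f i) (f i')) ->
     (forall i, i < j -> [/\ V i (s i), Lim i f (s i), le (s i) (f i) &
                             S i (s i) (f i)]) ->
     exists2 t, Lim j f t & V j t) ->
  (forall j s, V j s -> exists2 y, le s y & S j s y) ->
  exists s f : T -> X, forall j,
    [/\ V j (s j), Lim j f (s j), le (s j) (f j) & S j (s j) (f j)].
Proof.
move=> letr Lloc Lub Lex stp.
pose good a (f : T -> X) (sy : X * X) :=
  [/\ V a sy.1, Lim a f sy.1, le sy.1 sy.2 & S a sy.1 sy.2].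
have [z zE] := wo_rec (x0, x0)
  (fun a Z => pick_or (x0, x0) (good a (fun b => (Z b).2))).
exists (fun j => (z j).1), (fun j => (z j).2) => j.
elim/wo_ind: j => j IH.
have [t tL tV] := Lex j (fun i => (z i).2) (fun i => (z i).1)
  (fun i i' ii' i'j => let: And4 _ L l _ := IH i' i'j in
     letr _ _ _ (Lub _ _ _ L _ ii') l) IH.
have [y ty ySt] := stp j t tV.
set f := fun b => (if b < j then z b else (x0, x0)).2.
have ffE i : i < j -> (z i).2 = f i by rewrite /f => ->.
have [] : good j f (z j).
  rewrite zE; apply: pick_orP; exists (t, y); split => //.
  exact: Lloc tL.
by move=> zV zL zl zS; split => //; apply: Lloc zL => i /ffE ->.
Qed.

End WellOrder.

(** * Cardinal comparison through enumerations and injections *)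

Lemma card_le_enum {T U} (A : set T) (B : set U) :
  A !=set0 -> A #<= B -> exists f : U -> T, A = f @` B.
Proof.
by move=> /set0P/eqP A0 /pfcard_geP[//|/surjfunPex].
Qed.

Lemma enum_card_le {T U} (A : set T) (B : set U) (f : U -> T) :
  A `<=` f @` B -> A #<= B.
Proof.
by move=> /subset_card_le h; apply: (card_le_trans h); exact: card_image_le.
Qed.

Lemma card_le_inj {T U} (u0 : U) (A : set T) (B : set U) : A #<= B ->
  exists2 f : T -> U, (forall x, A x -> B (f x)) &
    forall x y, A x -> A y -> f x = f y -> x = y.
Proof.
have [->|/set0P A0] := eqVneq A set0; first by exists (fun=> u0).
move=> /(card_le_enum A0)[f Af]; rewrite Af.
have h x : (f @` B) x ->
    B (pick_or u0 (fun u => B u /\ f u = x)) /\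
    f (pick_or u0 (fun u => B u /\ f u = x)) = x.
  case=> u Bu fu; apply: (@pick_orP _ u0 (fun u => B u /\ f u = x)).
  by exists u.
exists (fun x => pick_or u0 (fun u => B u /\ f u = x)) => [x /h[]//|x y].
by move=> /h[_ {2}<-] /h[_ {2}<-] ->.
Qed.

Lemma inj_card_leT {T U} (A : set T) (f : T -> U) :
  (forall x y, A x -> A y -> f x = f y -> x = y) -> A #<= [set: U].
Proof.
move=> fI; have [->|/set0P[a Aa]] := eqVneq A set0; first exact: card_ge0.
apply: (@enum_card_le _ _ _ _ (fun u => pick_or a (fun x => A x /\ f x = u))).
move=> x Ax; exists (f x) => //.
have [] : A (pick_or a (fun y => A y /\ f y = f x)) /\
    f (pick_or a (fun y => A y /\ f y = f x)) = f x.
  by apply: (@pick_orP _ a (fun y => A y /\ f y = f x)); exists x.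
by move=> ? ?; apply: fI.
Qed.

(** * Strictly increasing maps on sets of ordinals *)

Definition smono {d : Order.disp_t} {M : orderType d} (h : M -> M) (v : set M) :
    Prop :=
  forall x y, v x -> v y -> x < y -> h x < h y.

Section StrictMono.
Context {d : Order.disp_t} {M : orderType d}.
Implicit Types (h : M -> M) (v : set M).

Lemma smono_le h v x y : smono h v -> v x -> v y -> (h x <= h y) = (x <= y).
Proof.
move=> hv vx vy; apply/idP/idP => [|xy].
  by apply: contraTT; rewrite -!ltNge; exact: hv.
by move: xy; rewrite le_eqVlt => /orP[/eqP->//|/(hv _ _ vx vy)/ltW].
Qed.

Lemma smono_lt h v x y : smono h v -> v x -> v y -> (h x < h y) = (x < y).
Proof. by move=> hv vx vy; rewrite !ltNge (smono_le hv vy vx). Qed.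

Lemma smono_inj h v x y : smono h v -> v x -> v y -> h x = h y -> x = y.
Proof.
move=> hv vx vy e; apply/eqP.
by rewrite eq_le -(smono_le hv vx vy) -(smono_le hv vy vx) e lexx.
Qed.

Lemma smono_sub h v w : v `<=` w -> smono h w -> smono h v.
Proof. by move=> vw hw x y /vw vx /vw vy; exact: hw. Qed.

Lemma smono_iso h v : smono h v -> order_iso h v (h @` v).
Proof.
by move=> hv; split=> // x y; rewrite !inE => vx vy; exact: smono_le hv vx vy.
Qed.

Lemma smono_inv h v : smono h v -> exists g, (forall x, v x -> g (h x) = x).
Proof.
move=> hv; exists (fun y => pick_or y (fun x => v x /\ h x = y)) => x vx.
have [v' e] := @pick_orP _ (h x) (fun x' => v x' /\ h x' = h x)
   (ex_intro _ x (conj vx erefl)).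
exact: smono_inj hv v' vx e.
Qed.

Lemma smono_inv_smono h v g : smono h v -> (forall x, v x -> g (h x) = x) ->
  smono g (h @` v).
Proof.
by move=> hv gK _ _ [x vx <-] [y vy <-]; rewrite (smono_lt hv vx vy) !gK.
Qed.

End StrictMono.


Section Genericity.
Context {dL dM dP : Order.disp_t}.
Context {L : orderType dL} {M : orderType dM} {P : porderType dP}.
Context {code : P -> cond L M}.
Hypothesis (HL : infinite_regular L) (HP : power_below_eq L).
Hypothesis (HM : is_successor_cardinal L M) (HU : uniform_via code).

Local Notation dom := (dom code).
Local Notation small A := (card_lt A [set: L]).

(** * Cardinal arithmetic below lambda and lambda^+ *)

Lemma L_wf : well_ordered L. Proof. by case: HL => [[]]. Qed.

Lemma below_small (a : L) : card_lt (below a) [set: L].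
Proof. by case: HL => [[_ h] _ _]. Qed.

Lemma small_bounded (A : set L) : card_lt A [set: L] ->
  exists m, forall x, A x -> x < m.
Proof.
move=> [_ nA]; apply: contrapT => h; apply: nA.
case: HL => _ _ /(_ A) reg; suff /reg : unbounded A by rewrite card_eq_le => /andP[].
move=> x; apply: contrapT => h'; apply: h; exists x => a Aa.
by rewrite ltNge; apply/negP => xa; apply: h'; exists a.
Qed.

Lemma small_sub {T} (A B : set T) : A `<=` B -> card_lt B [set: L] ->
  card_lt A [set: L].
Proof.
move=> /subset_card_le AB [B1 B2]; split; first exact: card_le_trans B1.
by move=> /card_le_trans/(_ AB).
Qed.

Lemma small_le {T U} (A : set T) (B : set U) : A #<= B ->
  card_lt B [set: L] -> card_lt A [set: L].
Proof.
move=> AB [B1 B2]; split; first exact: card_le_trans B1.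
by move=> /card_le_trans/(_ AB).
Qed.

Lemma small_image {T U} (f : T -> U) (A : set T) : card_lt A [set: L] ->
  card_lt (f @` A) [set: L].
Proof. exact: small_le (card_image_le _ _). Qed.

Lemma small_finite {T} (A : set T) : finite_set A -> card_lt A [set: L].
Proof.
move=> fA; have /infiniteP Li : infinite_set [set: L] by case: HL.
split; first by apply: card_le_trans Li; exact: finite_set_countable.
by move=> h; apply: (infinite_nat); apply: card_le_finite fA; exact: card_le_trans h.
Qed.

Lemma L_gt (a : L) : exists b, a < b.
Proof.
have [m h] := small_bounded (small_finite (finite_set1 a)).
by exists m; apply: h.
Qed.

Lemma L_inh : exists l : L, True.
Proof.
have /infinite_setN0[l _] : infinite_set [set: L] by case: HL.
by exists l.
Qed.

Lemma small_enum {T} (A : set T) : card_lt A [set: L] -> A !=set0 ->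
  exists (d : L) (f : L -> T), (forall i, A (f i)) /\ A `<=` f @` below d.
Proof.
move=> sA A0; have [l _] := L_inh.
have [g _ gI] := card_le_inj l sA.1.
have [m h] := small_bounded (small_image g sA).
case: A0 => a Aa; exists m, (fun i => pick_or a (fun x => A x /\ (g x = i))).
split=> [i|x Ax].
  have [[x xP]|nx] := pselect (exists x, A x /\ g x = i).
    by have [] := @pick_orP _ a (fun x => A x /\ (g x = i)) (ex_intro _ _ xP).
  by rewrite /pick_or; case: pselect => // ?.
exists (g x); first by apply: h; exists x.
have [] := @pick_orP _ a (fun y => A y /\ (g y = g x)) (ex_intro _ x (conj Ax erefl)).
by move=> ? ?; apply: gI.
Qed.

Lemma image_bounded (f : L -> L) (j : L) : exists m, forall i, i < j -> f i < m.
Proof.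
have [m h] := small_bounded (small_image f (below_small j)).
by exists m => i ij; apply: h; exists i.
Qed.

(** This is lambda^{<lambda} <= lambda in usable form: a total [f] together with a length [a] stands
    for the sequence [f] cut at [a]. *)
Lemma L_cut_code : exists2 g : (L -> L) * L -> L, True &
  forall f a f' a', g (f, a) = g (f', a') ->
    a = a' /\ forall x, x < a -> f x = f' x.
Proof.
have [l0 _] := L_inh.
move: HP; rewrite /power_below_eq card_eq_le => /andP[h _].
have [g _ gI] := card_le_inj l0 h.
pose F (s : (L -> L) * L) : {a : L & below a -> L} :=
  existT _ s.2 (fun x => s.1 (val x)).
pose ev (s : {a : L & below a -> L}) x :=
  if pselect (below (projT1 s) x) is left h then projT2 s (SigSub (mem_set h))
  else l0.
have evF f a x : x < a -> ev (F (f, a)) x = f x.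
  by move=> xa; rewrite /ev /=; case: pselect.
exists (fun s => g (F s)) => // f a f' a' /gI e; have {}e := e I I.
have aa : a = a' by have := congr1 (@projT1 _ _) e.
by split=> // x xa; rewrite -(evF f a x xa) e evF// -aa.
Qed.

(** A pair is coded as a sequence of length [l2] with value [i] at [l0] and [j] at [l1]. *)
Lemma L_pair : exists pr : L -> L -> L,
  forall i j i' j', pr i j = pr i' j' -> i = i' /\ j = j'.
Proof.
have [l0 _] := L_inh; have [l1 l01] := L_gt l0; have [l2 l12] := L_gt l1.
have [g _ gI] := L_cut_code.
exists (fun i j => g (fun x => if x == l0 then i else j, l2)) => i j i' j' /gI[_ h].
have := h _ (lt_trans l01 l12); rewrite eqxx => ->.
by have := h _ l12; rewrite gt_eqF.
Qed.

Lemma le_bigcup {I T} (D : set I) (F : I -> set T) :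
  D #<= [set: L] -> (forall i, D i -> F i #<= [set: L]) ->
  \bigcup_(i in D) F i #<= [set: L].
Proof.
move=> DL FL; have [pr prI] := L_pair; have [l0 _] := L_inh.
have [g _ gI] := card_le_inj l0 DL.
have /choice[h hI] : forall i, exists h : T -> L, D i -> forall x y,
    F i x -> F i y -> h x = h y -> x = y.
  move=> i; have [Di|nD] := pselect (D i); last by exists (fun=> l0).
  by have [h _ hI] := card_le_inj l0 (FL _ Di); exists h => _ x y; apply: hI.
have [->|/set0P[t0 [i0 Di0 Ft0]]] := eqVneq (\bigcup_(i in D) F i) set0.
  exact: card_ge0.
pose idx x := pick_or i0 (fun i => D i /\ F i x).
have idxP x : (\bigcup_(i in D) F i) x -> D (idx x) /\ F (idx x) x.
  case=> i Di Fx; apply: (@pick_orP _ i0 (fun i => D i /\ F i x)).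
  by exists i.
apply: (@inj_card_leT _ _ _ (fun x => pr (g (idx x)) (h (idx x) x))).
move=> x y /idxP[Dx Fx] /idxP[Dy Fy] /prI[/gI e].
by rewrite -e// in Fy *; apply: hI.
Qed.

(** Were the union mapped onto lambda, each piece would have a bounded image, and by regularity the
    bounds would again be bounded, say by [b]; then [b] is not attained. *)
Lemma small_bigcup {I T} (D : set I) (F : I -> set T) :
  card_lt D [set: L] -> (forall i, D i -> card_lt (F i) [set: L]) ->
  card_lt (\bigcup_(i in D) F i) [set: L].
Proof.
move=> sD sF; split.
  by apply: le_bigcup => [|i /sF[]//]; exact: sD.1.
have [l0 _] := L_inh.
move=> /card_le_enum[|g gE]; first by exists l0.
have /choice[m mP] : forall i, exists m, D i -> forall x, F i x -> g x < m.
  move=> i; have [Di|nD] := pselect (D i); last by exists l0.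
  have [m h] := small_bounded (small_image g (sF _ Di)).
  by exists m => _ x Fx; apply: h; exists x.
have [b bP] := small_bounded (small_image m sD).
have : [set: L] b by []; rewrite gE => -[x [i Di Fx] gx].
have := mP i Di x Fx; have : m i < b by apply: bP; exists i.
by rewrite gx => mb /lt_trans/(_ mb); rewrite ltxx.
Qed.

Lemma bigcup_bool {T} (A B : set T) :
  A `|` B = \bigcup_(b in [set: bool]) if b then A else B.
Proof.
apply/seteqP; split=> [x [Ax|Bx]|x [[] _]]; by [exists true|exists false|left|right].
Qed.

Lemma smallU {T} (A B : set T) : card_lt A [set: L] -> card_lt B [set: L] ->
  card_lt (A `|` B) [set: L].
Proof.
move=> sA sB; rewrite bigcup_bool; apply: small_bigcup => [|[] //].
exact/small_finite/finite_finset.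
Qed.

Lemma leU {T} (A B : set T) : A #<= [set: L] -> B #<= [set: L] ->
  A `|` B #<= [set: L].
Proof.
move=> sA sB; rewrite bigcup_bool; apply: le_bigcup => [|[] //].
exact: (small_finite finite_finset).1.
Qed.

Lemma le_setXT {T U} (A : set T) (B : set U) : A #<= [set: L] ->
  B #<= [set: L] -> A `*` B #<= [set: L].
Proof.
move=> sA sB; have -> : A `*` B = \bigcup_(a in A) ((fun b => (a, b)) @` B).
  apply/seteqP; split=> [[a b] [/= Aa Bb]|[_ _] [a Aa] [b Bb] [<- <-]//].
  by exists a => //; exists b.
by apply: le_bigcup => // a _; apply: card_le_trans (card_image_le _ _) sB.
Qed.

(** After an injection into lambda a small subset is bounded, so it is coded by its characteristic
    function cut at a bound. *)
Lemma leT_subsets {T} (A : set T) : A #<= [set: L] ->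
  [set B | B `<=` A /\ card_lt B [set: L]] #<= [set: L].
Proof.
move=> AL; have [l0 _] := L_inh; have [l1 l01] := L_gt l0.
have [g _ gI] := card_le_inj l0 AL; have [k _ kI] := L_cut_code.
have /choice[m mP] : forall B : set T, exists m,
    B `<=` A /\ card_lt B [set: L] -> forall x, B x -> g x < m.
  move=> B; have [[_ sB]|nB] := pselect (B `<=` A /\ card_lt B [set: L]);
    last by exists l0.
  by have [m h] := small_bounded (small_image g sB); exists m => _ x Bx; apply: h; exists x.
apply: (@inj_card_leT _ _ _ (fun B =>
  k (fun x => if `[< exists2 y, B y & g y = x >] then l1 else l0, m B))).
suff sub : forall B B', B `<=` A /\ card_lt B [set: L] ->
   B' `<=` A /\ card_lt B' [set: L] ->
   k (fun x => if `[< exists2 y, B y & g y = x >] then l1 else l0, m B) =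
   k (fun x => if `[< exists2 y, B' y & g y = x >] then l1 else l0, m B') ->
   B `<=` B'.
  by move=> B B' hB hB' e; apply/seteqP; split; apply: sub.
move=> B B' hB hB' /kI[_ h] x Bx; have := h (g x) (mP B hB x Bx).
case: asboolP => [_|[]]; last by exists x.
case: asboolP => [[y B'y /gI <-//]|_ e]; first exact: hB'.1; first exact: hB.1.
by rewrite e ltxx in l01.
Qed.

Lemma M_wf : well_ordered M. Proof. by case: HM. Qed.

Lemma below_le (a : M) : below a #<= [set: L].
Proof. by case: HM => _ h _. Qed.

Lemma M_bounded (A : set M) : A #<= [set: L] -> exists m, forall x, A x -> x < m.
Proof.
move=> AL; case: HM => _ _ [_ nM]; apply: contrapT => h; apply: nM.
have -> : [set: M] = \bigcup_(a in A) (below a `|` [set a]).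
  apply/seteqP; split=> // x _; apply: contrapT => nx; apply: h; exists x => a Aa.
  rewrite ltNge; apply/negP => xa; apply: nx; exists a => //.
  by move: xa; rewrite le_eqVlt => /orP[/eqP->|]; [right|left].
apply: le_bigcup => // a _; apply: leU; first exact: below_le.
exact: (small_finite (finite_set1 a)).1.
Qed.

Lemma M_gt (a : M) : exists b, a < b.
Proof.
have [m h] := M_bounded (small_finite (finite_set1 a)).1.
by exists m; apply: h.
Qed.

Lemma M_inh : exists m : M, True.
Proof. by have [m _] := M_bounded (card_ge0 M [set: L]); exists m. Qed.

Lemma M_bot : exists m0 : M, forall x, m0 <= x.
Proof.
have [m _] := M_inh; have [|m0 _ h] := wo_least M_wf (S := [set: M]).
  by exists m.
by exists m0 => x; apply: h.
Qed.


(** * Uniform partial orders *)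

Definition islub (A : set P) (s : P) : Prop :=
  (forall a, A a -> a <= s) /\ forall t, (forall a, A a -> a <= t) -> s <= t.

Lemma islub_uniq A s t : islub A s -> islub A t -> s = t.
Proof.
move=> [s1 s2] [t1 t2]; apply/eqP; rewrite eq_le.
by rewrite s2 // t2.
Qed.

Lemma dom_small p : small (dom p).
Proof.
have [PP [le [st _ rng _]]] := HU.
by have [|] := su_small st (p := code p); first by rewrite -rng; exists p.
Qed.

Lemma dom_le p q : p <= q -> dom p `<=` dom q.
Proof.
have [PP [le [st _ rng h]]] := HU.
by move/h; apply: (su_dom st); rewrite -rng; [exists p|exists q].
Qed.

Lemma bound2 p q r : p <= r -> q <= r ->
  exists r', [/\ p <= r', q <= r', r' <= r & dom r' = dom p `|` dom q].
Proof.
have [PP [le [st _ rng h]]] := HU; move=> /h pr /h qr.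
have PPc x : PP (code x) by rewrite -rng; exists x.
have [x []] := su_bound st (PPc p) (PPc q) (PPc r) pr qr.
rewrite -{1}rng => -[r' _ <-] /h p' /h q' /h r'' e.
by exists r'.
Qed.

Lemma amalg_ex p q r a : r <= p -> dom r = dom p `&` below a -> r <= q ->
  (forall r', r' <= p -> dom r' `<=` below a -> r' <= r) ->
  dom q `<=` below a -> exists s, p <= s /\ q <= s.
Proof.
have [PP [le [st inj rng h]]] := HU => rp er rq rmax qa.
have PPc x : PP (code x) by rewrite -rng; exists x.
have [|||s []] := su_amalg st (PPc p) (PPc q) (a := a) (r := code r).
- split; first by split=> //; exact/h.
  move=> q' [+ +]; rewrite -rng => -[r' _ <-] /h r'p e /h rr'; congr code.
  apply/eqP; rewrite eq_le rr' andbT; apply: rmax => //.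
  by rewrite /dom e => x [].
- exact/h.
- apply/seteqP; split=> [x [xp /qa]//|x xpa]; split; first by case: xpa.
  by apply: (dom_le rq); rewrite er.
by rewrite -rng => -[s' _ <-] /h ps /h qs; exists s'.
Qed.

(** Maximal candidates are greatest: any [r <= p] living below [a] is joined with [q] inside [p],
    the join is again a candidate, and by maximality it is [q]. *)
Lemma restr_ex p a : exists q,
  [/\ q <= p, dom q = dom p `&` below a &
      forall r, r <= p -> dom r `<=` below a -> r <= q].
Proof.
have [PP [le [st inj rng h]]] := HU.
have PPc x : PP (code x) by rewrite -rng; exists x.
have [q [[[]]]] := su_restr st a (PPc p).
rewrite -{1}rng => -[{}q _ <-] /h qp e mx _; exists q; split=> // r rp ra.
have [s [qs rs sp ds]] := bound2 qp rp.
suff <- : s = q by [].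
apply: inj; apply: mx; last exact/h.
split; [exact: PPc|exact/h|].
change (dom s = dom p `&` below a).
have e' : dom q = dom p `&` below a := e.
apply/seteqP; rewrite ds e'; split=> [x [//|xr]|x]; last by left.
by split; [exact: (dom_le rp)|exact: ra].
Qed.

Definition restr (p : P) (a : M) : P :=
  pick_or p (fun q => [/\ q <= p, dom q = dom p `&` below a &
      forall r, r <= p -> dom r `<=` below a -> r <= q]).

Lemma restrP p a : [/\ restr p a <= p, dom (restr p a) = dom p `&` below a &
      forall r, r <= p -> dom r `<=` below a -> r <= restr p a].
Proof. exact: (pick_orP _ (restr_ex p a)). Qed.

Lemma restr_le p a : restr p a <= p. Proof. by case: (restrP p a). Qed.

Lemma dom_restr p a : dom (restr p a) = dom p `&` below a.
Proof. by case: (restrP p a). Qed.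

Lemma dom_restrS p a : dom (restr p a) `<=` below a.
Proof. by rewrite dom_restr => x []. Qed.

Lemma le_restr r p a : r <= p -> dom r `<=` below a -> r <= restr p a.
Proof. by case: (restrP p a) => _ _; exact. Qed.

Lemma restr_mono p q a : p <= q -> restr p a <= restr q a.
Proof.
by move=> pq; apply: le_restr; [exact: le_trans (restr_le _ _) pq|exact: dom_restrS].
Qed.

Lemma restr_id p a : dom p `<=` below a -> restr p a = p.
Proof. by move=> pa; apply/eqP; rewrite eq_le restr_le le_restr. Qed.

Lemma restr_le2 p a b : (forall x, dom p x -> x < a -> x < b) ->
  restr p a <= restr p b.
Proof.
move=> ab; apply: le_restr; first exact: restr_le.
by rewrite dom_restr => x [/ab]; exact.
Qed.

Lemma restr_restr p a b : b <= a -> restr (restr p a) b = restr p b.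
Proof.
move=> ba; apply/eqP; rewrite eq_le restr_mono ?restr_le//=.
apply: le_restr; last exact: dom_restrS.
by apply: restr_le2 => x _ xb; exact: lt_le_trans xb ba.
Qed.

(** When [q] lives below [a], the condition on domains in the amalgamation axiom follows from
    [restr p a <= q]; the bound is then shrunk by [bound2]. *)
Lemma amalg p q a : restr p a <= q -> dom q `<=` below a ->
  exists s, [/\ p <= s, q <= s & dom s = dom p `|` dom q].
Proof.
move=> pq qa; have [h1 h2 h3] := restrP p a.
have [s [ps qs]] := amalg_ex h1 h2 pq h3 qa.
by have [s' [? ? _ ?]] := bound2 ps qs; exists s'.
Qed.

Lemma lub_in_islub PP le (A : set (cond L M)) (B : set P) s :
  range code = PP -> (forall p q : P, p <= q <-> le (code p) (code q)) ->
  (forall x, A x <-> exists2 p, B p & code p = x) ->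
  lub_in PP le A (code s) -> islub B s.
Proof.
move=> rng h AB [_ ub lst]; split=> [b Bb|t tub].
  by apply/h/ub/AB; exists b.
apply/h/lst; first by rewrite -rng; exists t.
by move=> x /AB[b Bb <-]; apply/h/tub.
Qed.

Lemma is_restrE PP le p a x : injective code ->
  range code = PP -> (forall p q : P, p <= q <-> le (code p) (code q)) ->
  is_restr PP le (code p) a x <-> x = code (restr p a).
Proof.
move=> inj rng h; have PPc z : PP (code z) by rewrite -rng; exists z.
have H : is_restr PP le (code p) a (code (restr p a)).
  split; first by split; [|exact/h/restr_le|exact: dom_restr].
  move=> x' [+ +]; rewrite -rng => -[q _ <-] /h qp e /h le'; congr code.
  apply/eqP; rewrite eq_le le' andbT; apply: le_restr => //.
  by rewrite /dom e => y [].
split=> [[[+ + +] mx]|->//]; rewrite -rng => -[q _ eq]; rewrite -{1}eq => /h qp dq.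
symmetry; apply: mx; first by case: H.
rewrite -eq; apply/h/le_restr => //.
by rewrite /dom eq dq => y [].
Qed.

Lemma restr_limit p a : is_limit a ->
  islub ((restr p) @` below a) (restr p a).
Proof.
move=> la; have [PP [le [st inj rng h]]] := HU.
have PPc x : PP (code x) by rewrite -rng; exists x.
have := su_restr_limit st (PPc p) la (iffRL (is_restrE p a _ inj rng h) erefl).
apply: (lub_in_islub rng h) => x; split.
  by move=> [b ba /(is_restrE p b _ inj rng h) ->]; exists (restr p b) => //; exists b.
by move=> [_ [b ba <-] <-]; exists b => //; apply/(is_restrE p b _ inj rng h).
Qed.

Lemma lub_seq (d : L) (p : L -> P) :
  (forall i j, i <= j -> j < d -> p i <= p j) ->
  exists s, [/\ islub (p @` below d) s, dom s = \bigcup_(i in below d) dom (p i) &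
    forall a, islub ((fun i => restr (p i) a) @` below d) (restr s a)].
Proof.
move=> pm; have [PP [le [st inj rng h]]] := HU.
have PPc x : PP (code x) by rewrite -rng; exists x.
have inc : increasing_seq PP le d (code \o p).
  by split=> [i _|i j ij jd]; [exact: PPc|apply/h/pm].
have [s sl ds] := su_lub st inc; have := sl => -[+ _ _]; rewrite -rng => -[s' _ e].
subst s; exists s'; split.
- apply: (lub_in_islub rng h) sl => x; split.
    by move=> [i id <-]; exists (p i) => //; exists i.
  by move=> [_ [i id <-] <-]; exists i.
- exact: ds.
move=> a; have := su_restr_lub st inc sl (iffRL (is_restrE s' a _ inj rng h) erefl).
apply: (lub_in_islub rng h) => x; split.
  move=> [i id /(is_restrE (p i) a _ inj rng h) ->].
  by exists (restr (p i) a) => //; exists i.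
by move=> [_ [i id <-] <-]; exists i => //; apply/(is_restrE (p i) a _ inj rng h).
Qed.

Lemma img_ex h p : smono h (dom p) ->
  exists q, is_image code h p q /\ forall p', p' <= p ->
    forall q', is_image code h p' q' -> q' <= q.
Proof.
move=> hm; have [PP [le [st inj rng hh]]] := HU.
have PPc x : PP (code x) by rewrite -rng; exists x.
have [] := su_indisc st (PPc p) (smono_iso hm).
rewrite -{1}rng => -[q _ e] mon; exists q; split=> // p' /hh pp q' e'.
by apply/hh; rewrite e' e; exact: mon.
Qed.

Definition img (h : M -> M) (p : P) : P := pick_or p (is_image code h p).

Lemma imgP h p : smono h (dom p) -> is_image code h p (img h p).
Proof. by move=> /img_ex[q [qi _]]; apply: pick_orP; exists q. Qed.

Lemma code_inj : injective code. Proof. by have [? [? [_ ]]] := HU. Qed.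

Lemma imgE h p q : smono h (dom p) -> is_image code h p q -> img h p = q.
Proof. by move=> /imgP e e'; apply: code_inj; rewrite e e'. Qed.

Lemma dom_img h p : smono h (dom p) -> dom (img h p) = h @` dom p.
Proof. by move=> /imgP e; rewrite /dom e. Qed.

Lemma img_le h p q : smono h (dom q) -> p <= q -> img h p <= img h q.
Proof.
move=> hq pq; have [r [ri rm]] := img_ex hq; rewrite (imgE hq ri).
by apply: rm (pq) _ _; apply: imgP; apply: smono_sub hq; exact: dom_le.
Qed.

Lemma img_ext h h' p : (forall x, dom p x -> h x = h' x) -> smono h (dom p) ->
  img h p = img h' p.
Proof.
move=> e hm; have hm' : smono h' (dom p).
  by move=> x y px py; rewrite -!e //; exact: hm.
apply: imgE => //; rewrite /is_image (imgP hm') /cmap; congr pair.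
by apply: eq_imagel => x px; rewrite e.
Qed.

Lemma smono_comp (h g : M -> M) (v : set M) : smono h v -> smono g (h @` v) -> smono (g \o h) v.
Proof. by move=> hv gv x y vx vy xy; apply: gv; [exists x|exists y|exact: hv]. Qed.

Lemma img_comp h g p : smono h (dom p) -> smono g (h @` dom p) ->
  img g (img h p) = img (g \o h) p.
Proof.
move=> hp gp; have gp' : smono g (dom (img h p)) by rewrite dom_img.
apply: imgE => //; rewrite /is_image (imgP (smono_comp hp gp)) (imgP hp) /cmap /=.
by rewrite image_comp.
Qed.

Lemma img_id h p : (forall x, dom p x -> h x = x) -> img h p = p.
Proof.
move=> e; have hm : smono h (dom p) by move=> x y px py; rewrite !e.
apply: imgE => //; rewrite /is_image /cmap.
have -> : h @` (code p).2 = (code p).2; last by case: (code p).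
rewrite -[RHS]image_id; apply: eq_imagel => x px; exact: e.
Qed.

Lemma img_inv h g p : smono h (dom p) -> (forall x, dom p x -> g (h x) = x) ->
  img g (img h p) = p.
Proof.
move=> hp gK; rewrite img_comp //; first exact: img_id.
exact: smono_inv_smono gK.
Qed.

Lemma le_img_inv h v p q : smono h v -> dom p `<=` v -> dom q `<=` v ->
  img h p <= img h q -> p <= q.
Proof.
move=> hv pv qv; have [g gK] := smono_inv hv.
have hp := smono_sub pv hv; have hq := smono_sub qv hv.
have gq : forall x, dom q x -> g (h x) = x by move=> x /qv; exact: gK.
move=> /(@img_le g); rewrite dom_img // => /(_ (smono_inv_smono hq gq)).
by rewrite !img_inv // => x /pv; exact: gK.
Qed.

Lemma img_surj h v r : smono h v -> dom r `<=` h @` v ->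
  exists2 p, dom p `<=` v & img h p = r.
Proof.
move=> hv rv; have [g gK] := smono_inv hv; have gm := smono_inv_smono hv gK.
have hg : forall y, dom r y -> h (g y) = y.
  by move=> y /rv[x vx <-]; rewrite gK.
have gr := smono_sub rv gm.
exists (img g r); last by apply: img_inv.
by rewrite dom_img // => _ [y /rv[x vx <-] <-]; rewrite gK.
Qed.

Lemma restr_img h p a b : smono h (dom p) ->
  (forall x, dom p x -> (h x < a) = (x < b)) ->
  restr (img h p) a = img h (restr p b).
Proof.
move=> hp ab; have hpb : smono h (dom (restr p b)).
  by apply: smono_sub hp; exact: dom_le (restr_le _ _).
apply/eqP; rewrite eq_le; apply/andP; split; last first.
  apply: le_restr; first exact: img_le (restr_le _ _).
  by rewrite dom_img // dom_restr => _ [x [px xb] <-]; rewrite /below/= ab.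
have dq : dom (restr (img h p) a) `<=` h @` dom (restr p b).
  rewrite !dom_restr dom_img // => _ [[x px <-] xa]; exists x => //; split=> //.
  by rewrite /below/= -ab.
have [p' p'v e] := img_surj hpb dq; rewrite -e; apply: img_le => //.
apply: le_restr; last by apply: subset_trans p'v _; exact: dom_restrS.
apply: (le_img_inv hp) => //.
  by apply: subset_trans p'v _; exact: dom_le (restr_le _ _).
by rewrite e; exact: restr_le.
Qed.


(** The least element is the lub of the empty sequence. *)
Lemma P_bot : exists p0 : P, (forall p, p0 <= p) /\ dom p0 = set0.
Proof.
have [PP [le [st inj rng h]]] := HU; have [l _] := L_inh.
have [l0 _ l0P] := wo_least L_wf (ex_intro [set: L] l I).
have no i : ~ i < l0 by move=> il; have := l0P i I; rewrite leNgt il.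
have [|s [+ _ sl] ds] := su_lub st (d := l0) (p := fun=> (l0, set0)).
  by split=> [i il|i j _ jl]; [case: (no i il)|case: (no j jl)].
rewrite -rng => -[p0 _ e]; subst s; exists p0; split=> [p|].
  apply/h/sl; first by rewrite -rng; exists p.
  by move=> x [i /no].
by rewrite /dom ds; apply/seteqP; split=> // x [i /no].
Qed.

Lemma empty_dom_restr p a : dom p = set0 -> restr p a = p.
Proof. by move=> e; apply: restr_id; rewrite e. Qed.

(** * Least upper bounds of small chains *)

Definition chain (A : set P) : Prop :=
  forall x y, A x -> A y -> x <= y \/ y <= x.

(** The strong lub: domain and all restrictions are computed termwise, as uniformity grants for
    increasing sequences. *)
Definition slub (A : set P) (s : P) : Prop :=
  [/\ islub A s, dom s = \bigcup_(x in A) dom x &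
      forall a, islub ((restr^~ a) @` A) (restr s a)].

Lemma slub_seq (d : L) (A : L -> set P) (g : L -> P) :
  (forall i, i < d -> slub (A i) (g i)) ->
  (forall i j, i <= j -> j < d -> g i <= g j) ->
  exists s, slub (\bigcup_(i in below d) A i) s.
Proof.
move=> gA /lub_seq[s [[s1 s2] ds rs]]; exists s; split.
- split=> [x [i id Ax]|t tP].
    by have [[/(_ x Ax)/le_trans -> //]] := gA i id; apply: s1; exists i.
  apply: s2 => _ [i id <-]; have [[_ h] _ _] := gA i id; apply: h => x Ax.
  by apply: tP; exists i.
- rewrite ds; apply/seteqP; split=> x.
    move=> [i id]; have [_ -> _] := gA i id => -[y Ay yx].
    by exists y => //; exists i.
  move=> [y [i id Ay] yx]; exists i => //; have [_ -> _] := gA i id.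
  by exists y.
- move=> a; have [r1 r2] := rs a; split=> [_ [x [i id Ax] <-]|t tP].
    have [_ _ /(_ a)[h _]] := gA i id; apply: le_trans (h _ _) (r1 _ _).
      by exists x.
    by exists i.
  apply: r2 => _ [i id <-]; have [_ _ /(_ a)[_ h]] := gA i id.
  by apply: h => _ [x Ax <-]; apply: tP; exists x => //; exists i.
Qed.

Lemma slub_max A m : A m -> (forall x, A x -> x <= m) -> slub A m.
Proof.
move=> Am mx; split; first by split=> // t; apply.
  by apply/seteqP; split=> [x xm|x [y /mx/dom_le]]; [exists m|apply].
move=> a; split=> [_ [x Ax <-]|t]; first exact/restr_mono/mx.
by apply; exists m.
Qed.

Lemma slub0 p0 : (forall p, p0 <= p) -> dom p0 = set0 -> slub set0 p0.
Proof.
move=> b e; split; first by split=> // t _.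
  by rewrite bigcup_set0.
by move=> a; rewrite image_set0 empty_dom_restr //; split=> // t _.
Qed.

Lemma slub_eq A B s : A = B -> slub A s -> slub B s. Proof. by move=> ->. Qed.

(** A chain need not be well-ordered by the order of P. It is enumerated as [f i], [i < d]; by
    induction on [d], the lubs of its initial segments exist, and they form an increasing
    sequence. *)
Lemma chain_lub A : small A -> chain A -> exists s, slub A s.
Proof.
move=> sA cA; have [->|/set0P A0] := eqVneq A set0.
  by have [p0 [? ?]] := P_bot; exists p0; exact: slub0.
have [d [f [fA Af]]] := small_enum sA A0.
have -> : A = f @` below d.
  by apply/seteqP; split=> // _ [i _ <-].
elim/(wo_ind L_wf): d {Af} => j IH.
have /choice[S SP] : forall i, exists s, i < j -> slub (f @` below i) s.
  move=> i; have [ij|] := boolP (i < j); last by exists (f i).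
  by have [s sP] := IH i ij; exists s.
(* In a chain, [f i] is either above all earlier terms or below one of them, hence below their lub
   [S i]; in both cases [g i] is the lub of the terms up to [i]. *)
pose g i := if f i <= S i then S i else f i.
have gA i : i < j -> slub (f @` [set k | k <= i]) (g i).
  move=> ij; have [[s1 s2] ds rs] := SP i ij; rewrite /g.
  have sub x : (f @` [set k | k <= i]) x -> (f @` below i) x \/ x = f i.
    move=> [k /= /le_eq_lt[->|ki] <-]; [by right|left].
    by exists k.
  have sub' x : (f @` below i) x -> (f @` [set k | k <= i]) x.
    by move=> [k /ltW ki <-]; exists k.
  case: ifPn => [fS|nfS]; last first.
    apply: slub_max => [|_ [k ki <-]]; first by exists i => /=.
    have [//|ik] := cA _ _ (fA k) (fA i).
    have [->//|ki'] := le_eq_lt (ki : k <= i).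
    by case/negP: nfS; apply: le_trans ik (s1 _ _); exists k.
  split; first split.
  - by move=> x /sub[/s1//|->].
  - by move=> t tP; apply: s2 => x /sub'/tP.
  - rewrite ds; apply/seteqP; split=> x [y Ay yx].
      by exists y => //; exact: sub'.
    case: (sub _ Ay) => [|ey]; first by exists y.
    by rewrite -ds; apply: (dom_le fS); rewrite -ey.
  - move=> a; have [r1 r2] := rs a; split=> [_ [x /sub[xA|->] <-]|t tP].
    + by apply: r1; exists x.
    + exact: restr_mono.
    + by apply: r2 => _ [x /sub' xA <-]; apply: tP; exists x.
have [|s sP] := slub_seq gA.
  move=> i i' ii' i'j; have [[_ h] _ _] := gA i (le_lt_trans ii' i'j).
  have [[h' _] _ _] := gA i' i'j; apply: h => _ [k ki <-]; apply: h'.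
  by exists k => //=; exact: le_trans ki ii'.
exists s; apply: slub_eq sP; apply/seteqP; split=> x.
  by move=> [i ij [k /= ki <-]]; exists k => //; exact: le_lt_trans ki ij.
by move=> [i ij <-]; exists i => //; exists i => /=.
Qed.

Lemma islub_slub A s : small A -> chain A -> islub A s -> slub A s.
Proof.
move=> sA cA sl; have [s' [l1 l2 l3]] := chain_lub sA cA.
by rewrite (islub_uniq sl l1).
Qed.

(** This reaches [R] even when no single [z] clears [dom p] below [a]: the supremum of that part of
    [dom p] is then a limit, where restriction is continuous, so [restr p a] is a lub of
    restrictions already below [R]. The hypothesis on [m0] takes care of an empty part. *)
Lemma restr_cover p a R m0 : (forall x : M, m0 <= x) -> restr p m0 <= R ->
  (forall y, dom p y -> y < a -> exists2 z, y < z & restr p z <= R) ->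
  restr p a <= R.
Proof.
move=> m0P p0 cov; apply: contrapT => npa.
have H z : restr p z <= R -> exists2 y, dom p y /\ y < a & z <= y.
  move=> pz; apply: contrapT => h; apply: npa; apply: le_trans pz.
  apply: restr_le2 => x px xa; rewrite ltNge; apply/negP => zx.
  by apply: h; exists x.
have [|dl [ub lst]] := wo_lub M_wf (S := dom p `&` below a) (b := a).
  by move=> x [_ /ltW].
have lt y : dom p y -> y < a -> y < dl.
  move=> py ya; have [z yz /H[y' [py' y'a] zy']] := cov y py ya.
  by apply: lt_le_trans yz _; apply: le_trans zy' (ub _ _).
have lim : is_limit dl.
  split; first by have [y [py ya] _] := H _ p0; exists y; exact: lt.
  move=> x xd; apply: contrapT => h.
  suff : dl <= x by rewrite leNgt xd.
  apply: lst => y [py ya]; rewrite leNgt; apply/negP => xy.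
  by apply: h; exists y => //; exact: lt.
apply: npa; apply: (@le_trans _ _ (restr p dl)); first by apply: restr_le2 => x; exact: lt.
have [_ h] := restr_limit p lim; apply: h => _ [b bd <-].
have [y [py ya] bb] : exists2 y, dom p y /\ y < a & b < y.
  apply: contrapT => h; suff : dl <= b by rewrite leNgt bd.
  apply: lst => y [py ya]; rewrite leNgt; apply/negP => xy.
  by apply: h; exists y.
have [z yz pz] := cov y py ya; apply: le_trans pz; apply: restr_le2 => x _ xb.
exact: lt_trans (lt_trans xb bb) yz.
Qed.

(** The elements of [A] are joined one after the other inside [R], with lubs at limits; the domain
    never leaves the union of their domains. *)
Lemma bound_in (A : set P) R : small A -> (forall x, A x -> x <= R) ->
  exists r, [/\ r <= R, forall x, A x -> x <= r & dom r `<=` \bigcup_(x in A) dom x].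
Proof.
move=> sA AR; have [A0|/set0P A0] := eqVneq A set0.
  have [p0 [p0P e]] := P_bot; exists p0; split=> //; last by rewrite e.
  by rewrite A0.
have [d [f [fA Af]]] := small_enum sA A0.
pose U := \bigcup_(x in A) dom x.
have [||||| s [g sg]] := @transfinite_chain _ _ L_wf _ R (fun x y => x <= y)
  (fun j g s => islub (g @` below j) s) (fun j s => s <= R /\ dom s `<=` U)
  (fun j s y => f j <= y /\ (y <= R /\ dom y `<=` U)).
- by move=> x y z; exact: le_trans.
- by move=> j g g' s e; rewrite (eq_imagel (f' := g')).
- by move=> j g s [h _] i ij; apply: h; exists i.
- move=> j g s mon st.
  have [|t [tl dt _]] := @lub_seq j g.
    by move=> i i' /le_eq_lt[->//|ii'] i'j; exact: mon.
  exists t => //; split.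
    by case: tl => _; apply=> _ [i ij <-]; have [_ _ _ [_ []]] := st i ij.
  by rewrite dt => x [i ij]; have [_ _ _ [_ [_]]] := st i ij; exact.
- move=> j s [sR sU]; have [r [? ? ? e]] := bound2 (AR _ (fA j)) sR.
  exists r => //; split=> //; split=> //; rewrite e => x [fx|/sU//].
  by exists (f j).
have [[sR sU] [ub _] _ _] := sg d; exists (s d); split=> // x /Af[i id <-].
have [_ _ _ [h _]] := sg i; apply: le_trans h (ub _ _); exists i => //.
Qed.

(** The lub of the images has its domain inside the image of [dom s], so it can be pulled back along
    [h] and compared with [s]. *)
Lemma lub_img h A s : small A -> chain A -> islub A s -> smono h (dom s) ->
  islub (img h @` A) (img h s).
Proof.
move=> sA cA sl hs; have [_ ds _] := islub_slub sA cA sl; case: sl => s1 s2.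
have Ad x : A x -> dom x `<=` dom s by move=> /s1/dom_le.
split=> [_ [x Ax <-]|t tP]; first by apply: img_le (s1 _ Ax).
have [||s' [[l1 l2] l3 _]] := @chain_lub (img h @` A).
- exact: small_image.
- move=> _ _ [x Ax <-] [y Ay <-]; have [xy|yx] := cA _ _ Ax Ay; [left|right].
    by apply: img_le xy; apply: smono_sub hs; exact: Ad.
  by apply: img_le yx; apply: smono_sub hs; exact: Ad.
apply: (@le_trans _ _ s'); last exact: l2.
have [|s'' s''d e] := @img_surj h (dom s) s' hs.
  rewrite l3 => y [_ [x Ax <-]]; rewrite dom_img; last by apply: smono_sub hs; exact: Ad.
  by move=> [z xz <-]; exists z => //; exact: Ad xz.
rewrite -e; apply: img_le; first by apply: smono_sub hs.
apply: s2 => x Ax; apply: (le_img_inv hs) => //; first exact: Ad.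
by rewrite e; apply: l1; exists x.
Qed.


(** * Collapse and enumeration of subsets of lambda^+ *)

Lemma rk_ex (W : set M) : exists r : M -> M, forall x,
  (forall z, W z -> z < x -> r z < r x) /\
  (forall y, (forall z, W z -> z < x -> r z < y) -> r x <= y).
Proof.
have [m0 m0P] := M_bot.
pose ub x (r : M -> M) y := forall z, W z -> z < x -> r z < y.
pose good x r y := ub x r y /\ forall y', ub x r y' -> y <= y'.
have [r rE] := wo_rec M_wf m0 (fun x r => pick_or m0 (good x r)).
exists r => x.
have ubE y : ub x (fun b => if b < x then r b else m0) y <-> ub x r y.
  by split=> h z Wz zx; have := h z Wz zx; rewrite zx.
suff : good x r (r x) by [].
have : good x (fun b => if b < x then r b else m0) (r x).
  rewrite rE; apply: pick_orP.
  have [|y uy ymin] := wo_least M_wf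
    (S := ub x (fun b => if b < x then r b else m0)); last by exists y.
  have [b bP] := M_bounded (card_le_trans (card_image_le r (below x)) (below_le x)).
  by exists b => z Wz zx; rewrite zx; apply: bP; exists z.
by move=> [/ubE h1 h2]; split=> // y' /ubE; exact: h2.
Qed.

(* [rk W x] is the order type of [W] below [x]; on [W] it is the collapse. *)
Definition rk (W : set M) : M -> M :=
  pick_or id (fun r => forall x, (forall z, W z -> z < x -> r z < r x) /\
  (forall y, (forall z, W z -> z < x -> r z < y) -> r x <= y)).

Lemma rk_lt W z x : W z -> z < x -> rk W z < rk W x.
Proof. by have [h _] := pick_orP id (rk_ex W) x; exact: h. Qed.

Lemma rk_min W x y : (forall z, W z -> z < x -> rk W z < y) -> rk W x <= y.
Proof. by have [_ h] := pick_orP id (rk_ex W) x; exact: h. Qed.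

Lemma rk_smono W : smono (rk W) W.
Proof. by move=> x y Wx _; exact: rk_lt. Qed.

Lemma rk_le W x y : x <= y -> rk W x <= rk W y.
Proof.
by move=> xy; apply: rk_min => z Wz zx; apply: rk_lt => //; exact: lt_le_trans zx xy.
Qed.

Lemma rk_init W x v : v < rk W x -> exists z, [/\ W z, z < x & rk W z = v].
Proof.
elim/(wo_ind M_wf): x => x IH vx.
have [z [Wz zx vz]] : exists z, [/\ W z, z < x & v <= rk W z].
  apply: contrapT => h; suff : rk W x <= v by rewrite leNgt vx.
  apply: rk_min => z Wz zx; rewrite ltNge; apply/negP => vz.
  by apply: h; exists z.
have [->|vz'] := le_eq_lt vz; first by exists z.
have [z' [? z'z ?]] := IH z zx vz'; exists z'; split=> //; exact: lt_trans z'z zx.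
Qed.

Lemma rk_ext W W' x : (forall z, z < x -> W z <-> W' z) -> rk W x = rk W' x.
Proof.
elim/(wo_ind M_wf): x => x IH e.
have e' z : z < x -> rk W z = rk W' z.
  by move=> zx; apply: IH => // y yz; apply: e; exact: lt_trans yz zx.
apply/eqP; rewrite eq_le; apply/andP; split; apply: rk_min => z Wz zx.
  by rewrite e' //; apply: rk_lt => //; apply/e.
by rewrite -e' //; apply: rk_lt => //; apply/e.
Qed.

Lemma rk_iso W g x : smono g W -> W x -> rk (g @` W) (g x) = rk W x.
Proof.
move=> gm; elim/(wo_ind M_wf): x => x IH Wx.
apply/eqP; rewrite eq_le; apply/andP; split; apply: rk_min => z.
  move=> [y Wy <-]; rewrite (smono_lt gm Wy Wx) => yx.
  by rewrite IH //; exact: rk_lt.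
by move=> Wz zx; rewrite -IH //; apply: rk_lt; [exists z|exact: gm].
Qed.

Lemma rk_id x : rk [set: M] x = x.
Proof.
elim/(wo_ind M_wf): x => x IH; apply/eqP; rewrite eq_le; apply/andP; split.
  by apply: rk_min => z _ zx; rewrite IH.
rewrite leNgt; apply/negP => rx; have := rk_lt (W := setT) I rx.
by rewrite (IH _ rx) ltxx.
Qed.

Definition en (W : set M) (y : M) : M := pick_or y (fun x => W x /\ rk W x = y).

Section Enumeration.
Variables (W : set M) (Wub : forall y, exists2 x, W x & y < x).

(** If [y] were not attained, [W] would embed into the predecessors of [y], have size at most
    lambda, and be bounded. *)
Lemma enP y : W (en W y) /\ rk W (en W y) = y.
Proof.
apply: (@pick_orP _ y (fun x => W x /\ rk W x = y)).
apply: contrapT => h.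
have lt x : W x -> rk W x < y.
  move=> Wx; case: (ltgtP (rk W x) y) => // [/rk_init[z [? _ ?]]|e].
    by case: h; exists z.
  by case: h; exists x.
have : W #<= [set: L].
  apply: card_le_trans (below_le y); apply: (enum_card_le (f := en W)) => x Wx.
  exists (rk W x); first exact: lt.
  have [Wz e] := @pick_orP _ (rk W x) (fun z => W z /\ rk W z = rk W x)
    (ex_intro _ x (conj Wx erefl)).
  exact: (smono_inj (@rk_smono W) Wz Wx e).
by move=> /M_bounded[b bP]; have [x /bP xb /(lt_trans xb)] := Wub b; rewrite ltxx.
Qed.

Lemma en_in y : W (en W y). Proof. by case: (enP y). Qed.

Lemma rk_en y : rk W (en W y) = y. Proof. by case: (enP y). Qed.

Lemma en_rk x : W x -> en W (rk W x) = x.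
Proof.
by move=> Wx; apply: (smono_inj (@rk_smono W) (en_in _) Wx); rewrite rk_en.
Qed.

Lemma en_lt x y : x < y -> en W x < en W y.
Proof.
move=> xy; rewrite -(smono_lt (@rk_smono W) (en_in _) (en_in _)).
by rewrite !rk_en.
Qed.

Lemma en_smono v : smono (en W) v.
Proof. by move=> x y _ _; exact: en_lt. Qed.

Lemma en_ltE x y : (en W x < en W y) = (x < y).
Proof. by apply: (@smono_lt _ _ _ setT) => //; exact: en_smono. Qed.

Lemma en_ge y : y <= en W y.
Proof.
elim/(wo_ind M_wf): y => y IH; rewrite leNgt; apply/negP => yy.
have /(IH _) : en W y < y by [].
by rewrite leNgt (en_lt yy).
Qed.

End Enumeration.

(** Adding everything from [c] on makes the set unbounded, so that its enumeration is a total
    strictly increasing map on M. *)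
Definition top (c : M) (w : set M) : set M := [set x | w x \/ c <= x].

Lemma top_ub c w y : exists2 x, top c w x & y < x.
Proof.
have [x yx] := M_gt (Order.max y c); move: yx; rewrite gt_max => /andP[yx /ltW cx].
by exists x => //; right.
Qed.

(* [hh c w] copies an ordinal of order type [w] onto [w], when [w] lies below
   [c], and what comes next above [c]; [th c w] is the order type of [w]. *)
Definition hh (c : M) (w : set M) : M -> M := en (top c w).
Definition th (c : M) (w : set M) : M := rk (top c w) c.

Lemma hh_lt c w x y : x < y -> hh c w x < hh c w y.
Proof. exact: (en_lt (top_ub c w)). Qed.

Lemma hh_smono c w v : smono (hh c w) v.
Proof. by move=> x y _ _; exact: hh_lt. Qed.

Lemma hh_ltE c w x y : (hh c w x < hh c w y) = (x < y).
Proof. exact: (en_ltE (top_ub c w)). Qed.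

Lemma hh_th c w : hh c w (th c w) = c.
Proof. by apply: (en_rk (top_ub c w)); right. Qed.

Lemma hh_ltc c w x : (hh c w x < c) = (x < th c w).
Proof. by rewrite -{2}(hh_th c w) (en_ltE (top_ub c w)). Qed.

Lemma hh_below c w : w `<=` below c -> hh c w @` below (th c w) = w.
Proof.
move=> wc; apply/seteqP; split=> [_ [x xt <-]|x wx].
  have [//|] := en_in (top_ub c w) x; rewrite -/(hh c w x) leNgt hh_ltc.
  by rewrite (xt : x < _).
exists (rk (top c w) x); last by apply: (en_rk (top_ub c w)); left.
by apply: rk_lt; [left|exact: wc].
Qed.

(** Up to [c] the two sets [top] have the same elements, so their collapses agree there, and the
    enumerations agree as long as their values stay below [c]. *)
Lemma hh_agree c w c' w' : c <= c' -> w = w' `&` below c ->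
  [/\ th c w <= th c' w',
      forall x, x < th c w -> hh c' w' x = hh c w x &
      forall x, (hh c' w' x < c) = (x < th c w)].
Proof.
move=> cc e.
have ee x : x <= c -> rk (top c w) x = rk (top c' w') x.
  move=> xc; apply: rk_ext => z zx; have zc := lt_le_trans zx xc.
  rewrite /top/= e; split=> -[h|h].
  - by left; case: h.
  - by rewrite leNgt zc in h.
  - by left.
  - by move: (le_trans cc h); rewrite leNgt zc.
have H x : x < th c w -> hh c' w' x = hh c w x.
  move=> xt; have hc : hh c w x < c by rewrite hh_ltc.
  have [wx|] := en_in (top_ub c w) x; last by rewrite -/(hh c w x) leNgt hc.
  rewrite -/(hh c w x) in wx.
  have w'x : top c' w' (hh c w x) by left; move: wx; rewrite e => -[].
  rewrite -(en_rk (top_ub c' w') w'x) -ee ?(ltW hc) //.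
  by rewrite (rk_en (top_ub c w)).
split=> //.
  have -> : th c w = rk (top c' w') c by rewrite /th ee.
  have [->//|cc'] := le_eq_lt cc.
  apply: rk_min => z tz zc; apply: rk_lt => //; exact: lt_trans zc cc'.
move=> x; apply/idP/idP => [xc|xt]; last by rewrite H // hh_ltc.
have [w'x|] := en_in (top_ub c' w') x; last first.
  by rewrite -/(hh c' w' x) leNgt (lt_le_trans xc cc).
rewrite -/(hh c' w' x) in w'x.
rewrite -[x](rk_en (top_ub c' w')) -/(hh c' w' x) -ee ?ltW //.
by apply: rk_lt => //; left; rewrite e.
Qed.


(** * Generic ideals and their quotients *)

Lemma compat_le (p p' q : P) : p' <= p -> compatible p q -> compatible p' q.
Proof. by move=> pp [r pr qr]; exists r => //; exact: le_trans pr. Qed.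

Local Notation Gen := (Gen code).

Section GenericIdeal.
Variables (c : M) (H : set P) (HG : Gen c H).

Lemma gen_sub p : H p -> dom p `<=` below c. Proof. by case: HG => h _ _ _ /h. Qed.

Lemma gen_down p q : H q -> p <= q -> H p. Proof. by case: HG => _ h _ _; exact: h. Qed.

Lemma gen_ub Q : small Q -> Q `<=` H -> exists2 r, H r & forall x, Q x -> x <= r.
Proof. by case: HG => _ _ h _ sQ QH; have [//|r Hr ub] := h Q; exists r. Qed.

Lemma gen_ub2 p q : H p -> H q -> exists r, [/\ H r, p <= r & q <= r].
Proof.
move=> Hp Hq; have [|x [->|->]//|r Hr ub] := @gen_ub [set p; q].
  exact/small_finite/finite_set2.
by exists r; split=> //; apply: ub; [left|right].
Qed.

Lemma gen_in p : dom p `<=` below c -> quot H p -> H p.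
Proof.
move=> pc pH; apply: contrapT => np; case: HG => _ _ _ h.
by have [q Hq []] := h p pc np; exact: pH.
Qed.

(** One direction is maximality of [H]. For the other, an element of [H] above both [restr p c] and
    [r] is amalgamated with [p]. *)
Lemma gen_quot p : quot H p <-> H (restr p c).
Proof.
split=> [pH|Hp r Hr].
  apply: gen_in; first exact: dom_restrS.
  by move=> r /pH; apply: compat_le; exact: restr_le.
have [r' [Hr' pr rr]] := gen_ub2 Hp Hr.
have [s [ps rs _]] := amalg pr (gen_sub Hr').
by exists s => //; exact: le_trans rr rs.
Qed.

Lemma gen_sub_quot p : H p -> quot H p.
Proof. by move=> Hp; apply/gen_quot; rewrite restr_id //; exact: gen_sub. Qed.

End GenericIdeal.

(** The positions over which player I plays density systems: the start of the game, with [c] zero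
    and no ideal yet, or a generic ideal. *)
Definition base (c : M) (H : set P) : Prop :=
  (H = set0 /\ forall x, c <= x) \/ Gen c H.

Lemma quot0 (p : P) : quot set0 p. Proof. by []. Qed.

Lemma quot_down (H : set P) p q : q <= p -> quot H p -> quot H q.
Proof. by move=> qp pH r /pH; exact: compat_le. Qed.

Lemma quot_anti (H H' : set P) p : H `<=` H' -> quot H' p -> quot H p.
Proof. by move=> HH pH r /HH/pH. Qed.

Section Base.
Variables (c : M) (H : set P) (HB : base c H).

Lemma base_quot p : quot H p <-> quot H (restr p c).
Proof.
case: HB => [[-> _]|HG]; first by split=> _; exact: quot0.
by rewrite !(gen_quot HG) restr_restr.
Qed.

Lemma base_sub p : H p -> dom p `<=` below c.
Proof. by case: HB => [[-> //]|/gen_sub]; exact. Qed.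

Lemma base_quot_restr p a : c <= a -> quot H (restr p a) <-> quot H p.
Proof. by move=> ca; rewrite base_quot restr_restr // -base_quot. Qed.

Lemma base_lub A s : small A -> chain A -> islub A s -> A `<=` quot H -> quot H s.
Proof.
case: HB => [[-> _] *|HG sA cA sl AH]; first exact: quot0.
apply/(gen_quot HG).
have [_ _ /(_ c)[_ h]] := islub_slub sA cA sl.
have [||r Hr ub] := gen_ub HG (Q := (restr^~ c) @` A).
- exact: small_image.
- by move=> _ [x /AH/(gen_quot HG) Hx <-].
by apply: (gen_down HG Hr); exact: h.
Qed.

End Base.

Lemma gen_mono c H c' H' p : base c H -> Gen c' H' -> H `<=` H' ->
  dom p `<=` below c -> H' p -> H !=set0 -> H p.
Proof.
case=> [[-> _] _ _ _ _ [x]//|HG HG' HH pc H'p _].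
by apply: (gen_in HG) => // ; apply: quot_anti HH _; exact: gen_sub_quot HG' _ H'p.
Qed.

(* An element of [Gen c] is only a maximal ideal, so P/H need not be closed
   under amalgamation; player II has to keep its ideals nice.  [decisive] below
   is a genericity property which ensures this. *)
Record nice (c : M) (H : set P) : Prop := Nice {
  nice_ideal : forall n p, H n -> quot H p ->
    exists r, [/\ quot H r, p <= r, n <= r & dom r = dom p `|` dom n];
  nice_amalg : forall p n a, c <= a -> quot H p -> quot H n -> restr p a <= n ->
    dom n `<=` below a ->
    exists r, [/\ quot H r, p <= r, n <= r & dom r = dom p `|` dom n];
  nice_decide : forall p q, quot H q -> exists q',
    [/\ quot H q', q <= q', p <= q' \/ ~ compatible p q' &
        dom q' `<=` dom p `|` dom q `|` below c]
}.

Lemma nice0 c : nice c set0.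
Proof.
split=> [n p []|p n a _ _ _ pn na|p q _].
  by have [r [? ? ?]] := amalg pn na; exists r; split=> //; exact: quot0.
have [[r pr qr]|npq] := pselect (compatible p q).
  have [r' [? ? _ e]] := bound2 pr qr.
  by exists r'; split=> //; [left|rewrite e => x; left].
by exists q; split=> //; [right|move=> x ?; left; right].
Qed.

Definition decisive (c : M) (H : set P) : Prop := forall p p', exists2 n, H n &
  (exists q, [/\ p <= q, p' <= q & restr q c <= n]) \/
  (forall q, p <= q -> p' <= q -> ~ compatible (restr q c) n).

Lemma bound2_quot (H : set P) p q r : p <= r -> q <= r -> quot H r ->
  exists r', [/\ quot H r', p <= r', q <= r' & dom r' = dom p `|` dom q].
Proof.
move=> pr qr rH; have [r' [? ? r'r ?]] := bound2 pr qr.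
by exists r'; split=> //; exact: quot_down r'r rH.
Qed.

(** A positive decision puts the trace of a common bound into [H], so the bound lies in P/H. A
    negative one is refuted by amalgamating over an element of [H] that lies above the trace and the
    deciding element. *)
Lemma decisive_nice c H : Gen c H -> decisive c H -> nice c H.
Proof.
move=> HG dec.
have ideal n p : H n -> quot H p ->
    exists r, [/\ quot H r, p <= r, n <= r & dom r = dom p `|` dom n].
  move=> Hn /(gen_quot HG) pH; have [n' [Hn' pn' nn']] := gen_ub2 HG pH Hn.
  have [n'' Hn'' [[q [pq nq qn]]|h]] := dec p n'.
    apply: (bound2_quot pq (le_trans nn' nq)).
    by apply/(gen_quot HG); exact: gen_down HG _ _ Hn'' qn.
  have [m [Hm n'm n''m]] := gen_ub2 HG Hn' Hn''.
  have [q [pq mq _]] := amalg (le_trans pn' n'm) (gen_sub HG Hm).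
  case: (h q pq (le_trans n'm mq)); exists (restr q c) => //.
  by apply: le_restr; [exact: le_trans n''m mq|exact: gen_sub HG _ Hn''].
split=> // [p n a ca pH nH pn na|p q qH].
  (* In the negative case [n] is joined with [n''] before amalgamating, so that the amalgam lies
     above the element that excludes it. *)
  have [n'' Hn'' [[q [pq nq qn]]|h]] := dec p n.
    apply: (bound2_quot pq nq).
    by apply/(gen_quot HG); exact: gen_down HG _ _ Hn'' qn.
  have [n1 [_ nn1 n''n1 dn1]] := ideal _ _ Hn'' nH.
  have [|q [pq nq _]] := amalg (le_trans pn nn1).
    by rewrite dn1 => x [/na//|/(gen_sub HG Hn'')/lt_le_trans]; exact.
  case: (h q pq (le_trans nn1 nq)); exists (restr q c) => //.
  by apply: le_restr; [exact: le_trans n''n1 nq|exact: gen_sub HG _ Hn''].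
have [n Hn [[r [pr qr rn]]|h]] := dec p q.
  have [|r' [? ? ? e]] := bound2_quot (H := H) pr qr.
    by apply/(gen_quot HG); exact: gen_down HG _ _ Hn rn.
  by exists r'; split=> //; [left|rewrite e => x; left].
have [q' [? qq' nq' e]] := ideal _ _ Hn qH.
exists q'; split=> //.
  right=> -[r pr q'r]; case: (h r pr (le_trans qq' q'r)); exists (restr r c) => //.
  by apply: le_restr; [exact: le_trans nq' q'r|exact: gen_sub HG _ Hn].
by rewrite e => x [?|/(gen_sub HG Hn)]; [left; right|right].
Qed.


(** * Coherent systems of conditions on a tree *)

Lemma cut_ex (h : M -> M) b a : smono h (below b) -> a <= b ->
  exists z, forall x, x < b -> (h x < z) = (x < a).
Proof.
move=> hb ab; have [->|ab'] := le_eq_lt ab; last first.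
  by exists (h a) => x xb; rewrite (smono_lt hb).
have [z zP] := M_bounded (card_le_trans (card_image_le h (below b)) (below_le b)).
by exists z => x xb; rewrite xb; apply: zP; exists x.
Qed.

Section Tree.
Context {X : Type}.
Variables (xi : X -> M) (pp : X -> P) (T : set X) (theta : M) (Q : set P).

(** Two elements of X pass through the same node at level [a] of the tree. *)
Definition sim (a : M) (t s : X) : Prop :=
  [/\ a <= xi t, a <= xi s & restr (pp t) a = restr (pp s) a].

Definition coherent (F : X -> P) : Prop :=
  (forall t, T t -> dom (F t) `<=` below (xi t)) /\
  (forall t s a, T t -> T s -> sim a t s -> restr (F t) a = restr (F s) a).

(** [theta] is the level at which the ideal is visible: in use [Q] is the pull-back of P/H, which
    depends only on restrictions to [theta], and branches that share any node share the one at
    [theta]. *)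
Hypothesis (Tsmall : small T) (Ttheta : forall t, T t -> theta <= xi t).
Hypothesis (Tsim : forall t s a, T t -> T s -> sim a t s -> sim theta t s).
Hypothesis (Qrestr : forall p, Q p <-> Q (restr p theta)).
Hypothesis (Qdown : forall p q, q <= p -> Q p -> Q q).
Hypothesis (Qlub : forall A s, small A -> chain A -> islub A s -> A `<=` Q -> Q s).
Hypothesis (Qamalg : forall p n a, theta <= a -> Q p -> Q n -> restr p a <= n ->
  dom n `<=` below a ->
  exists r, [/\ Q r, p <= r, n <= r & dom r = dom p `|` dom n]).
Hypothesis (unctbl : card_lt [set: nat] [set: L]).

Lemma sim_refl a t : a <= xi t -> sim a t t. Proof. by []. Qed.

Lemma sim_sym a t s : sim a t s -> sim a s t. Proof. by case=> ? ? e; split. Qed.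

Lemma sim_trans a t s u : sim a t s -> sim a s u -> sim a t u.
Proof. by move=> [? ? e] [? ? e']; split=> //; rewrite e. Qed.

Lemma sim_le a b t s : b <= a -> sim a t s -> sim b t s.
Proof.
move=> ba [at_ as_ e]; split; [exact: le_trans at_|exact: le_trans as_|].
by rewrite -(restr_restr _ ba) e restr_restr.
Qed.

Section Step.
Variables (F : X -> P) (t0 : X) (q : P).
Hypothesis (Fcoh : coherent F) (Tt0 : T t0) (Fq : F t0 <= q) (Qq : Q q).
Hypothesis (qdom : dom q `<=` below (xi t0)).

(** Only branches through the node of [t0] at [theta] feel the new condition [q]; elsewhere [F] is
    kept. *)
Let K : set X := [set t | T t /\ sim theta t t0].

Let K0 : K t0. Proof. by split=> //; apply/sim_refl/Ttheta. Qed.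

Let KT t : K t -> T t. Proof. by case. Qed.

Definition meet_pt (t s : X) (x : M) : Prop := exists2 a, x < a & sim a t s.

Let meet_ptS t s u a x : x < a -> sim a t s -> meet_pt t u x <-> meet_pt s u x.
Proof.
move=> xa ts; split=> -[b xb bs].
  exists (Order.min a b); first by rewrite lt_min xa.
  apply: (sim_trans (s := t)); first by apply/sim_sym/(sim_le _ ts); rewrite ge_min lexx.
  by apply: sim_le bs; rewrite ge_min lexx orbT.
exists (Order.min a b); first by rewrite lt_min xa.
apply: (sim_trans (s := s)); first by apply: (sim_le _ ts); rewrite ge_min lexx.
by apply: sim_le bs; rewrite ge_min lexx orbT.
Qed.

Let meet_pt_le t s x y : x < y -> meet_pt t s y -> meet_pt t s x.
Proof. by move=> xy [a ya h]; exists a => //; exact: lt_trans xy ya. Qed.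

(** This is the ordinal sum z + x. *)
Let up (z x : M) : M := hh z set0 x.

Let up_ge z x : z <= up z x.
Proof. by have [] := en_in (top_ub z set0) x. Qed.

Let up_id z x : x <= up z x. Proof. exact: en_ge (top_ub z set0) x. Qed.

Variables (d : L) (tt : L -> X).
Hypothesis (ttK : forall i, K (tt i)) (Ktt : K `<=` tt @` below d).
Variables (mu : M) (z : L -> M).
Hypothesis (mub : forall t, K t -> xi t <= mu).
Hypothesis (zmu : forall i, mu <= z i).
Hypothesis (zmono : forall i j, j < i -> z j <= z i).
Hypothesis (zup : forall i j x, j < i -> x < mu -> up (z j) x < z i).

(** The first branch in the enumeration on which the point [x] of [t] occurs. *)
Let idx (t : X) (x : M) : L :=
  pick_or d (fun j => meet_pt t (tt j) x /\
    forall k, meet_pt t (tt k) x -> j <= k).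

Let idxP t x : K t -> x < xi t -> meet_pt t (tt (idx t x)) x /\
  forall k, meet_pt t (tt k) x -> idx t x <= k.
Proof.
move=> Kt xt; apply: (@pick_orP _ d (fun j => meet_pt t (tt j) x /\
    forall k, meet_pt t (tt k) x -> j <= k)).
have [i id e] := Ktt Kt.
have [|m ? ?] := wo_least L_wf (S := [set j | meet_pt t (tt j) x]); last by exists m.
by exists i; exists (xi t) => //; rewrite e; exact: sim_refl.
Qed.

(* The branches are laid out in M so that common parts are identified, t0 is
   left in place and what is new on the i-th branch lies in [z i, z (i+1)[. *)
Let em (t : X) (x : M) : M :=
  if pselect (meet_pt t t0 x) then x else up (z (idx t x)) x.

Let em_sim t s a x : x < a -> sim a t s -> em t x = em s x.
Proof.
move=> xa ts; rewrite /em.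
have -> : idx t x = idx s x.
  rewrite /idx; congr pick_or; apply/funext => j; apply/propext.
  rewrite (meet_ptS (tt j) xa ts); split=> -[h1 h2]; split=> // k.
    by move/(meet_ptS (tt k) xa ts)/h2.
  by move/(meet_ptS (tt k) xa ts)/h2.
have := meet_ptS t0 xa ts.
by case: pselect => h1; case: pselect => h2 // [h3 h4]; exfalso; auto.
Qed.

Let em_t0 t a x : x < a -> sim a t t0 -> em t x = x.
Proof. by move=> xa s; rewrite /em; case: pselect => // -[]; exists a. Qed.

Let em_ge t x : x <= em t x.
Proof. by rewrite /em; case: pselect => //= *; exact: up_id. Qed.

Let em_mono t : K t -> smono (em t) (below (xi t)).
Proof.
move=> Kt x y /= xt yt xy; rewrite /em.
case: pselect => /= xA; case: pselect => /= yA //.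
- have [ix _] := idxP Kt yt; apply: lt_le_trans xt _.
  exact: le_trans (mub Kt) (le_trans (zmu _) (up_ge _ _)).
- by case: xA; exact: meet_pt_le xy yA.
have [my _] := idxP Kt yt; have [_ /(_ _ (meet_pt_le xy my))] := idxP Kt xt.
move=> /le_eq_lt[->|ij]; first exact: hh_lt.
apply: lt_le_trans (up_ge _ _); apply: zup => //.
exact: lt_le_trans xt (mub Kt).
Qed.

Let em_new j x : x < xi (tt j) -> em (tt j) x < z j ->
  meet_pt (tt j) t0 x \/ exists2 i, i < j & meet_pt (tt j) (tt i) x.
Proof.
move=> xt; rewrite /em; case: pselect => /= [|nA lt]; first by left.
right; have [m _] := idxP (ttK j) xt; exists (idx (tt j) x) => //.
rewrite ltNge; apply/negP => /le_eq_lt[e|ji].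
  by move: lt; rewrite -e ltNge up_ge.
have xmu : x < mu by apply: lt_le_trans xt (mub (ttK j)).
have := lt_trans lt (le_lt_trans (up_ge (z j) x) (lt_le_trans (zup ji xmu) (up_ge _ x))).
by rewrite ltxx.
Qed.

Let em_old t x : K t -> x < xi t -> forall j k, tt j = t -> j < k -> em t x < z k.
Proof.
move=> Kt xt j k e jk; have xmu := lt_le_trans xt (mub Kt).
rewrite /em; case: pselect => /= nA; first exact: lt_le_trans xmu (zmu _).
apply: zup xmu; apply: le_lt_trans jk; have [_ h] := idxP Kt xt.
by apply: h; exists (xi t) => //; rewrite e; exact: sim_refl.
Qed.

Let Fdom t : K t -> dom (F t) `<=` below (xi t).
Proof. by move=> /KT; case: Fcoh => h _; exact: h. Qed.

Let em_dom t p : K t -> dom p `<=` below (xi t) -> smono (em t) (dom p).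
Proof. by move=> Kt pd; exact: smono_sub (em_mono Kt). Qed.

Let img_sim t s a p : K t -> K s -> sim a t s -> dom p `<=` below a ->
  img (em t) p = img (em s) p.
Proof.
move=> Kt Ks ts pa; apply: img_ext.
  by move=> x /pa xa; exact: em_sim xa ts.
apply: em_dom => // x /pa xa; case: ts => at_ _ _; exact: lt_le_trans xa at_.
Qed.

Let img_t0 t a p : sim a t t0 -> dom p `<=` below a -> img (em t) p = p.
Proof. by move=> ts pa; apply: img_id => x /pa xa; exact: em_t0 xa ts. Qed.

Let restr_em t p a : K t -> dom p `<=` below (xi t) -> a <= xi t ->
  exists y, (forall x, x < a -> em t x < y) /\
            restr (img (em t) p) y = img (em t) (restr p a).
Proof.
move=> Kt pd at_; have [y yP] := cut_ex (em_mono Kt) at_.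
exists y; split; first by move=> x xa; rewrite yP //; exact: lt_le_trans xa at_.
by apply: restr_img; [exact: em_dom|move=> x /pd; exact: yP].
Qed.

Let restr_theta t p : K t -> dom p `<=` below (xi t) ->
  restr (img (em t) p) theta = restr p theta.
Proof.
move=> Kt pd; have [_ s0] := Kt.
rewrite (restr_img (b := theta)); last 2 first.
- exact: em_dom.
- move=> x xp; apply/idP/idP => [|xt]; first exact: le_lt_trans (em_ge _ _).
  by rewrite (em_t0 xt s0).
by apply: (img_t0 s0); exact: dom_restrS.
Qed.

Let Qimg t p : K t -> dom p `<=` below (xi t) -> Q (img (em t) p) <-> Q p.
Proof. by move=> Kt pd; rewrite Qrestr restr_theta // -Qrestr. Qed.

Let QF t : K t -> Q (F t).
Proof.
move=> [Tt s0]; case: Fcoh => _ /(_ t t0 theta Tt Tt0 s0) e.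
by apply/Qrestr; rewrite e -Qrestr; exact: Qdown Qq.
Qed.

(** A point of the copy of branch [j] below [z j] is shared with [t0] or with an earlier branch. Up
    to that point coherence of [F] identifies the condition with one already below [s]; as such
    points may be cofinal, [restr_cover] is what collects them. *)
Let glue_step j s : Q s -> dom s `<=` below (z j) -> q <= s ->
  (forall i, i < j -> img (em (tt i)) (F (tt i)) <= s) ->
  restr (img (em (tt j)) (F (tt j))) (z j) <= s.
Proof.
move=> Qs sz qs st; have [m0 m0P] := M_bot.
have Kj := ttK j; have Fd := Fdom Kj; have [Tj s0] := Kj.
apply: (restr_cover m0P).
  apply: (@le_trans _ _ (restr (F t0) theta)); last first.
    by apply: le_trans (restr_le _ _) (le_trans Fq qs).
  case: Fcoh => _ /(_ _ _ _ Tj Tt0 s0) <-; rewrite -(restr_theta Kj Fd).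
  by apply: restr_le2 => x _ /lt_le_trans; apply; exact: m0P.
move=> y; rewrite (dom_img (em_dom Kj Fd)) => -[x xF <-] lt.
have [[a xa sa]|[i ij [a xa sa]]] := em_new (Fd _ xF) lt.
  have [y' [ly ey]] := restr_em Kj Fd (let: And3 h _ _ := sa in h).
  exists y'; first exact: ly.
  rewrite ey (img_t0 sa (@dom_restrS _ _)); case: Fcoh => _ /(_ _ _ _ Tj Tt0 sa) ->.
  exact: le_trans (restr_le _ _) (le_trans Fq qs).
have [y' [ly ey]] := restr_em Kj Fd (let: And3 h _ _ := sa in h).
exists y'; first exact: ly.
rewrite ey (img_sim Kj (ttK i) sa (@dom_restrS _ _)).
case: Fcoh => _ /(_ _ _ _ Tj (KT (ttK i)) sa) ->; apply: le_trans (st i ij).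
by apply: img_le (restr_le _ _); exact/em_dom/Fdom.
Qed.

(** Everything glued before branch [j] lives below [z j], and what is new on that branch lives
    above, so each branch is added by one amalgamation at level [z j]. *)
Let glue : exists R, [/\ Q R, q <= R &
  forall t, K t -> img (em t) (F t) <= R].
Proof.
have [||||| s [g sg]] := @transfinite_chain _ _ L_wf _ q (fun x y => x <= y)
  (fun j g s => islub (q |` (g @` below j)) s)
  (fun j s => [/\ Q s, dom s `<=` below (z j), q <= s &
     forall i, i < j -> img (em (tt i)) (F (tt i)) <= s])
  (fun j s y => [/\ Q y, forall k, j < k -> dom y `<=` below (z k) &
     img (em (tt j)) (F (tt j)) <= y]).
- by move=> x y u; exact: le_trans.
- by move=> j g g' s e; rewrite (eq_imagel (f' := g')).
- by move=> j g s [h _] i ij; apply: h; right; exists i.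
- move=> j g s mon st.
  have qg i : i < j -> q <= g i.
    by move=> ij; have [[_ _ qs _] _ sg _] := st i ij; exact: le_trans sg.
  have [||t [tl dt _]] := @chain_lub (q |` (g @` below j)).
  + by apply: smallU; [exact/small_finite/finite_set1|exact/small_image/below_small].
  + move=> x y [->|[i ij <-]] [->|[k kj <-]]; [by left|by left; exact: qg|
      by right; exact: qg|].
    by case: (ltgtP i k) => [ik|ki|->]; [left|right|left] => //; exact: mon.
  exists t => //; split.
  + apply: (Qlub _ _ tl).
    * by apply: smallU; [exact/small_finite/finite_set1|exact/small_image/below_small].
    * move=> x y [->|[i ij <-]] [->|[k kj <-]]; [by left|by left; exact: qg|
        by right; exact: qg|].
      by case: (ltgtP i k) => [ik|ki|->]; [left|right|left] => //; exact: mon.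
    * by move=> x [->//|[i ij <-]]; have [_ _ _ []] := st i ij.
  + rewrite dt => x [y [->/qdom xt|[i ij <-]]].
      exact: lt_le_trans xt (le_trans (mub K0) (zmu _)).
    by have [_ _ _ [_ h _]] := st i ij; exact: h.
  + by case: tl => h _; apply: h; left.
  + move=> i ij; have [_ _ _ [_ _ h]] := st i ij; apply: le_trans h _.
    by case: tl => h _; apply: h; right; exists i.
- move=> j s [Qs sz qs st]; have Kj := ttK j.
  have [|||||r [Qr pr sr e]] := @Qamalg (img (em (tt j)) (F (tt j))) s (z j).
  + exact: le_trans (Ttheta Tt0) (le_trans (mub K0) (zmu _)).
  + by apply/(Qimg Kj (Fdom Kj))/QF.
  + exact: Qs.
  + exact: glue_step.
  + exact: sz.
  exists r => //; split=> // k jk; rewrite e => x [|/sz xz]; last exact: lt_le_trans xz (zmono jk).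
  by rewrite (dom_img (em_dom Kj (Fdom Kj))) => -[y /(Fdom Kj) yt <-]; exact: em_old jk.
have [[QR _ qR st] _ _ _] := sg d; exists (s d); split=> // t Kt.
by have [i id <-] := Ktt Kt; exact: st.
Qed.

(** The level at which the branches of [t] and [s] split. *)
Let ksim (t s : X) : M :=
  pick_or mu (fun m => (forall a, sim a t s -> a <= m) /\
    forall y, (forall a, sim a t s -> a <= y) -> m <= y).

Let ksimP t s : (forall a, sim a t s -> a <= ksim t s) /\
  forall y, (forall a, sim a t s -> a <= y) -> ksim t s <= y.
Proof.
apply: (@pick_orP _ mu (fun m => (forall a, sim a t s -> a <= m) /\
    forall y, (forall a, sim a t s -> a <= y) -> m <= y)).
by apply: (wo_lub M_wf (b := xi t)) => a [].
Qed.

Let ksim_img t s p : K t -> K s -> dom p `<=` below (ksim t s) ->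
  img (em t) p = img (em s) p /\ dom p `<=` below (xi t).
Proof.
move=> Kt Ks pk; have [_ lst] := ksimP t s.
have H x : dom p x -> meet_pt t s x.
  move=> /pk xk; apply: contrapT => h; suff : ksim t s <= x by rewrite leNgt xk.
  apply: lst => a ats; rewrite leNgt; apply/negP => xa; apply: h; by exists a.
have pt : dom p `<=` below (xi t).
  by move=> x /H[a xa [ta _ _]]; exact: lt_le_trans xa ta.
split=> //; apply: img_ext; last exact: em_dom.
by move=> x /H[a xa ats]; exact: em_sim xa ats.
Qed.

Let inR R (g : X -> P) : Prop := forall t, K t ->
  dom (g t) `<=` below (xi t) /\ img (em t) (g t) <= R.

(* One round of the omega steps after which the conditions below R cohere. *)
Let close_step R g : inR R g -> exists g', [/\ inR R g',
   forall t, K t -> g t <= g' t &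
   forall t s, K t -> K s -> restr (g s) (ksim t s) <= g' t].
Proof.
move=> gR.
suff /choice[g' g'P] : forall t, exists x, K t ->
    [/\ dom x `<=` below (xi t), img (em t) x <= R, g t <= x &
        forall s, K s -> restr (g s) (ksim t s) <= x].
  by exists g'; split=> [t /g'P[]|t /g'P[]|t s /g'P[_ _ _]] //; exact.
move=> t; have [Kt|nK] := pselect (K t); last by exists q.
pose A := g t |` ((fun s => restr (g s) (ksim t s)) @` K).
have Ad x : A x -> dom x `<=` below (xi t) /\ img (em t) x <= R.
  case=> [->|[s Ks <-]]; first exact: gR.
  have [e dx] := ksim_img Kt Ks (@dom_restrS (g s) _).
  split=> //; rewrite e; have [sd sR] := gR s Ks; apply: le_trans sR.
  by apply: img_le (restr_le _ _); exact: em_dom.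
have sA : small A.
  apply: smallU; first exact/small_finite/finite_set1.
  by apply: small_image; exact: small_sub KT Tsmall.
have [||r [rR Ar rd]] := @bound_in (img (em t) @` A) R; first exact: small_image.
  by move=> _ [x /Ad[_ xR] <-].
have [|p pt pe] := img_surj (em_mono Kt) (r := r).
  move=> y /rd[_ [x /Ad[xd _] <-]]; rewrite (dom_img (em_dom Kt xd)) => -[u /xd ? <-].
  by exists u.
have Ap x : A x -> x <= p.
  move=> Ax; have [xd _] := Ad x Ax; apply: (le_img_inv (em_mono Kt)) => //.
  by rewrite pe; apply: Ar; exists x.
exists p => _; split=> //; first by rewrite pe.
  by apply: Ap; left.
by move=> s Ks; apply: Ap; right; exists s.
Qed.

(** All copies stay below the single condition [R], so the demands never conflict. Each round makes
    [g n.+1 t] absorb, for every [s], the part of [g n s] below the splitting level; the two sides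
    of coherence thus interleave and have equal lubs. *)
Lemma tree_step_aux : exists F', [/\ coherent F', forall t, T t -> F t <= F' t,
  forall t, T t -> Q (F t) -> Q (F' t) & q <= F' t0].
Proof.
have [R [QR qR FR]] := glue.
pose g0 t := if pselect (t = t0) then q else F t.
have g0F t : F t <= g0 t by rewrite /g0; case: pselect => //= ->.
have g0R : inR R g0.
  move=> t Kt; rewrite /g0; case: pselect => /= [->|_]; last by split; [exact: Fdom|exact: FR].
  by split=> //; rewrite (img_t0 (a := xi t0)) //; exact: sim_refl.
have /choice[nx nxP] : forall g, exists g', inR R g -> [/\ inR R g',
   forall t, K t -> g t <= g' t &
   forall t s, K t -> K s -> restr (g s) (ksim t s) <= g' t].
  move=> g; have [gR|] := pselect (inR R g); last by exists g.
  by have [g' ?] := close_step gR; exists g'.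
pose g n := iter n nx g0.
have gR n : inR R (g n) by elim: n => [//|n IH]; case: (nxP _ IH).
have gS n t : K t -> g n t <= g n.+1 t.
  by move=> Kt; have [_ + _] := nxP _ (gR n); exact.
have gk n t s : K t -> K s -> restr (g n s) (ksim t s) <= g n.+1 t.
  by move=> Kt Ks; have [_ _] := nxP _ (gR n); exact.
have gmono n m t : K t -> (n <= m)%N -> g n t <= g m t.
  move=> Kt; elim: m => [|m IH]; first by rewrite leqn0 => /eqP->.
  rewrite leq_eqVlt => /orP[/eqP->//|]; rewrite ltnS => /IH h.
  exact: le_trans h (gS _ _ Kt).
pose A t := range (fun n => g n t).
have sA t : small (A t) by exact: small_image.
have cA t : K t -> chain (A t).
  move=> Kt _ _ [n _ <-] [m _ <-].
  by have [/(gmono _ _ _ Kt)|/ltnW/(gmono _ _ _ Kt)] := leqP n m; [left|right].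
have /choice[F' F'P] : forall t, exists x, (K t -> slub (A t) x) /\ (~ K t -> x = F t).
  move=> t; have [Kt|nK] := pselect (K t); last by exists (F t); split.
  by have [x ?] := chain_lub (sA t) (cA t Kt); exists x; split.
have FF' t : F t <= F' t.
  have [Kt|nK] := pselect (K t); last by case: (F'P t) => _ ->.
  have [/(_ Kt)[[h _] _ _] _] := F'P t; apply: le_trans (g0F t) (h _ _).
  by exists 0%N.
have Qg n t : K t -> Q (g n t).
  move=> Kt; have [gd gR'] := gR n t Kt; apply/(Qimg Kt gd); exact: Qdown gR' QR.
have half t s a : K t -> K s -> sim a t s -> restr (F' t) a <= restr (F' s) a.
  move=> Kt Ks ts; have [/(_ Kt)[_ _ /(_ a)[_ h]] _] := F'P t.
  apply: h => _ [_ [n _ <-] <-]; apply: le_restr (@dom_restrS _ _).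
  have [/(_ Ks)[[h _] _ _] _] := F'P s; apply: le_trans (h (g n.+1 s) _); last by exists n.+1.
  apply: le_trans (gk n s t Ks Kt); apply: restr_le2 => x _ /lt_le_trans; apply.
  by have [hh _] := ksimP s t; apply: hh; exact: sim_sym.
exists F'; split.
- split=> [t Tt|t s a Tt Ts ts].
    have [Kt|nK] := pselect (K t); last first.
      by have [_ ->] := F'P t => //; case: Fcoh => h _; exact: h.
    have [/(_ Kt)[_ -> _] _] := F'P t => x [_ [n _ <-]].
    by have [h _] := gR n t Kt; exact: h.
  have th : sim theta t s by exact: Tsim ts.
  have [Kt|nK] := pselect (K t).
    have Ks : K s by split=> //; apply: sim_trans (sim_sym th) _; case: Kt.
    by apply/eqP; rewrite eq_le !half //; exact: sim_sym.
  have nKs : ~ K s.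
    by move=> [_ s0]; apply: nK; split=> //; apply: sim_trans th _.
  have [_ ->//] := F'P t; have [_ ->//] := F'P s.
  by case: Fcoh => _; exact.
- by move=> t _.
- move=> t Tt QFt; have [Kt|nK] := pselect (K t); last by have [_ ->] := F'P t.
  have [/(_ Kt)[h _ _] _] := F'P t; apply: (Qlub (sA t) (cA t Kt) h).
  by move=> _ [n _ <-]; exact: Qg.
- have [/(_ K0)[[h _] _ _] _] := F'P t0; apply: h; exists 0%N => //.
  by rewrite /g/= /g0; case: pselect.
Qed.

End Step.

Lemma tree_step F t0 q : coherent F -> T t0 -> F t0 <= q -> Q q ->
  dom q `<=` below (xi t0) ->
  exists F', [/\ coherent F', forall t, T t -> F t <= F' t,
    forall t, T t -> Q (F t) -> Q (F' t) & q <= F' t0].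
Proof.
move=> Fc Tt0 Fq Qq qd; pose K := [set t | T t /\ sim theta t t0].
have K0 : K t0 by split=> //; apply/sim_refl/Ttheta.
have KT : K `<=` T by move=> t [].
have sK := small_sub KT Tsmall.
have [d [tt [ttK Ktt]]] := small_enum sK (ex_intro K t0 K0).
have [mu muP] := M_bounded (small_image xi sK).1.
(* Block starts: [z i] exceeds every z j + x with [j < i] and [x < mu], so the blocks are disjoint
   and each has room for a whole branch. *)
have [z zE] := wo_rec L_wf mu (fun i (Z : L -> M) => pick_or mu (fun y => mu <= y /\
   forall j, j < i -> Z j <= y /\ forall x, x < mu -> hh (Z j) set0 x < y)).
have zP i : mu <= z i /\ forall j, j < i -> z j <= z i /\
    forall x, x < mu -> hh (z j) set0 x < z i.
  set Z := fun b => if b < i then z b else mu.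
  have : exists y, mu <= y /\
   forall j, j < i -> Z j <= y /\ forall x, x < mu -> hh (Z j) set0 x < y.
    have sb := (below_small i).1.
    have [|b bP] := @M_bounded (mu |` (Z @` below i `|`
       \bigcup_(j in below i) (hh (Z j) set0 @` below mu))).
      apply: leU; first exact: (small_finite (finite_set1 mu)).1.
      apply: leU; first exact: card_le_trans (card_image_le _ _) sb.
      apply: le_bigcup => // j _.
      exact: card_le_trans (card_image_le _ _) (below_le mu).
    exists b; split; first by apply/ltW/bP; left.
    move=> j ji; split; first by apply/ltW/bP; right; left; exists j.
    by move=> x xmu; apply: bP; right; right; exists j => //; exists x.
  move=> /(pick_orP mu); rewrite -zE => -[h1 h2]; split=> // j ji.
  by have := h2 j ji; rewrite /Z ji.
apply: (@tree_step_aux F t0 q Fc Tt0 Fq Qq qd d tt ttK Ktt mu z) => //.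
- by move=> t Kt; apply/ltW/muP; exists t.
- by move=> i; case: (zP i).
- by move=> i j ji; case: (zP i) => _ /(_ j ji)[].
- by move=> i j x ji; case: (zP i) => _ /(_ j ji)[_]; exact.
Qed.

Lemma coherent_lub (A : X -> set P) (G : set (X -> P)) (s : X -> P) :
  (forall t, T t -> A t = [set g t | g in G]) ->
  (forall g, G g -> coherent g) -> G !=set0 ->
  (forall t, T t -> slub (A t) (s t)) -> coherent s.
Proof.
move=> AE Gc [g0 Gg0] As; split=> [t Tt|t u a Tt Tu tu].
  have [_ -> _] := As t Tt; rewrite AE // => x [_ [g Gg <-]].
  by have [h _] := Gc g Gg; exact: h.
have [_ _ /(_ a) l1] := As t Tt; have [_ _ /(_ a) l2] := As u Tu.
apply: islub_uniq l1 _; rewrite !AE // in l2 *.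
rewrite (_ : [set restr x a | x in [set g t | g in G]] =
             [set restr x a | x in [set g u | g in G]]) //.
have e (g : X -> P) : G g -> restr (g t) a = restr (g u) a.
  by move=> /Gc[_ h]; exact: h.
apply/seteqP; split=> _ [_ [g Gg <-] <-].
  by rewrite e //; exists (g u) => //; exists g.
by rewrite -e //; exists (g t) => //; exists g.
Qed.

(** [tree_step] is applied once for each of the fewer than lambda elements of [T], with pointwise
    lubs at limits. Later steps enlarge the value at [t] further, so membership in [E t] is kept
    only for some [s] below it. *)
Lemma tree_meet F (E : X -> set P) : coherent F -> (forall t, T t -> Q (F t)) ->
  (forall t s, T t -> Q s -> dom s `<=` below (xi t) ->
     exists s', [/\ E t s', s <= s', Q s' & dom s' `<=` below (xi t)]) ->
  exists F', [/\ coherent F', forall t, T t -> F t <= F' t,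
    forall t, T t -> Q (F' t) & forall t, T t -> exists2 s, E t s & s <= F' t].
Proof.
move=> Fc FQ Ed; have [T0|/set0P T0] := eqVneq T set0.
  by exists F; split=> // t; rewrite T0.
have [d [tt [ttT Ttt]]] := small_enum Tsmall T0.
have [||||| s [g sg]] := @transfinite_chain _ _ L_wf _ F
  (fun x y : X -> P => forall t, T t -> x t <= y t)
  (fun j g s => forall t, T t -> islub (F t |` ((fun i => g i t) @` below j)) (s t))
  (fun j s => [/\ coherent s, forall t, T t -> Q (s t) & forall t, T t -> F t <= s t])
  (fun j s y => [/\ coherent y, forall t, T t -> Q (y t) &
     exists2 e, E (tt j) e & e <= y (tt j)]).
- by move=> x y u xy yu t Tt; exact: le_trans (xy t Tt) (yu t Tt).
- move=> j g g' s e h t Tt; have := h t Tt.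
  rewrite (eq_imagel (f' := fun i => g' i t)) // => i ij.
  by rewrite e.
- by move=> j g s h i ij t Tt; have [ub _] := h t Tt; apply: ub; right; exists i.
- move=> j g s mon st.
  have Fg i t : i < j -> T t -> F t <= g i t.
    by move=> ij Tt; have [[_ _ Fs] _ sg _] := st i ij; exact: le_trans (Fs t Tt) (sg t Tt).
  pose A t := F t |` ((fun i => g i t) @` below j).
  have sA t : small (A t).
    by apply: smallU; [exact/small_finite/finite_set1|exact/small_image/below_small].
  have cA t : T t -> chain (A t).
    move=> Tt x y [->|[i ij <-]] [->|[k kj <-]]; [by left|by left; exact: Fg|
      by right; exact: Fg|].
    by case: (ltgtP i k) => [ik|ki|->]; [left|right|left] => //; exact: mon.
  have /choice[r rP] : forall t, exists x, T t -> slub (A t) x.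
    move=> t; have [Tt|nT] := pselect (T t); last by exists (F t).
    by have [x ?] := chain_lub (sA t) (cA t Tt); exists x.
  exists r; first by move=> t Tt; case: (rP t Tt).
  split.
  + apply: (@coherent_lub A (F |` (g @` below j)) r) => //.
    * move=> t Tt; rewrite image_setU image_set1; congr (_ `|` _).
      by rewrite image_comp.
    * by move=> _ [->//|[i ij <-]]; have [_ _ _ []] := st i ij.
    * by exists F; left.
  + move=> t Tt; have [l _ _] := rP t Tt; apply: (Qlub (sA t) (cA t Tt) l).
    by move=> _ [->|[i ij <-]]; [exact: FQ|have [_ _ _ [_ h _]] := st i ij; exact: h].
  + by move=> t Tt; have [[h _] _ _] := rP t Tt; apply: h; left.
- move=> j s [sc sQ Fs]; have Tj := ttT j.
  have [e [Ee se Qe de]] : exists e,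
      [/\ E (tt j) e, s (tt j) <= e, Q e & dom e `<=` below (xi (tt j))].
    by apply: Ed => //; [exact: sQ|case: sc => h _; exact: h].
  have [s' [s'c ss' s'Q es']] := tree_step sc Tj se Qe de.
  by exists s' => //; split=> //; [move=> t Tt; apply: s'Q => //; exact: sQ|exists e].
have [[sc sQ Fs] sl _ _] := sg d; exists (s d); split=> // t Tt.
have [i id et] := Ttt _ Tt; have [_ _ _ [_ _ [e Ee eg]]] := sg i.
exists e; rewrite -?et //; apply: le_trans eg _.
by have [h _] := sl (tt i) (ttT i); apply: h; right; exists i.
Qed.

End Tree.

(** * Presentations of generic ideals *)

Lemma Psub_le (A : set M) : A #<= [set: L] ->
  [set p : P | dom p `<=` A] #<= [set: L].
Proof.
move=> AL; have sA := leT_subsets AL.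
apply: card_le_trans (le_setXT (card_lexx [set: L]) sA).
have [l _] := L_inh; have [m _] := M_inh.
have [p0 _] := P_bot.
apply: (enum_card_le (f := fun y => pick_or p0 (fun p => code p = y))) => p pA.
exists (code p); first by split=> //; split=> //; exact: dom_small.
by apply: code_inj; apply: (@pick_orP _ p0 (fun p' => code p' = code p)); exists p.
Qed.

(** The enumeration [b] may run through more than [c], so that it can also list a task reaching
    above [c]; hence the intersection. *)
Definition wset (b : L -> M) (c : M) (e : L) : set M := (b @` below e) `&` below c.

(* The sequence [p] generates the ideal [H]; both [H] and [c] are exhausted by
   approximations of size < lambda. *)
Record pres (c : M) (H : set P) (b : L -> M) (p : L -> P) : Prop := Pres {
  pres_b : forall x, x < c -> exists i, b i = x;
  pres_in : forall i, H !=set0 -> H (p i);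
  pres_mono : forall i j, i <= j -> p i <= p j;
  pres_lim : forall e, is_limit e -> islub (p @` below e) (p e);
  pres_cof : forall x, H x -> exists i, x <= p i
}.

Lemma chain_pres (A : set P) (p g : L -> P) :
  (forall j, islub (A `|` (g @` below j)) (p j)) -> (forall j, p j <= g j) ->
  (forall i j, i <= j -> p i <= p j) /\
  (forall e, is_limit e -> islub (p @` below e) (p e)).
Proof.
move=> lg pg; have gp i j : i < j -> g i <= p j.
  by move=> ij; have [h _] := lg j; apply: h; right; exists i.
have mono i j : i <= j -> p i <= p j.
  by move=> /le_eq_lt[->//|/gp]; exact: le_trans.
split=> // e [[i0 i0e] el]; split=> [_ [i ie <-]|t tP]; first exact/mono/ltW.
have [_ h] := lg e; apply: h => a [Aa|[i ie <-]].
  by apply: le_trans (tP (p i0) _); [have [h _] := lg i0; apply: h; left|exists i0].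
have [j ij je] := el i ie.
by apply: le_trans (gp _ _ ij) (tP _ _); exists j.
Qed.

Lemma gen_lub c H A s : Gen c H -> small A -> A `<=` H -> islub A s -> H s.
Proof.
move=> HG sA AH [_ h]; have [r Hr ub] := gen_ub HG sA AH.
by apply: (gen_down HG Hr); exact: h.
Qed.

Lemma below_enum (c m0 : M) : exists b : L -> M, forall x, x < c -> exists i, b i = x.
Proof.
have [e|/set0P c0] := eqVneq (below c) set0.
  exists (fun=> m0) => x xc; have : below c x by [].
  by rewrite e.
have [b bE] := card_le_enum c0 (below_le c); exists b => x xc.
by have : below c x by []; rewrite bE => -[i _ <-]; exists i.
Qed.

(** By lambda^{<lambda} = lambda the ideal has at most lambda elements, and any fewer than lambda of
    them have a bound in it; so it has a cofinal chain of length lambda, continuous because its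
    terms are the lubs of the chain under construction. *)
Lemma pres_ex c H b : base c H -> (forall x, x < c -> exists i, b i = x) ->
  exists p, pres c H b p.
Proof.
move=> HB bc; have [p0 [p0P _]] := P_bot.
have [H0|/set0P H0] := eqVneq H set0.
  exists (fun=> p0); split=> // [i [x]|e [[x xe] _]|x]; rewrite ?H0 //.
  split=> [_ [i _ <-]//|t tP]; exact: p0P.
have HG : Gen c H by case: HB => // -[He]; case: H0 => x; rewrite He.
have HL' : H #<= [set: L].
  apply: card_le_trans (Psub_le (below_le c)).
  by apply: subset_card_le => p Hp; exact: gen_sub HG _ Hp.
have [x xE] := card_le_enum H0 HL'.
have xH i : H (x i) by rewrite xE; exists i.
have [||||| p [g pg]] := @transfinite_chain _ _ L_wf _ p0 (fun x y => x <= y)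
  (fun j g s => islub (g @` below j) s) (fun j s => H s)
  (fun j s y => H y /\ x j <= y).
- by move=> u v w; exact: le_trans.
- by move=> j g g' s e; rewrite (eq_imagel (f' := g')).
- by move=> j g s [h _] i ij; apply: h; exists i.
- move=> j g s mon st.
  have [|t [tl dt _]] := @chain_lub (g @` below j) (small_image _ (below_small j)).
    move=> _ _ [i ij <-] [k kj <-].
    by case: (ltgtP i k) => [ik|ki|->]; [left|right|left] => //; exact: mon.
  exists t => //; apply: (gen_lub HG _ _ tl); first exact/small_image/below_small.
  by move=> _ [i ij <-]; have [_ _ _ []] := st i ij.
- move=> j s Hs; have [r [? ? ?]] := gen_ub2 HG Hs (xH j).
  by exists r.
have lg j : islub (g @` below j) (p j) by case: (pg j).
have lg0 j : islub (set0 `|` (g @` below j)) (p j) by rewrite set0U.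
have [mono lim] := chain_pres lg0 (fun j => let: And4 _ _ h _ := pg j in h).
exists p; split=> // [i _|y]; first by case: (pg i).
rewrite xE => -[i _ <-]; have [j ij] := L_gt i; exists j.
have [_ _ _ [_ xg]] := pg i; apply: le_trans xg _.
by have [h _] := lg j; apply: h; exists i.
Qed.


(** * Building generic ideals and strategies *)

Local Notation dsys := (dsys (M := M) (P := P)).
Local Notation moveI := (moveI (M := M) (P := P)).

(* The conclusion of a commitment: either D is met over (c, H) above r and r',
   or an element of the ideal H excludes this. *)
Definition settles (D : dsys) (c : M) (H : set P) : Prop :=
  forall u w r r', small w -> u `<=` w -> dom r `<=` w -> dom r' `<=` w ->
  exists W n, [/\ w `<=` W, small W, forall x, W x -> c <= x -> w x,
    H n /\ dom n `<=` W &
    (exists q, [/\ D u W q, r <= q, r' <= q & restr q c <= n]) \/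
    (forall q, D u W q -> r <= q -> r' <= q -> ~ n <= restr q c)].

Lemma gen_inh c H : Gen c H -> H !=set0.
Proof.
move=> HG; have [|x []|r Hr _] := @gen_ub _ _ HG set0; last by exists r.
exact: small_finite.
Qed.

(** The density system that asks for nothing beyond P/H. Meeting it is trivial, but settling it
    decides the existence of common bounds. *)
Definition own_triv (H : set P) : dsys :=
  fun u w => [set p | quot H p /\ dom p `<=` w].

(** [settles] speaks only of bounds with domain inside [W]. Given an arbitrary bound [q] whose trace
    is compatible with [n], an amalgam of [q] with the witness lies above [n], and it is shrunk to
    the domains of [p], [p'] and [n], which are inside [W]. *)
Lemma settles_decisive c H : Gen c H -> settles (own_triv set0) c H -> decisive c H.
Proof.
move=> HG st p p'.
have [W [n [wW sW _ [Hn nW] h]]] := st set0 (dom p `|` dom p') p p'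
  (smallU (dom_small p) (dom_small p')) (@sub0set _ _)
  (fun x xp => or_introl xp) (fun x xp => or_intror xp).
exists n => //; case: h => [[q [_ pq p'q qn]]|h]; [by left; exists q|right].
move=> q pq p'q [m qm nm].
have [||q1 [qq1 mq1 dq1]] := @amalg q (restr m c) c.
- by apply: le_restr qm _; exact: dom_restrS.
- exact: dom_restrS.
have nq1 : n <= q1 by apply: le_trans mq1; apply: le_restr nm (gen_sub HG Hn).
have [q2 [pq2 p'q2 q2q dq2]] := bound2 (le_trans pq qq1) (le_trans p'q qq1).
have [q3 [q2q3 nq3 q3q dq3]] := bound2 q2q nq1.
apply: (h q3); [|exact: le_trans pq2 q2q3|exact: le_trans p'q2 q2q3|].
  split=> // x; rewrite dq3 dq2 => -[|/nW//]; exact: wW.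
exact: le_restr nq3 (gen_sub HG Hn).
Qed.

(** Density of D in P/H where [H] may be larger than the ideal over which D was played. The set [w]
    may have to grow, but only below [c], so a task inside some zeta above [c] stays inside it. *)
Definition dense (D : dsys) (c : M) (H : set P) : Prop :=
  forall u w r, small w -> u `<=` w -> dom r `<=` w -> quot H r ->
  exists W q, [/\ w `<=` W, small W, forall x, W x -> c <= x -> w x,
    quot H q & [/\ D u W q, r <= q & dom q `<=` W]].

(** [settles] is applied with r' = r. The negative alternative fails: by niceness [r] and the
    excluding [n] have a bound in P/H, and since P/H is contained in P/H0, that bound extends into
    D. *)
Lemma settles_dense D c0 H0 c H : density_system (L := L) code c0 H0 D ->
  H0 `<=` H -> Gen c H -> nice c H -> settles D c H -> dense D c H.
Proof.
move=> DS HH HG HN st u w r sw uw rw rH.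
have [W [n [wW sW Wc [Hn nW] h]]] := st u w r r sw uw rw rw.
have dd : in_ddom (L := L) u W by split=> //; exact: subset_trans uw wW.
exists W; case: h => [[q [Dq rq _ qn]]|h].
  exists q; split=> //; first by apply/(gen_quot HG); exact: gen_down HG _ _ Hn qn.
  by split=> //; have [] := ds_sub DS dd Dq.
have [r' [Hr' rr' nr' dr']] := nice_ideal HN Hn rH.
have r'W : dom r' `<=` W by rewrite dr' => x [/rw/wW|/nW].
have [q Dq r'q] := ds_dense DS dd (quot_anti HH Hr') r'W.
case: (h q Dq (le_trans rr' r'q) (le_trans rr' r'q)).
by apply: le_restr (gen_sub HG Hn); exact: le_trans nr' r'q.
Qed.

Lemma own_dense D c H : density_system (L := L) code c H D -> dense D c H.
Proof.
move=> DS u w r sw uw rw rH; have dd : in_ddom (L := L) u w by [].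
have [q Dq rq] := ds_dense DS dd rH rw.
by have [Hq qw] := ds_sub DS dd Dq; exists w, q; split.
Qed.

(** Step [j] of a chain in P/H fulfils the wish [S], decides the j-th condition living below [zeta],
    and serves the j-th pair of a system and a set. The wish refers to the limit value [p j], since
    commitments react to the approximation reached at that moment. *)
Lemma build_generic c H zeta g (DD : set dsys) (S : L -> P -> P -> Prop) :
  base c H -> nice c H -> c <= zeta -> quot H g -> dom g `<=` below zeta ->
  DD #<= [set: L] -> (forall D, DD D -> dense D c H) ->
  (forall j s, quot H s -> dom s `<=` below zeta ->
     exists y, [/\ quot H y, dom y `<=` below zeta, s <= y & S j s y]) ->
  exists G p, [/\ Gen zeta G, H `<=` G /\ G g,
    forall D, DD D -> Defs.meets (L := L) zeta G D,
    forall b, (forall x, x < zeta -> exists i, b i = x) -> pres zeta G b p &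
    forall j, quot H (p j) /\ exists2 y, G y & S j (p j) y].
Proof.
move=> HB HN cz gH gz DL Dd Sex; have [p0 [p0P p0d]] := P_bot.
have [|x xE] := card_le_enum _ (Psub_le (below_le zeta)).
  by exists p0; rewrite /= p0d.
have xz i : dom (x i) `<=` below zeta.
  by have : range x (x i); [exists i|rewrite -xE].
pose tasks := DD `*` [set u | u `<=` below zeta /\ small u].
have [tk tkP] : exists tk : L -> dsys * set M,
    forall D u, DD D -> u `<=` below zeta -> small u -> exists j, tk j = (D, u).
  have [T0|/set0P T0] := eqVneq tasks set0.
    exists (fun=> (own_triv set0, set0)) => D u DDD uz su; have : tasks (D, u) by [].
    by rewrite T0.
  have [tk tkE] := card_le_enum T0 (le_setXT DL (leT_subsets (below_le zeta))).
  exists tk => D u DDD uz su; have : tasks (D, u) by [].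
  by rewrite tkE => -[j _ <-]; exists j.
pose met j y := DD (tk j).1 -> (tk j).2 `<=` below zeta -> small (tk j).2 ->
  exists W q, [/\ (tk j).2 `<=` W, W `<=` below zeta, small W,
    (tk j).1 (tk j).2 W q & q <= y].
pose good j s y := [/\ exists2 y', S j s y' & y' <= y,
  x j <= y \/ ~ compatible (x j) y, met j y & quot H y /\ dom y `<=` below zeta].
have [||||| p [f pf]] := @transfinite_chain _ _ L_wf _ g (fun x y => x <= y)
  (fun j f s => islub ([set g] `|` (f @` below j)) s)
  (fun j s => quot H s /\ dom s `<=` below zeta) good.
- by move=> u v w; exact: le_trans.
- by move=> j h h' s e; rewrite (eq_imagel (f' := h')).
- by move=> j h s [ub _] i ij; apply: ub; right; exists i.
- move=> j h s mon st.
  have gh i : i < j -> g <= h i.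
    by move=> ij; have [_ [ub _] sh _] := st i ij; apply: le_trans sh; apply: ub; left.
  have sA : small ([set g] `|` (h @` below j)).
    by apply: smallU; [exact/small_finite/finite_set1|exact/small_image/below_small].
  have cA : chain ([set g] `|` (h @` below j)).
    move=> u v [->|[i ij <-]] [->|[k kj <-]]; [by left|by left; exact: gh|
      by right; exact: gh|].
    by case: (ltgtP i k) => [ik|ki|->]; [left|right|left] => //; exact: mon.
  have [t [tl dt _]] := chain_lub sA cA.
  exists t => //; split.
    apply: (base_lub HB sA cA tl) => _ [->//|[i ij <-]].
    by have [_ _ _ [_ _ _ []]] := st i ij.
  rewrite dt => y [_ [->/gz//|[i ij <-]]].
  by have [_ _ _ [_ _ _ [_]]] := st i ij; exact.
- move=> j s [Hs sz]; have [y1 [Hy1 y1z sy1 Sy1]] := Sex j s Hs sz.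
  have [y2 [Hy2 y12 dec dy2]] := nice_decide HN (x j) Hy1.
  have y2z : dom y2 `<=` below zeta.
    by move=> y /dy2[[/xz//|/y1z//]|yc]; exact: lt_le_trans yc cz.
  have [todo|skip] := pselect (DD (tk j).1 /\ (tk j).2 `<=` below zeta /\ small (tk j).2);
    last first.
    exists y2; first exact: le_trans sy1 y12.
    by split=> //; [exists y1|move=> h1 h2 h3; case: skip].
  have [DDD [uz su]] := todo.
  have [W [q [wW sW Wc Hq [Dq y2q qW]]]] := Dd _ DDD (tk j).2 ((tk j).2 `|` dom y2)
    y2 (smallU su (dom_small y2)) (fun _ h => or_introl h) (fun _ h => or_intror h) Hy2.
  have Wz : W `<=` below zeta.
    move=> y Wy; have [yc|cy] := ltP y c; first exact: lt_le_trans yc cz.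
    by have [/uz|/y2z] := Wc y Wy cy.
  exists q; first exact: le_trans (le_trans sy1 y12) y2q.
  split.
  + by exists y1 => //; exact: le_trans y12 y2q.
  + case: dec => [xy|nc]; [by left; exact: le_trans xy y2q|right].
    by move=> [r xr qr]; apply: nc; exists r => //; exact: le_trans y2q qr.
  + by move=> _ _ _; exists W, q; split=> // y uy; apply: wW; left.
  + by split=> // y /qW/Wz.
have [mono lim] := chain_pres (fun j => let: And4 _ h _ _ := pf j in h)
  (fun j => let: And4 _ _ h _ := pf j in h).
have fp i j : i < j -> f i <= p j.
  by move=> ij; have [_ [ub _] _ _] := pf j; apply: ub; right; exists i.
have gp i : g <= p i by have [_ [ub _] _ _] := pf i; apply: ub; left.
pose G := [set y | exists i, y <= p i].
have Gf i : G (f i) by have [j ij] := L_gt i; exists j; exact: fp.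
have Gp i : G (p i) by exists i.
have Gz y : G y -> dom y `<=` below zeta.
  by move=> [i /dom_le yi] a /yi; have [[_ h] _ _ _] := pf i; exact: h.
have Gq y : G y -> quot H y.
  by move=> [i yi]; have [[h _] _ _ _] := pf i; exact: quot_down yi h.
have xi y : dom y `<=` below zeta -> exists i, x i = y.
  by move=> yz; have : [set p | dom p `<=` below zeta] y by []; rewrite xE => -[i _ <-]; exists i.
have GG : Gen zeta G.
  split.
  - exact: Gz.
  - by move=> u v [i vi] uv; exists i; exact: le_trans uv vi.
  - move=> Q' [Q'G sQ'].
    have [l _] := L_inh.
    have /choice[ix ixP] : forall y, exists i, G y -> y <= p i.
      move=> y; have [[i yi]|nG] := pselect (G y); [by exists i|by exists l].
    have [m mP] := small_bounded (small_image ix sQ').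
    exists (p m) => // y Q'y; apply: le_trans (ixP y (Q'G y Q'y)) _.
    by apply/mono/ltW/mP; exists y.
  - move=> y yz nG; have [i ei] := xi y yz; exists (f i) => //.
    have [_ _ _ [_ dec _ _]] := pf i; rewrite -ei; case: dec => // xf.
    by case: nG; have [j] := Gf i; exists j; rewrite -ei; exact: le_trans xf _.
(* Each element of [H] was decided at some step, and not negatively, being compatible with all of
   P/H. *)
have HG : H `<=` G.
  move=> n Hn; have [i ei] : exists i, x i = n.
    by apply: xi => y /(base_sub HB Hn) yc; exact: lt_le_trans yc cz.
  have [_ _ _ [_ dec _ [qf _]]] := pf i; case: dec => [|[]].
    by rewrite ei; have [j fj] := Gf i; exists j; exact: le_trans fj.
  by rewrite ei; have [r fr nr] := qf n Hn; exists r.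
exists G, p; split=> //.
- by split=> //; have [l _] := L_inh; exists l.
- move=> D DDD u [uz su]; have [j ej] := tkP D u DDD uz su.
  have [_ _ _ [_ _ + _]] := pf j; rewrite /met ej /= => /(_ DDD uz su).
  move=> [W [q [uW Wz sW Dq qf]]]; exists W; split=> //; exists q; split=> //.
  by have [k fk] := Gf j; exists k; exact: le_trans fk.
- move=> j; split; first exact: Gq.
  have [_ _ _ [[y Sy yf] _ _ _]] := pf j; exists y => //.
  by have [k fk] := Gf j; exists k; exact: le_trans fk.
Qed.


(** * From a stepwise invariant to a strategy *)

Section Strategy.
Context {S : Type} (s0 : S) (zt : S -> M) (GG : S -> set P) (gg : S -> P)
  (DD : S -> set dsys) (Inv : M -> (M -> S) -> S -> Prop).

(* What the referee gives to player I at stage [a]: [H] is [G_<a] and [c] the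
   supremum of the earlier [zeta_b]. *)
Definition referee (a : M) (z : M -> S) (c : M) (H : set P) : Prop :=
  [/\ forall b, b < a -> zt (z b) <= c,
      forall y, (forall b, b < a -> zt (z b) <= y) -> c <= y,
      below a = set0 -> H = set0 &
      below a !=set0 -> Gen c H /\ forall b, b < a -> GG (z b) `<=` H].

(** The strategy recomputes the whole run, hidden data included, from the moves of player I so far;
    [Zloc] shows that recomputing at different stages gives the same run. *)
Lemma strategy_ex :
  (forall a z z' s, (forall b, b < a -> z b = z' b) -> Inv a z s -> Inv a z' s) ->
  (forall a z s, Inv a z s -> [/\ Gen (zt s) (GG s),
     forall b, b < a -> zt (z b) <= zt s /\ GG (z b) `<=` GG s,
     GG s (gg s),
     forall D, DD s D -> Defs.meets (L := L) (zt s) (GG s) D &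
     forall b D, b < a -> DD (z b) D -> Defs.meets (L := L) (zt s) (GG s) D]) ->
  (forall a z c H g D0, (forall b, b < a -> Inv b z (z b)) -> referee a z c H ->
     quot H g -> D0 #<= [set: L] ->
     (forall D, D0 D -> density_system (L := L) code c H D) ->
     exists s, [/\ Inv a z s, gg s = g & DD s = D0]) ->
  exists s : strategyII, winning (L := L) code s.
Proof.
move=> loc goal step; have [p0 _] := P_bot.
pose pick a (m : moveI) (Z : M -> S) :=
  pick_or s0 (fun s => [/\ Inv a Z s, gg s = m.1 & DD s = m.2]).
have /choice[Z ZE] : forall x : M -> moveI, exists z : M -> S, forall a,
    z a = pick a (x a) (fun b => if b < a then z b else s0).
  by move=> x; exact: (wo_rec M_wf s0 (fun a => pick a (x a))).
have Zloc x x' a : (forall b, b <= a -> x b = x' b) -> Z x a = Z x' a.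
  elim/(wo_ind M_wf): a => a IH e; rewrite !ZE e //; congr pick.
  apply/funext => b; case: ifP => // ba; apply: IH => // b' b'b.
  by apply: e; exact: le_trans b'b (ltW ba).
(* The moves known at stage [a] are filled up by a dummy move; by [Zloc] it does not influence stage
   [a]. *)
pose ext (a : M) (xr : [set b | b <= a] -> moveI) (b : M) : moveI :=
  if pselect ([set b | b <= a] b) is left h then xr (SigSub (mem_set h))
  else (p0, set0).
exists (fun a xr _ => (zt (Z (ext a xr) a), GG (Z (ext a xr) a))) => x y fol.
have yE a : y a = (zt (Z x a), GG (Z x a)).
  rewrite fol; suff -> : Z (ext a (fun b => x (val b))) a = Z x a by [].
  by apply: Zloc => b ba; rewrite /ext; case: pselect.
have key a : (forall b, b <= a -> legalI code x y b) ->
    [/\ Inv a (Z x) (Z x a), gg (Z x a) = (x a).1 & DD (Z x a) = (x a).2].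
  elim/(wo_ind M_wf): a => a IH leg.
  have [c [H [[[ub lst] H0 HU'] gH DL Dd]]] := leg a (lexx a).
  have ref : referee a (Z x) c H.
    split=> //.
    - by move=> b ba; apply: ub; exists b => //=; rewrite yE.
    - move=> u uP; apply: lst => _ [b ba <-] /=; rewrite yE; exact: uP.
    - move=> /HU'[[[HG sub] _] _]; split=> // b ba p Gp; apply: sub; exists b => //.
      by rewrite /= yE.
  have [s [sI sg sD]] := step a (Z x) c H (x a).1 (x a).2
    (fun b ba => let: And3 h _ _ := IH b ba (fun b' b'b => leg b' (le_trans b'b (ltW ba)))
       in h) ref gH DL Dd.
  have [] : [/\ Inv a (fun b => if b < a then Z x b else s0) (Z x a),
      gg (Z x a) = (x a).1 & DD (Z x a) = (x a).2].
    rewrite [in Z x a]ZE /pick.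
    apply: (@pick_orP _ s0 (fun s => [/\ Inv a (fun b => if b < a then Z x b else s0) s,
       gg s = (x a).1 & DD s = (x a).2])).
    by exists s; split=> //; apply: loc sI => b ->.
  by move=> h ? ?; split=> //; apply: loc h => b ->.
move=> a leg; have [/goal[G1 mon Gg m1 m2] eg eD] := key a leg.
split; rewrite ?yE //=.
- by move=> b ba; rewrite yE; exact: mon.
- by rewrite -eg.
move=> b D /le_eq_lt[->|ba] xD; first by apply: m1; rewrite eD.
apply: m2 (ba) _; have [|_ _ ->//] := key b.
by move=> b' b'b; apply: leg; exact: le_trans b'b (ltW ba).
Qed.

End Strategy.

(** * Uncountable lambda: guessing and commitments *)

Section Uncountable.
Hypothesis (unctbl : card_lt [set: nat] [set: L]).

(** The club filter, given by the limit closure points of functions; intersections and diagonal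
    intersections become operations on functions. *)
Definition almost (phi : L -> Prop) : Prop := exists f : L -> L,
  forall e, is_limit e -> (forall i, i < e -> f i < e) -> phi e.

Lemma almost_mono (phi psi : L -> Prop) : (forall e, phi e -> psi e) ->
  almost phi -> almost psi.
Proof. by move=> h [f fP]; exists f => e el /(fP e el)/h. Qed.

Lemma almost_all (phi : L -> Prop) : (forall e, phi e) -> almost phi.
Proof. by move=> h; exists id. Qed.

Lemma almost_limit : almost is_limit. Proof. by exists id. Qed.

(** Normality of the club filter: [s i j] bounds [f i] below [j], and [g j] bounds [s i j] for
    [i < j]; a limit closed under [g] is then closed under each [f i] with [i < e]. *)
Lemma almost_diag (phi : L -> L -> Prop) : (forall i, almost (phi i)) ->
  almost (fun e => forall i, i < e -> phi i e).
Proof.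
move=> /choice[f fP].
have /choice[s sP] : forall i, exists s : L -> L,
    forall j k, k < j -> f i k < s j.
  move=> i; have /choice[s sP] : forall j, exists y, forall k, k < j -> f i k < y.
    by move=> j; exact: image_bounded.
  by exists s.
have /choice[g gP] : forall j, exists y, forall i, i < j -> s i j < y.
  by move=> j; have [m h] := image_bounded (s^~ j) j; exists m => i; exact: h.
exists g => e el ge i ie; apply: fP => // k ke.
have [_ h] := el; have [|j mj je] := h (Order.max i k); first by rewrite gt_max ie ke.
move: mj; rewrite gt_max => /andP[ij kj].
exact: lt_trans (sP _ _ _ kj) (lt_trans (gP _ _ ij) (ge _ je)).
Qed.

Lemma almost_and (phi psi : L -> Prop) : almost phi -> almost psi ->
  almost (fun e => phi e /\ psi e).
Proof.
move=> [f fP] [g gP]; exists (fun i => Order.max (f i) (g i)) => e el h.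
by split; [apply: fP|apply: gP] => // i /h; rewrite gt_max => /andP[].
Qed.

Lemma almost_closed (f : L -> L) : almost (fun e => forall i, i < e -> f i < e).
Proof. by exists f. Qed.

Lemma almost_gt (i : L) : almost (fun e => i < e).
Proof. by exists (fun=> i) => e [[x xe] _] h; exact: h x xe. Qed.

Lemma almost_closed2 (f : L -> L -> L) :
  almost (fun e => forall i j, i < e -> j < e -> f i j < e).
Proof.
have := almost_diag (fun i => almost_closed (f i)).
by apply: almost_mono => e h i j ie je; exact: h.
Qed.

Lemma almost_small (F : L -> set L) : (forall i, small (F i)) ->
  almost (fun e => forall i x, i < e -> F i x -> x < e).
Proof.
move=> sF; have /choice[f fP] : forall i, exists m, forall x, F i x -> x < m.
  by move=> i; exact: small_bounded.
by exists f => e el h i x ie /fP xf; exact: lt_trans xf (h _ ie).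
Qed.

(** The closure points form a club: the supremum of omega iterations is closed, and it exists
    because countable sets are bounded in an uncountable regular lambda. *)
Lemma stationary_almost (S : set L) phi : stationary S -> almost phi ->
  exists e, S e /\ phi e.
Proof.
move=> stS [f fP]; pose C := [set e | is_limit e /\ forall i, i < e -> f i < e].
suff /stS[e [Se [el ce]]] : is_club C by exists e; split=> //; exact: fP.
split=> [x|a la h]; last first.
  split=> // i /h[c [[_ hc] ic ca]]; exact: lt_trans (hc _ ic) ca.
have /choice[nx nxP] : forall y, exists y', y < y' /\ forall i, i <= y -> f i < y'.
  move=> y; have [y1 yy1] := L_gt y; have [y2 y2P] := image_bounded f y1.
  exists (Order.max y1 y2); rewrite lt_max yy1; split=> // i iy.
  by rewrite lt_max (y2P i) ?orbT //; exact: le_lt_trans iy yy1.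
pose a n := iter n nx x.
have aS n : a n < a n.+1 by have [] := nxP (a n).
have [b bP] := small_bounded (small_image a unctbl).
have [|e eP emin] := wo_least L_wf (S := [set e | forall n, a n < e]).
  by exists b => n; apply: bP; exists n.
have cof y : y < e -> exists n, y <= a n.
  move=> ye; apply: contrapT => h; suff : e <= y by rewrite leNgt ye.
  by apply: emin => n; rewrite ltNge; apply/negP => ya; apply: h; exists n.
exists e; last by apply/ltW; exact: (eP 0%N).
split.
  split; first by exists (a 0%N).
  by move=> y /cof[n yn]; exists (a n.+1) => //; exact: le_lt_trans yn (aS n).
move=> i /cof[n yn]; have [_ /(_ _ yn) h] := nxP (a n).
exact: lt_trans h (eP n.+1).
Qed.

(** Triples are coded by ordinals below lambda; when [e] is closed under the pairing and above the
    codes of the naturals, a guess for the coded relation below [e] decodes to one for [R] below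
    [e]. *)
Lemma guess : Dl L -> exists AA : L -> set (set (nat * L * L)),
  (forall e, small (AA e)) /\
  forall (R : set (nat * L * L)) phi, almost phi ->
    exists e, phi e /\ AA e [set x | [/\ R x, x.1.2 < e & x.2 < e]].
Proof.
move=> [AA [_ sA stA]]; have [pr prI] := L_pair; have [l _] := L_inh.
have [nu _ nuI] := card_le_inj l unctbl.1.
pose kp (x : nat * L * L) := pr (nu x.1.1) (pr x.1.2 x.2).
have kpI x y : kp x = kp y -> x = y.
  case: x y => [[n i] j] [[n' i'] j'] /prI[/= /nuI e /prI[/= e1 e2]].
  by rewrite e // e1 e2.
exists (fun e => (fun B => [set x | [/\ B (kp x), x.1.2 < e & x.2 < e]]) @` AA e).
split=> [e|R phi aphi]; first exact: small_image.
have [m mP] := small_bounded (small_image nu unctbl).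
have := almost_and aphi (almost_and (almost_gt m) (almost_closed2 pr)).
move=> /(stationary_almost (stA (kp @` R)))[e [Ae [phie [me pre]]]].
exists e; split=> //; exists ((kp @` R) `&` below e) => //.
apply/seteqP; split=> -[[n i] j] /=.
  by move=> [[[y Ry /kpI e'] _] ie je]; split; rewrite -?e'.
move=> [Rx ie je]; split=> //; split; first by exists (n, i, j).
apply: (pre) => //; last exact: (pre).
by apply: lt_trans me; apply: mP; exists n.
Qed.

(** Each presentation catches up with the trace of the other on [c]; at a limit closed under both
    catching-up functions the two lubs coincide. *)
Lemma pres_coherent c H c' H' b p b' p' : base c H -> Gen c' H' -> c <= c' ->
  H `<=` H' -> pres c H b p -> pres c' H' b' p' ->
  almost (fun e => wset b c e = wset b' c' e `&` below c /\
                   (H !=set0 -> restr (p' e) c = p e)).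
Proof.
move=> HB HG cc HH pr pr'; apply: almost_and.
  have /choice[f fP] : forall i, exists j, b i < c -> b' j = b i.
    move=> i; have [bi|nb] := pselect (b i < c); last by exists i.
    by have [j e] := pres_b pr' (lt_le_trans bi cc); exists j.
  have /choice[f' fP'] : forall i, exists j, b' i < c -> b j = b' i.
    move=> i; have [bi|nb] := pselect (b' i < c); last by exists i.
    by have [j e] := pres_b pr bi; exists j.
  apply: almost_mono (almost_and (almost_closed f) (almost_closed f')) => e [cf cf'].
  apply/seteqP; split=> x.
    move=> [[i ie <-] bc]; split=> //; split; last exact: lt_le_trans bc cc.
    by exists (f i); [exact: cf|rewrite fP].
  move=> [[[i ie <-] bc'] bc]; split=> //.
  by exists (f' i); [exact: cf'|rewrite fP'].
have [H0|/set0P H0] := eqVneq H set0.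
  by apply: almost_all => e; rewrite H0 => -[].
have H'0 : H' !=set0 by case: H0 => x /HH; exists x.
have /choice[f fP] : forall i, exists j, p i <= p' j.
  by move=> i; apply: (pres_cof pr'); apply/HH/(pres_in pr).
have /choice[f' fP'] : forall i, exists j, restr (p' i) c <= p j.
  move=> i; apply: (pres_cof pr).
  apply: (gen_mono HB HG HH (@dom_restrS _ _) _ H0).
  by apply: (gen_down HG (pres_in pr' i H'0)); exact: restr_le.
have := almost_and almost_limit (almost_and (almost_closed f) (almost_closed f')).
apply: almost_mono => e [el [cf cf']] _; apply/eqP; rewrite eq_le; apply/andP; split.
  have [||_ _ /(_ c)[_ h]] := islub_slub _ _ (pres_lim pr' el).
  - exact/small_image/below_small.
  - move=> _ _ [i _ <-] [j _ <-].
    by have [ij|/ltW ji] := leP i j; [left|right]; exact: pres_mono pr' _ _ _.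
  apply: h => _ [_ [i ie <-] <-]; apply: le_trans (fP' i) _.
  exact/(pres_mono pr)/ltW/cf'.
have [_ h] := pres_lim pr el; apply: h => _ [i ie <-]; apply: le_restr.
  exact: le_trans (fP i) (pres_mono pr' (ltW (cf _ ie))).
exact: base_sub HB _ (pres_in pr i H0).
Qed.

(* A shape is the collapse of an approximation below e of an object: an ideal
   over [oc] generated by [op], along [ob], and a task, namely to meet the
   density system number [ok] at ([ou], W), W containing [ow], above the
   conditions [orr] and [orr'].  The ordinal [sxi] is the part of the collapse
   coming from below [oc]. *)
Record shape : Type := Shape {
  sxi : M; spp : P; su : set M; sw : set M; sr : P; sr' : P; sk : L
}.

Record obj : Type := Obj {
  oc : M; ob : L -> M; op : L -> P; ou : set M; ow : set M;
  orr : P; orr' : P; ok : L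
}.

Definition oW (o : obj) (e : L) : set M :=
  (ob o @` below e) `&` (below (oc o) `|` ow o).

(** At such [e], and these form a club, the approximation of the object at [e] is described entirely
    by ordinals below [e]. *)
Record okay (o : obj) (e : L) : Prop := Okay {
  okay_mono : forall i j, i <= j -> op o i <= op o j;
  okay_lub : islub (op o @` below e) (op o e);
  okay_dom : forall i, i < e -> dom (op o i) `<=` oW o e `&` below (oc o);
  okay_fst : forall i, i < e -> (code (op o i)).1 < e;
  okay_w : ow o `<=` oW o e;
  okay_u : ou o `<=` ow o;
  okay_r : dom (orr o) `<=` ow o;
  okay_r' : dom (orr' o) `<=` ow o;
  okay_r1 : (code (orr o)).1 < e;
  okay_r1' : (code (orr' o)).1 < e;
  okay_k : ok o < e
}.

Definition shape_of (o : obj) (e : L) : shape :=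
  let r := rk (oW o e) in
  Shape (r (oc o)) (img r (op o e)) (r @` ou o) (r @` ow o)
    (img r (orr o)) (img r (orr' o)) (ok o).

(* For almost all e, [rel o] below e determines the shape of [o] at e. *)
Definition rel (o : obj) : set (nat * L * L) := fun x =>
  let i := x.1.2 in let j := x.2 in
  match x.1.1 with
  | 0 => ob o i < ob o j
  | 1 => ob o i < oc o
  | 2 => ow o (ob o i)
  | 3 => ou o (ob o i)
  | 4 => dom (orr o) (ob o i)
  | 5 => dom (orr' o) (ob o i)
  | 6 => i = (code (orr o)).1
  | 7 => i = (code (orr' o)).1
  | 8 => i = ok o
  | 9 => dom (op o i) (ob o j)
  | _ => (code (op o i)).1 = j
  end.

Lemma img_eqP g p p' : smono g (dom p) -> (code p').1 = (code p).1 ->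
  dom p' = g @` dom p -> img g p = p'.
Proof.
move=> gm e1 e2; apply: imgE => //; rewrite /is_image /cmap.
by rewrite [LHS]surjective_pairing e1; congr pair.
Qed.

(** The relations make [ob o i] to [ob o' i] an order-isomorphism [g] that carries all data of [o]
    at [e] to those of [o'], and the collapse does not see [g]. The condition at [e] itself follows
    since it is the lub of the earlier ones. *)
Lemma shape_det o o' e : okay o e -> okay o' e ->
  (forall n i j, i < e -> j < e -> rel o (n, i, j) <-> rel o' (n, i, j)) ->
  shape_of o e = shape_of o' e.
Proof.
move=> h h' R.
pose g x := ob o' (pick_or e (fun i => i < e /\ ob o i = x)).
have gE i : i < e -> g (ob o i) = ob o' i.
  move=> ie; rewrite /g; set j := pick_or _ _.
  have [je ej] : j < e /\ ob o j = ob o i.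
    by apply: (@pick_orP _ e (fun j => j < e /\ ob o j = ob o i)); exists i.
  have := R 0%N i j ie je; have := R 0%N j i je ie.
  rewrite /rel /= ej ltxx => -[_ h1] [_ h2].
  by case: (ltgtP (ob o' j) (ob o' i)) => // [/h1|/h2].
pose W := oW o e; pose W' := oW o' e.
have gW : smono g W.
  move=> _ _ [[i ie <-] _] [[j je <-] _] lt; rewrite !gE //.
  exact/(R 0%N i j ie je).
have imE A A' n : (forall x, A x -> exists2 i, i < e & ob o i = x) ->
    (forall x, A' x -> exists2 i, i < e & ob o' i = x) ->
    (forall i, i < e -> rel o (n, i, i) <-> A (ob o i)) ->
    (forall i, i < e -> rel o' (n, i, i) <-> A' (ob o' i)) -> A' = g @` A.
  move=> Ai A'i RA RA'; apply/seteqP; split=> [x A'x|_ [x Ax <-]].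
    have [i ie ix] := A'i x A'x; exists (ob o i); last by rewrite gE.
    by apply/RA/R => //; apply/RA'; rewrite ?ix.
  have [i ie ix] := Ai x Ax; rewrite -ix gE //.
  by apply/RA'/R => //; apply/RA; rewrite ?ix.
have Wi x : W x -> exists2 i, i < e & ob o i = x by move=> [[i ie <-] _]; exists i.
have Wi' x : W' x -> exists2 i, i < e & ob o' i = x by move=> [[i ie <-] _]; exists i.
have wE : ow o' = g @` ow o.
  by apply: (imE _ _ 2%N) => // x; [move/(okay_w h)/Wi|move/(okay_w h')/Wi'].
have uE : ou o' = g @` ou o.
  apply: (imE _ _ 3%N) => // x.
    by move/(okay_u h)/(okay_w h)/Wi.
  by move/(okay_u h')/(okay_w h')/Wi'.
have rE : dom (orr o') = g @` dom (orr o).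
  apply: (imE _ _ 4%N) => // x.
    by move/(okay_r h)/(okay_w h)/Wi.
  by move/(okay_r h')/(okay_w h')/Wi'.
have r'E : dom (orr' o') = g @` dom (orr' o).
  apply: (imE _ _ 5%N) => // x.
    by move/(okay_r' h)/(okay_w h)/Wi.
  by move/(okay_r' h')/(okay_w h')/Wi'.
have kE : ok o = ok o'.
  by apply: (R 8%N (ok o) (ok o) (okay_k h) (okay_k h)).1.
have r1 : (code (orr o)).1 = (code (orr o')).1.
  exact: (R 6%N (code (orr o)).1 _ (okay_r1 h) (okay_r1 h)).1 (erefl _).
have r1' : (code (orr' o)).1 = (code (orr' o')).1.
  exact: (R 7%N (code (orr' o)).1 _ (okay_r1' h) (okay_r1' h)).1 (erefl _).
have bE : W' `&` below (oc o') = g @` (W `&` below (oc o)).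
  apply: (imE _ _ 1%N) => [x [/Wi]//|x [/Wi']//|i ie|i ie].
    split=> [lt|[]//]; split=> //; split; [by exists i|by left].
  split=> [lt|[]//]; split=> //; split; [by exists i|by left].
have pE i : i < e -> img g (op o i) = op o' i.
  move=> ie; have d1 := okay_dom h ie; have d2 := okay_dom h' ie.
  apply: img_eqP; first by apply: smono_sub gW => x /d1[].
    exact: (R 10%N i _ ie (okay_fst h ie)).1 (erefl _).
  apply/seteqP; split=> [x xp|_ [x xp <-]].
    have [/Wi'[j je jx] _] := d2 x xp; exists (ob o j); last by rewrite gE.
    by apply: (R 9%N i j ie je).2; rewrite /rel/= jx.
  have [/Wi[j je jx] _] := d1 x xp; rewrite -jx gE //.
  by apply: (R 9%N i j ie je).1; rewrite /rel/= jx.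
have sA : small (op o @` below e) by exact/small_image/below_small.
have chA : chain (op o @` below e).
  move=> _ _ [i ie <-] [j je <-].
  by have [ij|/ltW ji] := leP i j; [left|right]; exact: okay_mono h _ _ _.
have [_ dpe _] := islub_slub sA chA (okay_lub h).
have peW : dom (op o e) `<=` W.
  by rewrite dpe => x [_ [i ie <-] /(okay_dom h ie)[]].
have peE : img g (op o e) = op o' e.
  apply: islub_uniq (lub_img sA chA (okay_lub h) (smono_sub peW gW)) _.
  have -> : img g @` (op o @` below e) = op o' @` below e; last exact: okay_lub h'.
  by rewrite image_comp; apply: eq_imagel => i ie /=; rewrite pE.
have WE : W' = g @` W.
  apply/seteqP; split=> [x [[i ie ix] [xc|xw]]|_ [x [[i ie ix] [xc|xw]] <-]].
  - have : (W' `&` below (oc o')) x by split=> //; split; [exists i|left].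
    by rewrite bE => -[y [Wy _] <-]; exists y.
  - by move: xw; rewrite wE => -[y yw <-]; exists y => //; exact: okay_w h _ yw.
  - have : (g @` (W `&` below (oc o))) (g x).
      by exists x => //; split=> //; split; [exists i|left].
    by rewrite -bE => -[].
  - by apply: (okay_w h'); rewrite wE; exists x.
have rkE x : W x -> rk W' (g x) = rk W x by rewrite WE => Wx; exact: rk_iso.
have rE2 A : A `<=` W -> rk W' @` (g @` A) = rk W @` A.
  by move=> AW; rewrite image_comp; apply: eq_imagel => x /AW/rkE.
have iE p : dom p `<=` W -> img (rk W') (img g p) = img (rk W) p.
  move=> pW; have gp := smono_sub pW gW.
  have rg : smono (rk W') (g @` dom p).
    apply: (smono_sub (w := W')); last exact: rk_smono.
    by rewrite WE => _ [x /pW Wx <-]; exists x.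
  rewrite img_comp //; symmetry; apply: img_ext; last exact: smono_sub (@rk_smono W).
  by move=> x /pW Wx /=; rewrite rkE.
rewrite /shape_of -/W -/W'; congr Shape => //.
- apply/eqP; rewrite eq_le; apply/andP; split; apply: rk_min => z Wz zc.
    have : (g @` (W `&` below (oc o))) (g z) by exists z.
    by rewrite -bE => -[W'z z'c]; rewrite -rkE //; exact: rk_lt.
  have : (W' `&` below (oc o')) z by [].
  by rewrite bE => -[y [Wy yc] <-]; rewrite rkE //; exact: rk_lt.
- by rewrite -peE iE.
- by rewrite uE rE2 // => x /(okay_u h)/(okay_w h).
- by rewrite wE rE2 // => x /(okay_w h).
- have <- : img g (orr o) = orr o'.
    by apply: img_eqP => //; apply: smono_sub gW => x /(okay_r h)/(okay_w h).
  by rewrite iE // => x /(okay_r h)/(okay_w h).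
- have <- : img g (orr' o) = orr' o'.
    by apply: img_eqP => //; apply: smono_sub gW => x /(okay_r' h)/(okay_w h).
  by rewrite iE // => x /(okay_r' h)/(okay_w h).
Qed.

Lemma shape0_ex : exists t0 : shape, True.
Proof.
by have [p0 _] := P_bot; have [m0 _] := M_bot; have [l _] := L_inh;
  exists (Shape m0 p0 set0 set0 p0 p0 l).
Qed.

Lemma almost_okay o H : pres (oc o) H (ob o) (op o) -> base (oc o) H -> H !=set0 ->
  (forall x, ow o x -> exists i, ob o i = x) -> small (ow o) ->
  ou o `<=` ow o -> dom (orr o) `<=` ow o -> dom (orr' o) `<=` ow o ->
  almost (okay o).
Proof.
move=> pr HB H0 wb sw uw rw rw'.
have [l _] := L_inh.
have /choice[idx idxP] : forall x, exists i, x < oc o \/ ow o x -> ob o i = x.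
  move=> x; have [h|] := pselect (x < oc o \/ ow o x); last by exists l.
  have [i e] : exists i, ob o i = x by case: h; [exact: pres_b pr x|exact: wb].
  by exists i.
have [m mP] := small_bounded (small_image idx sw).
pose big := Order.max m (Order.max (code (orr o)).1 (Order.max (code (orr' o)).1 (ok o))).
have := almost_and almost_limit (almost_and (almost_gt big) (almost_and
  (almost_small (F := fun i => idx @` dom (op o i)) (fun i => small_image _ (dom_small _)))
  (almost_closed (fun i => (code (op o i)).1)))).
apply: almost_mono => e [el [be [sme fe]]].
move: be; rewrite !gt_max => /and4P[me r1 r1' ke].
split=> //.
- exact: pres_mono pr.
- exact: pres_lim pr e el.
- move=> i ie x xp; have xc : x < oc o := base_sub HB (pres_in pr i H0) xp.
  split=> //; split; last by left.
  by exists (idx x); [apply: (sme i) => //; exists x|apply: idxP; left].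
- move=> x xw; split; last by right.
  exists (idx x); last by apply: idxP; right.
  by apply: lt_trans me; apply: mP; exists x.
Qed.

(** * Commitments and their validity *)

Section Guessing.
Variable (AA : L -> set (set (nat * L * L))).
Hypothesis (AAsmall : forall e, small (AA e)).
Hypothesis (AAguess : forall (R : set (nat * L * L)) phi, almost phi ->
    exists e, phi e /\ AA e [set x | [/\ R x, x.1.2 < e & x.2 < e]]).

(* The shapes guessed at e. *)
Definition TT (e : L) : set shape := [set t | exists o,
  [/\ okay o e, AA e [set x | [/\ rel o x, x.1.2 < e & x.2 < e]] &
      t = shape_of o e]].

(** By [shape_det] a guessed relation determines the shape, so there are no more shapes at [e] than
    guesses. *)
Lemma TT_small e : small (TT e).
Proof.
have [t0 _] := shape0_ex.
apply: small_le (AAsmall e).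
pose good B t := exists o, [/\ okay o e,
   B = [set x | [/\ rel o x, x.1.2 < e & x.2 < e]] & t = shape_of o e].
apply: (enum_card_le (f := fun B => pick_or t0 (good B))).
move=> t [o [oko AAo et]]; eexists; first exact: AAo.
set B := [set x | _].
have [o' [oko' e1 ->]] : good B (pick_or t0 (good B)).
  by apply: pick_orP; exists t, o.
rewrite et; apply: shape_det => // n i j ie je.
have : B (n, i, j) <-> rel o' (n, i, j) by rewrite e1 /=; split=> [[]|].
by rewrite /B /= => h; split=> [/h[]//|ho]; apply/h.
Qed.

Lemma TT_hit o phi : almost phi -> almost (okay o) ->
  exists e, [/\ phi e, okay o e & TT e (shape_of o e)].
Proof.
move=> aphi ao; have [e [[? ?] ?]] := AAguess (rel o) (almost_and aphi ao).
by exists e; split=> //; exists o.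
Qed.

Record shape_ok (t : shape) : Prop := ShapeOk {
  so_xi : small (below (sxi t));
  so_pp : dom (spp t) `<=` below (sxi t);
  so_w : small (sw t);
  so_u : su t `<=` sw t;
  so_r : dom (sr t) `<=` sw t;
  so_r' : dom (sr' t) `<=` sw t
}.

Lemma shape_of_ok o e : okay o e -> shape_ok (shape_of o e).
Proof.
move=> h; have sW : small (oW o e).
  by apply: small_sub (small_image (ob o) (below_small e)) => x [].
have rW A : A `<=` oW o e -> smono (rk (oW o e)) A.
  by move=> AW; exact: smono_sub (@rk_smono _).
have sA : small (op o @` below e) by exact/small_image/below_small.
have chA : chain (op o @` below e).
  move=> _ _ [i ie <-] [j je <-].
  by have [ij|/ltW ji] := leP i j; [left|right]; exact: okay_mono h _ _ _.
have [_ dpe _] := islub_slub sA chA (okay_lub h).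
have peW : dom (op o e) `<=` oW o e `&` below (oc o).
  by rewrite dpe => x [_ [i ie <-] /(okay_dom h ie)].
have wW := okay_w h; have rr := subset_trans (okay_r h) wW.
have rr' := subset_trans (okay_r' h) wW.
split=> /=.
- apply: small_sub (small_image (rk (oW o e)) sW) => x /rk_init[z [Wz _ <-]].
  by exists z.
- rewrite dom_img; first by move=> _ [x /peW[Wx xc] <-]; exact: rk_lt.
  by apply: rW => x /peW[].
- by apply: small_image; exact: small_sub wW sW.
- by apply: image_subset; exact: okay_u h.
- by rewrite (dom_img (rW _ rr)); apply: image_subset; exact: okay_r h.
- by rewrite (dom_img (rW _ rr')); apply: image_subset; exact: okay_r' h.
Qed.

Lemma TT_ok e t : TT e t -> shape_ok t.
Proof. by move=> [o [oko _ ->]]; exact: shape_of_ok. Qed.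

(* The shape [t] extends the approximation [(w, pe)] of [(c, H)]. *)
Definition Ext (c : M) (H : set P) (w : set M) (pe : P) (t : shape) : Prop :=
  th c w <= sxi t /\
  (H !=set0 -> img (hh c w) (restr (spp t) (th c w)) = pe).

(* The collapsed conditions whose copies over [(c, H)] lie in P/H. *)
Definition Qs (c : M) (H : set P) (w : set M) : set P :=
  [set p | quot H (img (hh c w) p)].

Definition KK (c : M) (H : set P) (e : L) (w : set M) (pe : P) : set shape :=
  [set t | TT e t /\ Ext c H w pe t].

(** The ideal [H] honours what was promised at [e] to the shapes passing through its approximation
    at [e]. *)
Definition valid_at (F : L -> shape -> P) c H e w pe : Prop :=
  coherent sxi spp (KK c H e w pe) (F e) /\
  forall t, KK c H e w pe t -> Qs c H w (F e t) /\ spp t <= F e t.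

(** Quantifying over all presentations makes this a property of the pair (c, H); by [valid_pres] one
    presentation suffices to check it. *)
Definition valid (F : L -> shape -> P) c H : Prop := forall b p,
  pres c H b p -> almost (fun e => valid_at F c H e (wset b c e) (p e)).

(** This and the next four lemmas verify the hypotheses of [Tree] for level [th c w] and the set
    [Qs c H w]. *)
Lemma Qs_restr c H w p : base c H ->
  Qs c H w p <-> Qs c H w (restr p (th c w)).
Proof.
move=> HB; rewrite /Qs/= (base_quot HB) -(base_quot_restr HB (img _ (restr p _)) (lexx c)).
rewrite -(restr_img (a := c)) ?restr_restr //; first exact: hh_smono.
by move=> x _; rewrite hh_ltc.
Qed.

Lemma Qs_down c H w p q : q <= p -> Qs c H w p -> Qs c H w q.
Proof. by move=> qp; apply: quot_down; apply: img_le qp; exact: hh_smono. Qed.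

Lemma Qs_lub c H w A s : base c H -> small A -> chain A -> islub A s -> A `<=` Qs c H w ->
  Qs c H w s.
Proof.
move=> HB sA cA sl AQ; apply: (base_lub HB (A := img (hh c w) @` A)).
- exact: small_image.
- move=> _ _ [x Ax <-] [y Ay <-].
  by have [xy|yx] := cA _ _ Ax Ay; [left|right]; apply: img_le => //; exact: hh_smono.
- by apply: lub_img => //; exact: hh_smono.
- by move=> _ [x Ax <-]; exact: AQ.
Qed.

Lemma Qs_amalg c H w p n a : nice c H -> th c w <= a -> Qs c H w p -> Qs c H w n ->
  restr p a <= n -> dom n `<=` below a ->
  exists r, [/\ Qs c H w r, p <= r, n <= r & dom r = dom p `|` dom n].
Proof.
move=> HN ta Qp Qn pn na; set h := hh c w; have hm v : smono h v by exact: hh_smono.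
have [|||r [Qr pr nr dr]] := nice_amalg HN (a := h a) _ Qp Qn.
- by rewrite leNgt hh_ltc -leNgt.
- rewrite (restr_img (b := a)) //; first exact: img_le.
  by move=> x _; exact: hh_ltE.
- by rewrite dom_img // => _ [x /na xa <-]; exact: hh_lt.
rewrite !dom_img // in dr.
have [|r' _ r'E] := @img_surj h setT r (hm _).
  by rewrite dr => x [] [y _ <-]; exists y.
exists r'; split.
- by rewrite /Qs/= r'E.
- by apply: (le_img_inv (hm setT)) => //; rewrite r'E.
- by apply: (le_img_inv (hm setT)) => //; rewrite r'E.
apply/seteqP; rewrite -r'E dom_img // in dr; split=> x xr.
  have : (h @` dom r') (h x) by exists x.
  by rewrite dr => -[] [y yd /(smono_inj (hm setT) I I) <-]; [left|right].
have : (h @` dom p `|` h @` dom n) (h x).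
  by case: xr => ?; [left|right]; exists x.
by rewrite -dr => -[y yr /(smono_inj (hm setT) I I) <-].
Qed.

Lemma KK_sim c H w e pe t s a : base c H -> KK c H e w pe t -> KK c H e w pe s ->
  sim sxi spp a t s -> sim sxi spp (th c w) t s.
Proof.
move=> HB [Tt [tx tE]] [Ts [sx sE]] ts; split=> //.
have [H0|/set0P H0] := eqVneq H set0.
  have [[_ cm]|[_ _ h0 _]] := HB; last first.
    have [|r Hr _] := h0 set0; last by rewrite H0 in Hr.
    by split=> //; exact: small_finite.
  (* At the start of the game [c] is the least ordinal, so [th c w] is least as well. *)
  have at_ : th c w <= a.
    by rewrite leNgt -hh_ltc -leNgt; exact: cm.
  by case: (sim_le at_ ts).
have hm v : smono (hh c w) v by exact: hh_smono.
have e1 := tE H0; have e2 := sE H0; apply/eqP; rewrite eq_le.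
by apply/andP; split; apply: (le_img_inv (hm setT)) => //; rewrite e1 e2.
Qed.

(* The task of [t], copied over [(c, w)]: it is fulfilled, or [s] excludes it.
   Such [s] are dense for trivial reasons. *)
Definition EE (D : L -> dsys) (c : M) (w : set M) (t : shape) (s : P) : Prop :=
  let h := hh c w in
  let Dt := D (sk t) (h @` su t) (h @` (below (sxi t) `|` sw t)) in
  (exists q, [/\ Dt q, img h (sr t) <= q, img h (sr' t) <= q &
                 restr q (h (sxi t)) <= img h s]) \/
  (forall q, Dt q -> img h (sr t) <= q -> img h (sr' t) <= q ->
     ~ img h s <= restr q (h (sxi t))).

Lemma next_at (D : L -> dsys) c H F e w pe : base c H -> nice c H ->
  (forall k u v q, in_ddom (L := L) u v -> D k u v q -> quot H q /\ dom q `<=` v) ->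
  valid_at F c H e w pe ->
  exists F', [/\ coherent sxi spp (KK c H e w pe) F',
   forall t, F e t <= F' t & forall t, KK c H e w pe t ->
     Qs c H w (F' t) /\ exists2 s, EE D c w t s & s <= F' t].
Proof.
move=> HB HN DQ [Fc FQ]; set K := KK c H e w pe in Fc FQ *.
have hm v : smono (hh c w) v by exact: hh_smono.
have [F' [F'c FF' F'Q F'E]] : exists F', [/\ coherent sxi spp K F',
    forall t, K t -> F e t <= F' t, forall t, K t -> Qs c H w (F' t) &
    forall t, K t -> exists2 s, EE D c w t s & s <= F' t].
  apply: (@tree_meet _ _ _ _ (th c w)) => //.
  - by apply: small_sub (TT_small e) => t [].
  - by move=> t [_ []].
  - by move=> t s a; exact: KK_sim.
  - by move=> p; exact: Qs_restr.
  - by move=> p q; exact: Qs_down.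
  - by move=> A s; exact: Qs_lub.
  - by move=> p n a; exact: Qs_amalg.
  - by move=> t /FQ[].
  move=> t s [Tt _] Qss sd; have tok := TT_ok Tt.
  set h := hh c w; set V := h @` (below (sxi t) `|` sw t).
  have dd : in_ddom (L := L) (h @` su t) V.
    split; first by apply: image_subset => x /(so_u tok); right.
    by split=> //; apply: small_image; apply: smallU; [exact: so_xi tok|exact: so_w tok].
  (* If some admissible [q] in the system has its trace above the copy of [s], then [s] is raised to
     the pull-back of that trace; otherwise [s] already excludes the task. *)
  have [[q [Dq rq r'q sq]]|nq] := pselect (exists q, [/\ D (sk t) (h @` su t) V q,
     img h (sr t) <= q, img h (sr' t) <= q & img h s <= restr q (h (sxi t))]).
    have [Hq qV] := DQ _ _ _ _ dd Dq.
    have [|s' s'd s'E] := img_surj (hm (below (sxi t))) (r := restr q (h (sxi t))).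
      rewrite dom_restr => _ [/qV[x _ <-] lt].
      by exists x => //; rewrite /below/= -(hh_ltE c w).
    exists s'; split=> //.
    - by left; exists q; rewrite s'E.
    - by apply: (le_img_inv (hm setT)) => //; rewrite s'E.
    - by rewrite /Qs/= s'E; apply: quot_down Hq; exact: restr_le.
  exists s; split=> //; right=> q Dq rq r'q sq; apply: nq.
  by exists q; split.
exists (fun t => if pselect (K t) then F' t else F e t); split.
- split=> [t Kt|t s a Kt Ks ts].
    by case: pselect => //= _; case: F'c => h _; exact: h.
  case: pselect => //= _; case: pselect => //= _.
  by case: F'c => _ h; exact: h ts.
- by move=> t; case: pselect => //= Kt; exact: FF'.
- by move=> t Kt; case: pselect => //= _; split; [exact: F'Q|exact: F'E].
Qed.

Lemma pres_agree c H b p b' p' : base c H -> pres c H b p -> pres c H b' p' ->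
  almost (fun e => wset b c e = wset b' c e /\ (H !=set0 -> p' e = p e)).
Proof.
move=> HB pr pr'; have [[H0 cm]|HG] := HB.
  apply: almost_all => e; split; last by rewrite H0 => -[].
  suff E (b0 : L -> M) : wset b0 c e = set0 by rewrite !E.
  by apply/seteqP; split=> // x [_ xc]; move: (xc : x < c); rewrite ltNge cm.
have := pres_coherent HB HG (lexx c) (fun x h => h) pr pr'.
apply: almost_mono => e [e1 e2]; split.
  by rewrite e1 /wset -setIA setIid.
move=> H0; rewrite -e2 // restr_id //.
exact: gen_sub HG _ (pres_in pr' e H0).
Qed.

Lemma KK_ext c H e w pe pe' : (H !=set0 -> pe' = pe) ->
  KK c H e w pe = KK c H e w pe'.
Proof.
move=> h; apply/seteqP; split=> t [? [? E]]; split=> //; split=> // H0.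
  by rewrite h // E.
by rewrite E // h.
Qed.

Lemma valid_pres F c H b p : base c H -> pres c H b p ->
  almost (fun e => valid_at F c H e (wset b c e) (p e)) -> valid F c H.
Proof.
move=> HB pr ap b' p' pr'.
apply: almost_mono (almost_and ap (pres_agree HB pr pr')) => e [v [<- pe]].
by move: v; rewrite /valid_at (KK_ext c e _ pe).
Qed.

Lemma next_family (D : L -> dsys) c H F b p : base c H -> nice c H ->
  (forall k u v q, in_ddom (L := L) u v -> D k u v q -> quot H q /\ dom q `<=` v) ->
  pres c H b p -> valid F c H ->
  exists F', [/\ forall e t, F e t <= F' e t, valid F' c H &
    almost (fun e => forall t, KK c H e (wset b c e) (p e) t ->
       exists2 s, EE D c (wset b c e) t s & s <= F' e t)].
Proof.
move=> HB HN DQ pr Fv.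
have /choice[F' F'P] : forall e, exists F', [/\ forall t, F e t <= F' t &
    valid_at F c H e (wset b c e) (p e) ->
    coherent sxi spp (KK c H e (wset b c e) (p e)) F' /\
    forall t, KK c H e (wset b c e) (p e) t -> Qs c H (wset b c e) (F' t) /\
        exists2 s, EE D c (wset b c e) t s & s <= F' t].
  move=> e; have [v|nv] := pselect (valid_at F c H e (wset b c e) (p e)).
    by have [F' [? ? ?]] := next_at HB HN DQ v; exists F'; split.
  by exists (F e); split.
exists F'; split.
- by move=> e; case: (F'P e).
- apply: (valid_pres HB pr); apply: almost_mono (Fv b p pr) => e v.
  have [FF' /(_ v)[F'c F'Q]] := F'P e; split=> // t Kt; have [? _] := F'Q t Kt.
  by split=> //; case: v => _ /(_ t Kt)[_ /le_trans]; apply.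
- apply: almost_mono (Fv b p pr) => e v t Kt.
  by have [_ /(_ v)[_ /(_ t Kt)[_]]] := F'P e.
Qed.


(** * How a commitment settles a density system over all later ideals *)

Definition care (F : L -> shape -> P) (D : dsys) (c : M) (H : set P) : Prop :=
  forall c' H', c <= c' -> H `<=` H' -> Gen c' H' -> valid F c' H' ->
  settles D c' H'.

Lemma hh_rk c w x : w x -> w `<=` below c -> hh c w (rk w x) = x.
Proof.
move=> wx wc; have -> : rk w x = rk (top c w) x.
  apply: rk_ext => z zx; rewrite /top/=; split=> [|[//|cz]]; first by left.
  by have := lt_le_trans (lt_trans zx (wc x wx)) cz; rewrite ltxx.
by apply: (en_rk (top_ub c w)); left.
Qed.

Lemma rk_cut W c x : x <= c -> rk (W `&` below c) x = rk W x.
Proof.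
move=> xc; apply: rk_ext => z zx; split=> [[]//|Wz]; split=> //.
exact: lt_le_trans zx xc.
Qed.

Lemma th_rk c w : w `<=` below c -> th c w = rk w c.
Proof.
move=> wc; apply: rk_ext => z zc; rewrite /top/=; split=> [[//|cz]|]; last by left.
by have := lt_le_trans zc cz; rewrite ltxx.
Qed.

(** The task over (c', H') and a presentation of H' form an object whose shape [t] is guessed at
    some [e] where [F] is valid and both presentations cohere. The promise for [t] was decided over
    (c, H); validity puts its copy over [c'] into H', and invariance of [D k] turns the decision
    into one about the given task. *)
Lemma care_next (D : L -> dsys) c H F b p k : base c H ->
  (forall j, density_system (L := L) code c H (D j)) ->
  pres c H b p ->
  almost (fun e => forall t, KK c H e (wset b c e) (p e) t ->
       exists2 s, EE D c (wset b c e) t s & s <= F e t) ->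
  care F (D k) c H.
Proof.
move=> HB DS pr FE c' H' cc HH HG' Fv u w r r' smw uw rw r'w.
(* [z] lies above [c'] and [w], so that [b'] lists the task as well as [c']. *)
have [z zP] := M_bounded (leU (below_le c') smw.1).
have [b' b'P] := below_enum z z.
have b'c x : x < c' -> exists i, b' i = x.
  by move=> xc; apply/b'P/zP; left.
have [p' pr'] := pres_ex (or_intror HG' : base c' H') b'c.
pose o := Obj c' b' p' u w r r' k.
have H'0 := gen_inh HG'.
have ao : almost (okay o).
  apply: (almost_okay (H := H')) => //; first by right.
  by move=> x xw; apply/b'P/zP; right.
have [e [[[Fc FQ] [[wE pE] FEe]] oko tT]] := TT_hit (almost_and (Fv b' p' pr')
  (almost_and (pres_coherent HB HG' cc HH pr pr') FE)) ao.
set t := shape_of o e in tT.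
set W := oW o e; set w' := wset b' c' e in Fc FQ wE.
set we := wset b c e in wE FEe.
have w'W : w' = W `&` below c'.
  apply/seteqP; split=> x; last by move=> [[? _] ?].
  by move=> [xb xc]; split=> //; split=> //; left.
have w'c : w' `<=` below c' by move=> x [].
have wW : w `<=` W := okay_w oko.
have sW : small W by apply: small_sub (small_image b' (below_small e)) => x [].
pose f := rk W.
have fm A : A `<=` W -> smono f A by move=> AW; exact: smono_sub (@rk_smono W).
have thE : th c' w' = sxi t by rewrite th_rk // w'W rk_cut.
have rkf y : y < c' -> rk w' y = f y by move=> yc; rewrite w'W rk_cut // ltW.
have hf x : w' x -> hh c' w' (f x) = x.
  move=> w'x; rewrite -rkf; last exact: w'c.
  exact: hh_rk.
have fh x : x < sxi t -> w' (hh c' w' x) /\ f (hh c' w' x) = x.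
  rewrite -thE => xt; have w'h : w' (hh c' w' x).
    have : (hh c' w' @` below (th c' w')) (hh c' w' x) by exists x.
    by rewrite hh_below.
  split=> //; rewrite -rkf; last exact: w'c.
  rewrite (_ : rk w' _ = rk (top c' w') (hh c' w' x)).
    exact: (rk_en (top_ub c' w')).
  apply: rk_ext => y yx; rewrite /top/=; split=> [|[//|cy]]; first by left.
  by have := lt_le_trans (lt_trans yx (w'c _ w'h)) cy; rewrite ltxx.
have fc x : W x -> (f x < sxi t) = (x < c').
  move=> Wx; apply/idP/idP => [|xc]; last exact: rk_lt.
  by apply: contraTT; rewrite -!leNgt; exact: rk_le.
have [p'd p'H'] : dom (p' e) `<=` w' /\ H' (p' e).
  split; last exact: pres_in pr' e H'0.
  have sA : small (p' @` below e) by exact/small_image/below_small.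
  have chA : chain (p' @` below e).
    move=> _ _ [i ie <-] [j je <-].
    by have [ij|/ltW ji] := leP i j; [left|right]; exact: pres_mono pr' _ _ _.
  have [_ -> _] := islub_slub sA chA (okay_lub oko).
  by move=> x [_ [i ie <-] /(okay_dom oko ie)]; rewrite w'W.
have w'Ws : w' `<=` W by rewrite w'W => x [].
have hm c0 w0 v : smono (hh c0 w0) v by exact: hh_smono.
have sppE : img (hh c' w') (spp t) = p' e.
  apply: img_inv; first by apply: fm; exact: subset_trans p'd w'Ws.
  by move=> x /p'd/hf.
have tok := TT_ok tT.
have Kt' : KK c' H' e w' (p' e) t.
  split=> //; split; first by rewrite thE.
  by move=> _; rewrite restr_id // thE; exact: so_pp tok.
have [th_le hE hc] := hh_agree cc wE.
have Kt : KK c H e we (p e) t.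
  split=> //; split; first by rewrite -thE.
  move=> H0; rewrite -pE // -sppE (restr_img (b := th c we)) //.
  by apply: img_ext => // x; rewrite dom_restr => -[_ /hE].
have [s sE sF] := FEe t Kt.
have [QF _] := FQ t Kt'.
have Fd : dom (F e t) `<=` below (sxi t) by case: Fc => h _; exact: h.
have sd := subset_trans (dom_le sF) Fd.
have nd : dom (img (hh c' w') s) `<=` w'.
  by rewrite dom_img // => _ [x /sd/fh[h _] <-].
exists W, (img (hh c' w') s); split=> //.
- by move=> x [_ [/= xc|//]] cx; have := lt_le_trans xc cx; rewrite ltxx.
- split; last exact: subset_trans nd w'Ws.
  apply: (gen_in HG'); first exact: subset_trans nd w'c.
  by apply: quot_down QF; exact: img_le.
(* [g] moves [W], which lives over [c'], to the set [V] used for the decision over [c], and fixes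
   the points of [W] below [c]; this is the isomorphism fed to [ds_invar]. *)
pose g := hh c we \o f.
have gm A : A `<=` W -> smono g A.
  by move=> AW x y Ax Ay xy; apply: hh_lt; exact: fm Ax Ay xy.
set V := hh c we @` (below (sxi t) `|` sw t) in sE.
have VE : V = g @` W.
  rewrite /V /g -image_comp; congr (_ @` _); apply/seteqP; split=> x.
    move=> [xt|[y yw <-]]; last by exists y => //; exact: wW.
    by have [w'x <-] := fh x xt; exists (hh c' w' x) => //; exact: w'Ws.
  move=> [y Wy <-]; have [yc|cy] := ltP y c'; first by left; rewrite /below/= fc.
  right; exists y => //; case: Wy => _ [yc|//].
  by have := lt_le_trans yc cy; rewrite ltxx.
have gid x : W x -> x < c -> g x = x.
  move=> Wx xc; have w'x : w' x by rewrite w'W; split=> //; exact: lt_le_trans xc cc.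
  have h1 := hf x w'x; rewrite /g /= -hE //.
  by rewrite -hc h1.
have gc x : W x -> (g x < c) = (x < c).
  move=> Wx; apply/idP/idP => [|xc]; last by rewrite gid.
  rewrite /g /= hh_ltc => ft; have fxi : f x < sxi t by rewrite -thE; exact: lt_le_trans ft th_le.
  have w'x : w' x by rewrite w'W; split=> //; rewrite /below/= -fc.
  by rewrite -[x]hf // hc.
have Vc : W `&` below c = V `&` below c.
  rewrite VE; apply/seteqP; split=> [x [Wx xc]|_ [[x Wx <-] gxc]].
    by split=> //; exists x => //; exact: gid.
  have xc : x < c by rewrite -gc.
  by rewrite gid.
have gxi x : W x -> (g x < hh c we (sxi t)) = (x < c').
  by move=> Wx; rewrite hh_ltE fc.
have uW := subset_trans uw wW.
have dd1 : in_ddom (L := L) u W by [].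
have dd2 : in_ddom (L := L) (g @` u) V.
  by rewrite VE; split; [exact: image_subset|split=> //; exact: small_image].
have hsu : hh c we @` su t = g @` u by rewrite image_comp.
have rg q : dom q `<=` W -> restr (img g q) c = restr q c.
  move=> qW; rewrite (restr_img (b := c)); [|exact: gm|by move=> x /qW/gc].
  by apply: img_id => x; rewrite dom_restr => -[/qW Wx xc]; exact: gid.
have Hg q : dom q `<=` W -> quot H (img g q) <-> quot H q.
  by move=> qW; rewrite (base_quot HB) rg // -(base_quot HB).
have Dg q : dom q `<=` W -> quot H q -> D k u W q <-> D k (g @` u) V (img g q).
  move=> qW Hq; apply: (ds_invar (DS k) dd1 dd2 Vc (h := g)) => //.
    by rewrite VE; apply: smono_iso; exact: gm.
  by apply: imgP; exact: gm.
have gimg r0 : dom r0 `<=` W -> img (hh c we) (img f r0) = img g r0.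
  by move=> r0W; rewrite img_comp //; exact: fm.
have ns : img g (img (hh c' w') s) = img (hh c we) s.
  rewrite img_comp //; last by apply: gm; rewrite -(dom_img (hm _ _ _)); exact: subset_trans nd w'Ws.
  by symmetry; apply: img_ext => // x /sd/fh[_ e']; rewrite /g /= e'.
have rW := subset_trans rw wW; have r'W := subset_trans r'w wW.
have gx q : dom q `<=` W -> restr (img g q) (hh c we (sxi t)) = img g (restr q c').
  by move=> qW; apply: restr_img; [exact: gm|move=> x /qW/gxi].
rewrite /EE -/V hsu in sE; case: sE => [[q0 [Dq rq r'q qs]]|no]; [left|right].
  have [Hq0 q0V] : (quot H q0 /\ dom q0 `<=` V) by exact: (ds_sub (DS k) dd2 Dq).
  have [|q qW qE] := img_surj (gm W (fun x h => h)) (r := q0); first by rewrite -VE.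
  exists q; split.
  - by apply/Dg => //; [apply/Hg; rewrite ?qE|rewrite qE].
  - by apply: (le_img_inv (gm W (fun x h => h))) => //; rewrite qE -gimg.
  - by apply: (le_img_inv (gm W (fun x h => h))) => //; rewrite qE -gimg.
  - apply: (le_img_inv (gm W (fun x h => h))).
    + by apply: subset_trans qW; exact: dom_le (restr_le _ _).
    + exact: subset_trans nd w'Ws.
    + by rewrite -gx // qE ns.
move=> q Dq rq r'q nq; have [Hq qW] : quot H q /\ dom q `<=` W by exact: (ds_sub (DS k) dd1 Dq).
apply: (no (img g q)).
- exact/Dg.
- by rewrite gimg //; apply: img_le rq; exact: gm.
- by rewrite gimg //; apply: img_le r'q; exact: gm.
- rewrite gx // -ns; apply: img_le nq; apply: gm.
  by apply: subset_trans qW; exact: dom_le (restr_le _ _).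
Qed.


(** * Commitments over larger ideals and along increasing sequences *)

Lemma restr_hh c w c' w' x : c <= c' -> w = w' `&` below c ->
  restr (img (hh c' w') x) c = restr (img (hh c w) x) c.
Proof.
move=> cc wE; have [_ hE hc] := hh_agree cc wE.
rewrite (restr_img (b := th c w)); [|exact: hh_smono|by move=> y _; exact: hc].
rewrite (restr_img (b := th c w)); [|exact: hh_smono|by move=> y _; exact: hh_ltc].
by apply: img_ext; [move=> y; rewrite dom_restr => -[_ /hE]|exact: hh_smono].
Qed.

Lemma KK_sub c H w pe c' H' w' pe' e t : c <= c' -> w = w' `&` below c ->
  (H !=set0 -> restr pe' c = pe) -> H' !=set0 ->
  KK c' H' e w' pe' t -> KK c H e w pe t.
Proof.
move=> cc wE pE H'0 [Tt [tx tE]]; have [thl hE hc] := hh_agree cc wE.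
split=> //; split=> [|H0]; first exact: le_trans tx.
rewrite -pE // -(tE H'0) (restr_img (b := th c w)); last by move=> y _; exact: hc.
  rewrite restr_restr //; symmetry; apply: img_ext; last exact: hh_smono.
  by move=> y; rewrite dom_restr => -[_ /hE].
exact: hh_smono.
Qed.

Lemma KK_nonempty c H H' e w pe : H !=set0 -> H' !=set0 ->
  KK c H e w pe = KK c H' e w pe.
Proof.
by move=> h h'; apply/seteqP; split=> t [? [? E]]; split=> //; split=> // _; exact: E.
Qed.

Lemma coherent_sub (K K' : set shape) f : K `<=` K' -> coherent sxi spp K' f ->
  coherent sxi spp K f.
Proof.
by move=> KK' [h1 h2]; split=> [t /KK'/h1//|t s a /KK' Kt /KK' Ks]; exact: h2.
Qed.

Definition leF (F F' : L -> shape -> P) : Prop :=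
  almost (fun e => forall t, TT e t -> F e t <= F' e t).

(** Coherence comes from the smaller ideal, through whose approximation more shapes pass; membership
    in P/H' comes from the stronger [F'], as P/H' is closed downward. *)
Lemma valid_transfer F F' c H c' H' : base c H -> Gen c' H' -> c <= c' ->
  H `<=` H' -> valid F c H -> leF F F' -> valid F' c' H' -> valid F c' H'.
Proof.
move=> HB HG cc HH Fv FF Fv' b' p' pr'.
have [b bP] := below_enum c c; have [p pr] := pres_ex HB bP.
apply: almost_mono (almost_and (almost_and (Fv b p pr) (Fv' b' p' pr'))
  (almost_and FF (pres_coherent HB HG cc HH pr pr'))).
move=> e [[[Fc FQ] [_ FQ']] [le [wE pE]]].
have sub : KK c' H' e (wset b' c' e) (p' e) `<=` KK c H e (wset b c e) (p e).
  by move=> t; apply: KK_sub => //; exact: gen_inh HG.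
split=> [|t Kt]; first exact: coherent_sub sub Fc.
have [_ ?] := FQ t (sub t Kt); have [Q' _] := FQ' t Kt; split=> //.
by apply: Qs_down Q'; apply: le; case: Kt.
Qed.

(* Commitments persist in G_<a: a condition lies in it iff all its restrictions
   to the earlier zeta_b lie in G_b. *)
Lemma valid_limit F (I : set M) (zt : M -> M) (G : M -> set P) c H :
  I #<= [set: L] -> I !=set0 ->
  (forall b, I b -> [/\ Gen (zt b) (G b), zt b <= c, G b `<=` H &
                        valid F (zt b) (G b)]) ->
  (forall x, x < c -> exists2 b, I b & x < zt b) -> Gen c H -> valid F c H.
Proof.
move=> IL I0 Ib cof HG b p pr; have HB : base c H by right.
have [ei eiE] := card_le_enum I0 IL.
have eiI i : I (ei i) by rewrite eiE; exists i.
have /choice[bp bpP] : forall i, exists bp : (L -> M) * (L -> P),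
    pres (zt (ei i)) (G (ei i)) bp.1 bp.2.
  move=> i; have [Gi _ _ _] := Ib _ (eiI i).
  have [b1 b1P] := below_enum (zt (ei i)) c.
  by have [p1 ?] := pres_ex (or_intror Gi : base _ _) b1P; exists (b1, p1).
have /choice[f fP] : forall i, exists j, b i < c -> b i < zt (ei j).
  move=> i; have [bi|] := pselect (b i < c); last by exists i.
  have [d Id lt] := cof _ bi; move: Id; rewrite eiE => -[j _ ej].
  by exists j; rewrite ej.
have A1 : almost (fun e => forall i, i < e ->
    valid_at F (zt (ei i)) (G (ei i)) e (wset (bp i).1 (zt (ei i)) e) ((bp i).2 e)).
  by apply: almost_diag => i; have [_ _ _] := Ib _ (eiI i); apply; exact: bpP.
have A2 : almost (fun e => forall i, i < e ->
    wset (bp i).1 (zt (ei i)) e = wset b c e `&` below (zt (ei i)) /\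
    restr (p e) (zt (ei i)) = (bp i).2 e).
  apply: almost_diag => i; have [Gi zc GH _] := Ib _ (eiI i).
  have := pres_coherent (or_intror Gi : base _ _) HG zc GH (bpP i) pr.
  by apply: almost_mono => e [-> h]; split=> //; apply: h; exact: gen_inh Gi.
apply: almost_mono (almost_and almost_limit (almost_and (almost_closed f)
  (almost_and A1 A2))) => e [[[i0 i0e] el] [fe [val coh]]].
set w := wset b c e in coh *.
have sub i : i < e -> KK c H e w (p e) `<=`
    KK (zt (ei i)) (G (ei i)) e (wset (bp i).1 (zt (ei i)) e) ((bp i).2 e).
  move=> ie t; have [wE pE] := coh i ie; have [_ zc _ _] := Ib _ (eiI i).
  by apply: KK_sub => //; exact: gen_inh HG.
split.
  by apply: (coherent_sub (sub i0 i0e)); case: (val i0 i0e).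
move=> t Kt; split; last by have [_ /(_ t (sub _ i0e t Kt))[]] := val i0 i0e.
apply/(gen_quot HG); set s := img (hh c w) (F e t).
have Gs i : i < e -> G (ei i) (restr s (zt (ei i))).
  move=> ie; have [wE _] := coh i ie; have [Gi zc _ _] := Ib _ (eiI i).
  rewrite /s (restr_hh _ zc wE); apply/(gen_quot Gi).
  by have [_ /(_ t (sub _ ie t Kt))[]] := val i ie.
have [||R HR ub] := gen_ub HG (Q := (fun i => restr s (zt (ei i))) @` below e).
- exact/small_image/below_small.
- move=> _ [i ie <-]; have [_ _ GH _] := Ib _ (eiI i).
  exact/GH/Gs.
apply: (gen_down HG HR); have [m0 m0P] := M_bot.
apply: (restr_cover m0P).
  apply: le_trans (ub (restr s (zt (ei i0))) _); last by exists i0.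
  by apply: restr_le2 => x _ /lt_le_trans; apply; exact: m0P.
(* Each point of [dom s] below [c] is [b i] with [i < e]; as [e] is closed under [f], some ideal
   with index below [e] reaches beyond it. *)
move=> y ys yc; have [i ie iy] : exists2 i, i < e & b i = y.
  have : w y.
    move: ys; rewrite /s (dom_img (@hh_smono _ _ _)) => -[x xF ex].
    rewrite -(hh_below (c := c) (w := w)); last by move=> ? [].
    by exists x => //; rewrite /below/= -hh_ltc ex.
  by move=> [[i ie <-] _]; exists i.
exists (zt (ei (f i))); first by rewrite -iy; apply: fP; rewrite iy.
by apply: ub; exists (f i) => //; exact: fe.
Qed.

(** Diagonal lub: at [e] only the commitments with index below [e] are joined. So each lub is over a
    small set although there may be lambda commitments, and for almost all [e] that set is a
    chain. *)
Lemma valid_chain (I : set M) (F : M -> L -> shape -> P) c H : base c H ->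
  I #<= [set: L] -> (forall b, I b -> valid (F b) c H) ->
  (forall b b', I b -> I b' -> b < b' -> leF (F b) (F b')) ->
  (I = set0 -> H = set0) ->
  exists F', valid F' c H /\ forall b, I b -> leF (F b) F'.
Proof.
move=> HB IL Fv Fle IH; have [E0|/set0P I0] := eqVneq I set0.
  (* The commitment that promises nothing beyond the approximation itself. *)
  exists (fun _ t => spp t); split; last by rewrite E0.
  move=> b p _; apply: almost_all => e; split; last first.
    by move=> t _; split=> //; rewrite /Qs/= IH //; exact: quot0.
  by split=> [t [/TT_ok/so_pp]//|t s a _ _ []].
have [ei eiE] := card_le_enum I0 IL.
have eiI i : I (ei i) by rewrite eiE; exists i.
pose A e t := (fun i => F (ei i) e t) @` below e.
have sA e t : small (A e t) by exact/small_image/below_small.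
have ach : almost (fun e => forall t, TT e t -> chain (A e t)).
  have h i j : almost (fun e => ei i < ei j -> forall t, TT e t ->
      F (ei i) e t <= F (ei j) e t).
    have [ij|nij] := boolP (ei i < ei j).
      by apply: almost_mono (Fle _ _ (eiI i) (eiI j) ij).
    by apply: almost_all => e.
  have := almost_diag (fun i => almost_diag (h i)).
  apply: almost_mono => e lt t Tt _ _ [i ie <-] [j je <-].
  case: (ltgtP (ei i) (ei j)) => [ij|ji|->]; [left|right|by left].
    exact: lt.
  exact: lt.
have /choice[F' F'P] : forall e, exists f : shape -> P, forall t,
    chain (A e t) -> slub (A e t) (f t).
  move=> e; have /choice[f fP] : forall t, exists x, chain (A e t) -> slub (A e t) x.
    move=> t; have [ch|nch] := pselect (chain (A e t)); last by exists (spp t).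
    by have [x ?] := chain_lub (sA e t) ch; exists x.
  by exists f.
exists F'; split=> [b p pr|b Ib]; last first.
  move: Ib; rewrite eiE => -[i _ <-].
  apply: almost_mono (almost_and ach (almost_gt i)) => e [ch ie] t Tt.
  by have [[ub _] _ _] := F'P e t (ch t Tt); apply: ub; exists i.
have val : almost (fun e => forall i, i < e ->
    valid_at (F (ei i)) c H e (wset b c e) (p e)).
  by apply: almost_diag => i; exact: Fv.
apply: almost_mono (almost_and almost_limit (almost_and ach val)).
move=> e [[[i0 i0e] _] [ch {}val]]; split.
  apply: (@coherent_lub _ _ _ _ (A e) ((fun i => F (ei i) e) @` below e)).
  - by move=> t _; rewrite image_comp.
  - by move=> _ [i ie <-]; case: (val i ie).
  - by exists (F (ei i0) e), i0.
  - by move=> t [Tt _]; exact/F'P/ch.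
move=> t Kt; have Tt : TT e t by case: Kt.
have [[ub lst] ? ?] := F'P e t (ch t Tt); split.
  apply: (Qs_lub HB (sA e t) (ch t Tt)) => //.
  by move=> _ [i ie <-]; have [_ /(_ t Kt)[]] := val i ie.
have [_ /(_ t Kt)[_ h]] := val i0 i0e; apply: le_trans h _.
by apply: ub; exists i0.
Qed.


(** By coherence, all shapes through the approximation reached at step [e] have values of [F e] with
    one and the same trace below [zeta], so a single condition [real e t] serves them all; it lies
    above the chain because [spp t <= F e t]. *)
Lemma build_committed F c H zeta g (DD : set dsys) :
  base c H -> nice c H -> valid F c H -> c <= zeta -> quot H g ->
  dom g `<=` below zeta -> DD #<= [set: L] -> (forall D, DD D -> dense D c H) ->
  exists G, [/\ Gen zeta G, H `<=` G, G g,
    forall D, DD D -> Defs.meets (L := L) zeta G D & valid F zeta G].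
Proof.
move=> HB HN Fv cz gH gz DL Dd.
have [b bz] := below_enum zeta zeta.
pose w e := wset b zeta e.
pose hz e := hh zeta (w e).
pose th' e := th zeta (w e).
(* [setT] stands for the ideal under construction; [KK] depends only on its being nonempty. *)
pose K e s := KK zeta setT e (w e) s.
pose real e t := img (hz e) (restr (F e t) (th' e)).
pose ready e s := coherent sxi spp (K e s) (F e) /\
  forall t, K e s t -> quot H (real e t) /\ spp t <= F e t.
pose S e s y := ready e s -> forall t, K e s t -> real e t <= y.
have hm e v : smono (hz e) v by exact: hh_smono.
have realz e t : dom (real e t) `<=` below zeta.
  rewrite dom_img // => _ [x + <-]; rewrite dom_restr => -[_ xt].
  by rewrite /below/= hh_ltc.
have realE e t : real e t = restr (img (hz e) (F e t)) zeta.
  by rewrite (restr_img (b := th' e)) // => x _; rewrite hh_ltc.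
have [|G [p [GG [HG gG] Gm Gp GS]]] := build_generic (S := S) HB HN cz gH gz DL Dd.
  move=> e s sH sz; have [[r [t Kt]]|no] := pselect (ready e s /\ exists t, K e s t);
    last by exists s; split=> // r t Kt; case: no; split=> //; exists t.
  have [co re] := r; have [tH tF] := re t Kt.
  have [Tt [tx tE]] := Kt; have {}tE := tE (ex_intro setT s I).
  exists (real e t); split=> //.
    by rewrite -tE; apply: img_le; [exact: hm|exact: restr_mono tF].
  move=> _ t' Kt'; have [Tt' [tx' tE']] := Kt'; have {}tE' := tE' (ex_intro setT s I).
  rewrite /real; case: co => _ /(_ t' t (th' e) Kt' Kt) -> //; split=> //.
  apply/eqP; rewrite eq_le.
  by apply/andP; split; apply: (le_img_inv (hm e setT)) => //; rewrite tE tE'.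
exists G; split=> //.
have pr := Gp b bz; have GB : base zeta G by right.
apply: (valid_pres GB pr).
have [bc bcP] := below_enum c c; have [pc prc] := pres_ex HB bcP.
have := almost_and (Fv bc pc prc) (pres_coherent HB GG cz HG prc pr).
apply: almost_mono => e [[Fc FQ] [wE pE]].
have G0 : G !=set0 by exists g.
have sub : K e (p e) `<=` KK c H e (wset bc c e) (pc e).
  by move=> t; apply: KK_sub => //; exists g.
have rdy : ready e (p e).
  split; first exact: coherent_sub sub Fc.
  move=> t Kt; have [QF ?] := FQ t (sub t Kt); split=> //.
  apply/(base_quot HB); rewrite realE restr_restr // (restr_hh _ cz wE).
  exact: (base_quot HB _).1 QF.
have KE : KK zeta G e (wset b zeta e) (p e) = K e (p e).
  by apply: KK_nonempty => //; exists g.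
have [_ [y Gy Sy]] := GS e.
rewrite /valid_at KE; split; first by case: rdy.
move=> t Kt; split; last by have [_ /(_ t Kt)[]] := rdy.
apply/(gen_quot GG); rewrite -realE; apply: (gen_down GG Gy); exact: Sy.
Qed.

Lemma order_iso_smono (h : M -> M) v w : order_iso h v w -> smono h v /\ h @` v = w.
Proof.
move=> [e hm]; split=> // x y vx vy xy.
by rewrite ltNge hm ?inE // -ltNge.
Qed.

(** Rigidity of well-orders: at the least point moved, the value or the preimage would be a smaller
    point already fixed. *)
Lemma smono_fix (h : M -> M) v a : smono h v ->
  v `&` below a = (h @` v) `&` below a ->
  (forall x, v x -> x < a -> h x = x) /\ (forall x, v x -> (h x < a) = (x < a)).
Proof.
move=> hv e.
have fix_ x : v x -> x < a -> h x = x.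
  elim/(wo_ind M_wf): x => x IH vx xa.
  case: (ltgtP (h x) x) => // [hx|hx].
    have vhx : v (h x).
      have : ((h @` v) `&` below a) (h x) by split; [exists x|exact: lt_trans xa].
      by rewrite -e => -[].
    have e' := smono_inj hv vhx vx (IH _ hx vhx (lt_trans hx xa)).
    by move: hx; rewrite e' ltxx.
  have : ((h @` v) `&` below a) x by rewrite -e.
  move=> [[z vz zx] _]; have zltx : z < x by rewrite -(smono_lt hv vz vx) zx.
  have hz := IH z zltx vz (lt_trans zltx xa).
  by move: zltx; rewrite -[z]hz zx ltxx.
split=> // x vx; apply/idP/idP => [hxa|xa]; last by rewrite fix_.
have vhx : v (h x).
  have : ((h @` v) `&` below a) (h x) by split=> //; exists x.
  by rewrite -e => -[].
by rewrite -(smono_inj hv vhx vx (fix_ _ vhx hxa)).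
Qed.

(** Membership in P/H depends only on the restriction to [c], and the isomorphism fixes the points
    below [c]. *)
Lemma own_triv_density c H : base c H ->
  density_system (L := L) code c H (own_triv H).
Proof.
move=> HB; split=> //.
- by move=> u w _ p.
- by move=> u w p _ Hp pw; exists p => //; split.
move=> u1 w1 u2 w2 h _ _ w12 /order_iso_smono[hm hw] _ p q Hp pw /(imgE (smono_sub pw hm)) <-.
have [fx ltx] := @smono_fix h w1 c hm (etrans w12 (congr1 (fun A => A `&` below c) (esym hw))).
have hp := smono_sub pw hm.
split=> _; split=> //; last first.
  by rewrite dom_img // -hw; exact: image_subset.
apply/(base_quot HB); rewrite (restr_img (b := c)) //; last by move=> x /pw/ltx.
rewrite img_id; last by move=> x; rewrite dom_restr => -[/pw]; exact: fx.
exact: (base_quot HB _).1 Hp.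
Qed.


(** * The invariant of the game for uncountable lambda *)

Record stage : Type := Stage {
  zt : M; GG : set P; gg : P; DD : set dsys;
  FF : L -> shape -> P; cc : M; HH : set P
}.

(** At each stage the trivial system joins those played by I; at stage 0 it is [own_triv set0], the
    source of niceness at all later stages. *)
Record invariant (a : M) (z : M -> stage) (s : stage) : Prop := Invariant {
  inv_gen : [/\ Gen (zt s) (GG s), GG s (gg s), cc s <= zt s & HH s `<=` GG s];
  inv_mono : forall b, b < a -> [/\ zt (z b) <= zt s, GG (z b) `<=` GG s &
    leF (FF (z b)) (FF s)];
  inv_valid : valid (FF s) (zt s) (GG s);
  inv_base : [/\ base (cc s) (HH s), below a = set0 -> HH s = set0 &
    DD s #<= [set: L]];
  inv_care : forall D, DD s D \/ D = own_triv (HH s) ->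
    density_system (L := L) code (cc s) (HH s) D /\
    care (FF s) D (cc s) (HH s);
  inv_meets : forall D, DD s D -> Defs.meets (L := L) (zt s) (GG s) D;
  inv_meets_old : forall b D, b < a -> DD (z b) D ->
    Defs.meets (L := L) (zt s) (GG s) D
}.

Lemma stage_step a z c H g (D0 : set dsys) :
  (forall b, b < a -> invariant b z (z b)) -> referee zt GG a z c H ->
  quot H g -> D0 #<= [set: L] ->
  (forall D, D0 D -> density_system (L := L) code c H D) ->
  exists s, [/\ invariant a z s, gg s = g & DD s = D0].
Proof.
move=> inv [ub lst H0 HG] gH D0L D0d; have [m0 m0P] := M_bot.
have ne b : b < a -> below a !=set0 by exists b.
have HGen b : b < a -> Gen c H by move=> /ne/HG[].
have sub b : b < a -> GG (z b) `<=` H by move=> ba; have [_ h] := HG (ne b ba); exact: h.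
have HB : base c H.
  have [E0|/set0P] := eqVneq (below a) set0; last by move=> /HG[]; right.
  left; split; first exact: H0.
  by move=> y; apply: lst => b ba; have : below a b by []; rewrite E0.
have Gb b : b < a -> Gen (zt (z b)) (GG (z b)).
  by move=> ba; case: (inv_gen (inv b ba)).
have cof x : x < c -> exists2 b, b < a & x < zt (z b).
  move=> xc; apply: contrapT => no; suff : c <= x by rewrite leNgt xc.
  by apply: lst => b ba; rewrite leNgt; apply/negP => xb; apply: no; exists b.
have valb b b' : b <= b' -> b' < a -> valid (FF (z b)) (zt (z b')) (GG (z b')).
  move=> /le_eq_lt[->|bb'] b'a; first exact: inv_valid (inv b' b'a).
  have ba := lt_trans bb' b'a; have [h1 h2 h3] := inv_mono (inv b' b'a) bb'.
  apply: (valid_transfer (or_intror (Gb b ba)) (Gb b' b'a) h1 h2 _ h3).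
    exact: inv_valid (inv b ba).
  exact: inv_valid (inv b' b'a).
(* The ideals from stage [b] on are cofinal below [a], whether [a] is a limit or a successor, and
   the commitment of stage [b] is valid over each of them. *)
have valH b : b < a -> valid (FF (z b)) c H.
  move=> ba; apply: (valid_limit (I := [set b' | b <= b' /\ b' < a])
    (zt := fun b => zt (z b)) (G := fun b => GG (z b))) => //.
  - by apply: card_le_trans (below_le a); apply: subset_card_le => x [].
  - by exists b; split.
  - by move=> b' [bb' b'a]; split; [exact: Gb|exact: ub|exact: sub|exact: valb].
  - move=> x /cof[b' b'a xb']; have [bb'|/ltW b'b] := leP b b'.
      by exists b'.
    exists b => //; apply: lt_le_trans xb' _; have [->//|b'b'] := le_eq_lt b'b.
    by have [] := inv_mono (inv b ba) b'b'.
  - exact: HGen ba.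
have [F1 [F1v F1le]] := @valid_chain (below a) (fun b => FF (z b)) c H HB
  (below_le a) valH (fun b b' _ b'a bb' => let: And3 _ _ h := inv_mono (inv b' b'a) bb' in h)
  (fun E => H0 E).
have stl b D : b < a -> DD (z b) D \/ D = own_triv (HH (z b)) -> settles D c H.
  move=> ba hD; have [_ cr] := inv_care (inv b ba) hD.
  have [_ _ cz HG'] := inv_gen (inv b ba).
  apply: cr (HGen b ba) (valH b ba); first exact: le_trans cz (ub b ba).
  exact: subset_trans HG' (sub b ba).
have HN : nice c H.
  have [E0|/set0P[b ba]] := eqVneq (below a) set0; first by rewrite H0 //; exact: nice0.
  apply: decisive_nice (HGen b ba) _; apply: settles_decisive (HGen b ba) _.
  (* The trivial system over the empty ideal was treated at stage [m0], so [H] settles it and is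
     decisive. *)
  have m0a : m0 < a by exact: le_lt_trans ba.
  have e0 : HH (z m0) = set0.
    have [_ h _] := inv_base (inv m0 m0a); apply: h.
    by apply/seteqP; split=> // x xm; have := lt_le_trans xm (m0P x); rewrite ltxx.
  by apply: (stl m0) => //; right; rewrite e0.
have [k kE] : exists k : L -> dsys, D0 `|` [set own_triv H] = range k.
  apply: card_le_enum; first by exists (own_triv H); right.
  by apply: leU => //; exact: (small_finite (finite_set1 _)).1.
have kd i : density_system (L := L) code c H (k i).
  have : (D0 `|` [set own_triv H]) (k i) by rewrite kE; exists i.
  by case=> [/D0d//|->]; exact: own_triv_density.
have kq i u v q : in_ddom (L := L) u v -> k i u v q -> quot H q /\ dom q `<=` v.
  by move=> dd kiq; exact: (ds_sub (kd i) dd kiq).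
have [b0 b0P] := below_enum c m0; have [p0 pr0] := pres_ex HB b0P.
have [F2 [F12 F2v F2E]] := next_family HB HN kq pr0 F1v.
have F2c D : D0 D \/ D = own_triv H -> care F2 D c H.
  move=> hD; have : (D0 `|` [set own_triv H]) D by case: hD; [left|right].
  by rewrite kE => -[i _ <-]; exact: care_next kd pr0 F2E.
have [zeta zP] := M_bounded (leU (dom_small g).1 (small_finite (finite_set1 c)).1).
have cz : c <= zeta by apply/ltW/zP; right.
have gz : dom g `<=` below zeta by move=> x xg; apply: zP; left.
pose Dall := D0 `|` \bigcup_(b in below a) DD (z b).
have DallL : Dall #<= [set: L].
  apply: leU => //; apply: le_bigcup; first exact: below_le.
  by move=> b ba; case: (inv_base (inv b ba)).
have Dalld D : Dall D -> dense D c H.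
  case=> [/D0d|[b ba bD]]; first exact: own_dense.
  have [ds _] := inv_care (inv b ba) (or_introl bD).
  have [_ _ _ HG'] := inv_gen (inv b ba).
  apply: (settles_dense ds _ (HGen b ba) HN); first exact: subset_trans HG' (sub b ba).
  by apply: stl (ba) _; left.
have [G [GG' HsG Gg Gm F2G]] := build_committed HB HN F2v cz gH gz DallL Dalld.
exists (Stage zeta G g D0 F2 c H); split=> //; split=> //=.
- move=> b ba; split; first exact: le_trans (ub b ba) cz.
    exact: subset_trans (sub b ba) HsG.
  apply: almost_mono (F1le b ba) => e h t Tt; exact: le_trans (h t Tt) (F12 e t).
- move=> D hD; split; last exact: F2c.
  by case: hD => [/D0d//|->]; exact: own_triv_density.
- by move=> D hD; apply: Gm; left.
- by move=> b D ba hD; apply: Gm; right; exists b.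
Qed.

Lemma uncountable_strategy : exists s : strategyII, winning (L := L) code s.
Proof.
have [m0 _] := M_bot; have [p0 _] := P_bot.
pose s0 := Stage m0 set0 p0 set0 (fun _ _ => p0) m0 set0.
apply: (@strategy_ex stage s0 zt GG gg DD invariant).
- move=> a z z' s e [h1 h2 h3 h4 h5 h6 h7]; split=> // b.
    by move=> ba; rewrite -e //; exact: h2.
  by move=> D ba; rewrite -e //; exact: h7.
- move=> a z s [h1 h2 h3 h4 h5 h6 h7]; split=> //; try by case: h1.
  by move=> b /h2[].
- exact: stage_step.
Qed.

End Guessing.
End Uncountable.

(** * Countable lambda *)

Section Countable.
Hypothesis (ctbl : forall (T : Type) (A : set T), small A -> finite_set A).

(* For finite sets of conditions the property is inherited from the base by
   induction; with a fixed number of conditions it is not. *)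
Definition fdecisive (c : M) (H : set P) : Prop := forall A : set P, small A ->
  exists2 n, H n &
  (exists2 q, (forall x, A x -> x <= q) & restr q c <= n) \/
  (forall q, (forall x, A x -> x <= q) -> ~ compatible (restr q c) n).

Lemma fdecisive_decisive c H : fdecisive c H -> decisive c H.
Proof.
move=> dec p p'; have [|n Hn h] := dec [set p; p']; first exact/small_finite/finite_set2.
exists n => //; case: h => [[q ub qn]|h].
  by left; exists q; split=> //; apply: ub; [left|right].
by right=> q pq p'q; apply: h => x [->|->].
Qed.

(** To decide [A] above [x], the base is asked about [A] together with [x]. The number of conditions
    grows by one, which is why all finite sets are treated at once. *)
Lemma fdecisive_step c H zeta (A : set P) x : base c H -> nice c H ->
  (H !=set0 -> fdecisive c H) -> c <= zeta -> small A -> quot H x ->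
  dom x `<=` below zeta ->
  exists y, [/\ x <= y, quot H y, dom y `<=` below zeta &
    (exists2 q, (forall p, A p -> p <= q) & restr q zeta <= y) \/
    (forall q, (forall p, A p -> p <= q) -> ~ compatible (restr q zeta) y)].
Proof.
move=> HB HN dec cz sA Hx xz.
have up q : (forall p, (A `|` [set x]) p -> p <= q) -> quot H q ->
  exists y, [/\ x <= y, quot H y, dom y `<=` below zeta &
    (exists2 q, (forall p, A p -> p <= q) & restr q zeta <= y) \/
    (forall q, (forall p, A p -> p <= q) -> ~ compatible (restr q zeta) y)].
  move=> ub Hq; exists (restr q zeta); split.
  - by apply: le_restr xz; apply: ub; right.
  - exact: quot_down (restr_le _ _) Hq.
  - exact: dom_restrS.
  - by left; exists q => // p Ap; apply: ub; left.
have am q y m : (forall p, A p -> p <= q) -> restr q zeta <= m -> y <= m ->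
    exists q', [/\ forall p, A p -> p <= q', q <= q' & restr m zeta <= q'].
  move=> ub qm ym; have [||q' [qq' mq' _]] := @amalg q (restr m zeta) zeta.
  - by apply: le_restr qm _; exact: dom_restrS.
  - exact: dom_restrS.
  by exists q'; split=> // p /ub/le_trans; apply.
have sAx : small (A `|` [set x]) by apply: smallU => //; exact/small_finite/finite_set1.
have [H0|/set0P H0] := eqVneq H set0.
  have [[q ub]|no] := pselect (exists q, forall p, (A `|` [set x]) p -> p <= q).
    by apply: (up q ub); rewrite H0; exact: quot0.
  exists x; split=> //; right=> q ub [m qm xm]; apply: no.
  have [q' [ub' _ mq']] := am q x m ub qm xm.
  exists q' => p [/ub'//|->]; apply: le_trans mq'.
  exact: le_restr xm xz.
have HG : Gen c H by case: HB => // -[e]; case: H0 => n; rewrite e.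
have [n Hn [[q ub qn]|no]] := dec H0 _ sAx.
  by apply: (up q ub); apply/(gen_quot HG); exact: gen_down HG _ _ Hn qn.
have [y [Hy xy ny dy]] := nice_ideal HN Hn Hx.
have nz : dom n `<=` below zeta by move=> a /(gen_sub HG Hn) ac; exact: lt_le_trans ac cz.
have yz : dom y `<=` below zeta by rewrite dy => a [/xz|/nz].
exists y; split=> //; right=> q ub [m qm ym].
have [q' [ub' _ mq']] := am q y m ub qm ym.
have yq' : y <= q' by apply: le_trans mq'; exact: le_restr ym yz.
apply: (no q') => [p [/ub'//|->]|]; first exact: le_trans xy yq'.
exists (restr q' c) => //; apply: le_restr (gen_sub HG Hn); exact: le_trans ny yq'.
Qed.

(** [zp] is the sum of [zeta] and a bound of a copy of lambda in M, so the interval offers room for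
    every small set. *)
Lemma zeta_plus (zeta : M) : exists2 zp, zeta <= zp &
  ~ small [set v | zeta <= v /\ v < zp].
Proof.
have [m0 _] := M_bot.
have [_ _ [LM _]] := HM; have [g _ gI] := card_le_inj m0 LM.
have gL : g @` [set: L] #<= [set: L] by exact: card_image_le.
have [m mP] := M_bounded gL.
exists (hh zeta set0 m).
  by have [] := en_in (top_ub zeta set0) m.
move=> sm; have : small (g @` [set: L]).
  apply: small_sub (small_image (rk (top zeta set0)) sm) => x gx.
  exists (hh zeta set0 x); last exact: (rk_en (top_ub zeta set0)).
  by split; [have [] := en_in (top_ub zeta set0) x|apply: hh_lt; exact: mP].
have [l0 _] := L_inh.
move=> [_]; apply; apply: (enum_card_le (f := fun y => pick_or l0 (fun l => g l = y))).
move=> l _; exists (g l); first by exists l.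
apply: (gI _ _ I I).
by apply: (@pick_orP _ l0 (fun l' => g l' = g l)); exists l.
Qed.

(** The collapse of [w] and everything below [zeta] fixes [zeta], and a small [w] cannot fill the
    interval up to [zp]. Up to isomorphism over [zeta], all tasks thus live below [zp], and there
    are at most lambda of them. *)
Lemma move_down zeta zp (w : set M) : ~ small [set v | zeta <= v /\ v < zp] ->
  zeta <= zp -> small w ->
  exists h, [/\ smono h (below zeta `|` w), forall x, x < zeta -> h x = x,
    forall x, zeta <= x -> zeta <= h x & forall x, w x -> h x < zp].
Proof.
move=> big zzp sw; pose S := below zeta `|` w.
have id x : x <= zeta -> rk S x = x.
  move=> xz; rewrite -[RHS]rk_id; apply: rk_ext => z zx; split=> // _.
  by left; exact: lt_le_trans zx xz.
exists (rk S); split.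
- exact: rk_smono.
- by move=> x /ltW/id.
- by move=> x xz; have := rk_le S xz; rewrite id.
move=> x wx; rewrite ltNge; apply/negP => zpx; apply: big.
apply: small_sub (small_image (rk S) sw) => v [zv vzp].
have [z [[zz|wz] zx e]] := rk_init (lt_le_trans vzp zpx); last by exists z.
by move: zv; rewrite -e (id z (ltW zz)) leNgt (zz : z < zeta).
Qed.


(** [r] is amalgamated with the trace of [x'] below [zeta] before extending into D; hence the trace
    of the resulting [q] may be added to the chain, and density of D passes to the new ideal. *)
Lemma dense_step D c H zeta u w r x : base c H -> nice c H -> dense D c H ->
  c <= zeta -> small w -> u `<=` w -> dom r `<=` w -> quot H r ->
  quot H x -> dom x `<=` below zeta ->
  (exists x', [/\ quot H x', x <= x' & restr r zeta <= x']) ->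
  exists y W q, [/\ x <= y, quot H y, dom y `<=` below zeta,
    [/\ w `<=` W, small W & forall v, W v -> zeta <= v -> w v] &
    [/\ D u W q, r <= q, dom q `<=` W, quot H q & restr q zeta <= y]].
Proof.
move=> HB HN Dd cz sw uw rw Hr Hx xz [x' [Hx' xx' rx']].
have [r' [Hr' rr' xr' dr']] : exists r', [/\ quot H r', r <= r',
    restr x' zeta <= r' & dom r' = dom r `|` dom (restr x' zeta)].
  apply: (nice_amalg HN cz Hr).
  - exact: quot_down (restr_le _ _) Hx'.
  - exact: le_restr rx' (@dom_restrS _ _).
  - exact: dom_restrS.
have [W [q [wW sW Wc Hq [Dq r'q qW]]]] := Dd u (w `|` dom r') r'
  (smallU sw (dom_small r')) (fun _ h => or_introl (uw _ h)) (fun _ h => or_intror h) Hr'.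
exists (restr q zeta), W, q; split.
- apply: le_restr (xz); apply: le_trans r'q; apply: le_trans xr'.
  exact: le_restr xx' xz.
- exact: quot_down (restr_le _ _) Hq.
- exact: dom_restrS.
- split=> // [v wv|v Wv zv]; first by apply: wW; left.
  case: (Wc v Wv (le_trans cz zv)) => //; rewrite dr' => -[/rw//|].
  by rewrite dom_restr => -[_ vz]; have := lt_le_trans vz zv; rewrite ltxx.
- by split=> //; exact: le_trans r'q.
Qed.

Lemma img_down h zeta (p : P) : smono h (dom p) -> (forall x, x < zeta -> h x = x) ->
  (forall x, zeta <= x -> zeta <= h x) -> restr (img h p) zeta = restr p zeta.
Proof.
move=> hm hz zh; rewrite (restr_img (b := zeta)) //.
  by apply: img_id => x; rewrite dom_restr => -[_ xz]; exact: hz.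
move=> x _; apply/idP/idP => [|xz]; last by rewrite hz.
by apply: contraTT; rewrite -!leNgt; exact: zh.
Qed.

(** Only tasks with domains below [zp] are served; any other is moved there by [move_down], and the
    answer is pulled back, since D is invariant and [restr _ zeta] is not changed by the move. *)
Lemma countable_build c H zeta g (Dn Do : set dsys) :
  base c H -> nice c H -> (H !=set0 -> fdecisive c H) -> c <= zeta ->
  quot H g -> dom g `<=` below zeta -> Dn `|` Do #<= [set: L] ->
  (forall D, (Dn `|` Do) D -> dense D c H /\ exists c0 H0, [/\ base c0 H0, c0 <= c,
     H0 `<=` H & density_system (L := L) code c0 H0 D]) ->
  exists G, [/\ Gen zeta G, H `<=` G, G g,
    forall D, (Dn `|` Do) D -> Defs.meets (L := L) zeta G D &
    fdecisive zeta G /\ forall D, (Dn `|` Do) D -> dense D zeta G].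
Proof.
move=> HB HN dec cz Hg gz DL Dd; set DD := Dn `|` Do in DL Dd *.
have [zp zzp big] := zeta_plus zeta; have [p0 [p0P p0d]] := P_bot.
have sP := Psub_le (below_le zp).
have [|tA tAE] := @card_le_enum _ _ [set A | A `<=` [set p | dom p `<=` below zp] /\ small A]
    [set: L] _ (leT_subsets sP).
  by exists set0; split=> //; exact/small_finite/finite_set0.
have sM := leT_subsets (below_le zp).
pose tasks := DD `*` [set u | u `<=` below zp /\ small u] `*`
  [set u | u `<=` below zp /\ small u] `*` [set p | dom p `<=` below zp].
have tL : tasks #<= [set: L].
  by apply: (le_setXT _ sP); apply: (le_setXT _ sM); exact: le_setXT.
have [tk tkP] : exists tk : L -> dsys * set M * set M * P,
    forall t, tasks t -> exists j, tk j = t.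
  have [T0|/set0P T0] := eqVneq tasks set0.
    by exists (fun=> (own_triv set0, set0, set0, p0)) => t; rewrite T0.
  have [tk tkE] := card_le_enum T0 tL.
  by exists tk => t; rewrite tkE => -[j _ <-]; exists j.
pose S1 j y := (exists2 q, (forall p, tA j p -> p <= q) & restr q zeta <= y) \/
    (forall q, (forall p, tA j p -> p <= q) -> ~ compatible (restr q zeta) y).
pose S2 j y := let: (D, u, w, r) := tk j in
  tasks (tk j) -> u `<=` w -> dom r `<=` w -> quot H r ->
  (exists x', [/\ quot H x', y <= x' & restr r zeta <= x']) ->
  exists W q, [/\ w `<=` W, small W & forall v, W v -> zeta <= v -> w v] /\
    [/\ D u W q, r <= q, dom q `<=` W, quot H q & restr q zeta <= y].
have tAs j : small (tA j).
  have : (range tA) (tA j) by exists j.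
  by rewrite -tAE => -[].
have S1le j y y' : y <= y' -> S1 j y -> S1 j y'.
  move=> yy' [[q ub qy]|no]; [left|right].
    by exists q => //; exact: le_trans yy'.
  move=> q ub [m qm y'm]; apply: (no q ub); exists m => //; exact: le_trans y'm.
have [|G [p [GG [HG gG] Gm Gp GS]]] := build_generic (S := fun j _ y => S1 j y /\ S2 j y)
    HB HN cz Hg gz DL (fun D h => let: conj d _ := Dd D h in d).
  move=> j s Hs sz.
  have [y1 [sy1 Hy1 y1z S1y]] := fdecisive_step HB HN dec cz (tAs j) Hs sz.
  case etk : (tk j) => [[[D u] w] r].
  have [todo|skip] := pselect ([/\ tasks (tk j), u `<=` w, dom r `<=` w & quot H r] /\
      exists x', [/\ quot H x', y1 <= x' & restr r zeta <= x']); last first.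
    exists y1; split=> //; split=> //; rewrite /S2 etk => h1 h2 h3 h4 h5.
    by case: skip; split=> //; rewrite etk.
  have [[tj uw rw Hr] ex] := todo; move: tj; rewrite etk => -[[[DDD [_ _]] [_ sw]] _].
  have [y [W [q [y1y Hy yz hW hq]]]] :=
    dense_step HB HN (Dd D DDD).1 cz sw uw rw Hr Hy1 y1z ex.
  exists y; split=> //; first exact: le_trans y1y.
  split; first exact: S1le y1y S1y.
  by rewrite /S2 etk => _ _ _ _ _; exists W, q.
exists G; split=> //; split.
- move=> A sA; pose w := \bigcup_(a in A) dom a.
  have sw : small w by apply: small_bigcup => // a _; exact: dom_small.
  have [h [hm hz zh hzp]] := move_down big zzp sw.
  have wS : w `<=` below zeta `|` w by move=> x; right.
  have Aw x : A x -> dom x `<=` w by move=> Ax y xy; exists x.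
  have hw v : v `<=` w -> smono h v by move=> vw; apply: smono_sub hm => x /vw /wS.
  have hA x : A x -> smono h (dom x) by move=> /Aw; exact: hw.
  have [j ej] : exists j, tA j = img h @` A.
    have : (range tA) (img h @` A).
      rewrite -tAE; split; last exact: small_image.
      move=> _ [x Ax <-] /=; rewrite (dom_img (hA x Ax)) => _ [y xy <-].
      by apply: hzp; exact: Aw xy.
    by case=> j _ <-; exists j.
  have [_ [y Gy [S1y _]]] := GS j; rewrite /S1 ej in S1y; exists y => //.
  case: S1y => [[q ub qy]|no]; [left|right].
    have [||q0 [q0q ub0 q0d]] := @bound_in (img h @` A) q => //; first exact: small_image.
    have [|q1 q1d q1E] := @img_surj h w q0 (hw _ (fun _ h => h)).
      move=> x /q0d[_ [a Aa <-]]; rewrite (dom_img (hA a Aa)) => -[b ab <-].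
      by exists b => //; exact: Aw ab.
    exists q1.
      move=> x Ax; apply: (le_img_inv (hw _ (fun _ h => h))) => //; first exact: Aw.
      by rewrite q1E; apply: ub0; exists x.
    by rewrite -(img_down (hw _ q1d) hz zh) q1E; apply: le_trans (restr_mono _ q0q) qy.
  move=> q ub [m qm ym]; have [q0 [q0q ub0 q0d]] := bound_in sA ub.
  apply: (no (img h q0)).
    by move=> _ [x Ax <-]; apply: img_le (ub0 x Ax); exact: hw.
  exists m => //; rewrite (img_down (hw _ q0d) hz zh).
  exact: le_trans (restr_mono _ q0q) qm.
- move=> D DDD u w r sw uw rw Gr.
  have [h [hm hz zh hzp]] := move_down big zzp sw.
  have wS : w `<=` below zeta `|` w by move=> x; right.
  have hr : smono h (dom r) by apply: smono_sub hm => x /rw/wS.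
  have hwzp v : v `<=` w -> h @` v `<=` below zp.
    by move=> vw _ [x /vw xw <-]; exact: hzp.
  have td : tasks (D, h @` u, h @` w, img h r).
    split; last by rewrite /= dom_img //; exact: hwzp.
    split; last by split; [exact: hwzp|exact: small_image].
    split; first exact: DDD.
    split; [exact: hwzp|exact/small_image/(small_sub uw)].
  have [j ej] := tkP _ td.
  have rE := img_down hr hz zh.
  have Grz : G (restr r zeta) by apply/(gen_quot GG).
  have Hsub x : G x -> quot H x.
    by move=> Gx; apply: quot_anti HG _; exact: gen_sub_quot GG _ Gx.
  have Hir : quot H (img h r).
    rewrite -(base_quot_restr HB _ cz) rE; exact: Hsub.
  have [_ [y Gy [_ +]]] := GS j; rewrite /S2 ej.
  have uw' := image_subset h uw.
  have rw' : dom (img h r) `<=` h @` w by rewrite dom_img //; exact: image_subset.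
  have ex : exists x', [/\ quot H x', y <= x' & restr (img h r) zeta <= x'].
    have [x' [Gx' yx' rx']] := gen_ub2 GG Gy Grz.
    by exists x'; split=> //; [exact: Hsub|rewrite rE].
  move=> /(_ td uw' rw' Hir ex)[W' [q' [[wW' sW' W'z] [Dq' rq' q'W' Hq' q'y]]]].
  (* The pull-back of [W'] along [h], as [W'] has no points from [zeta] on besides those of the
     moved [w]. *)
  pose W := (W' `&` below zeta) `|` w.
  have WS : W `<=` below zeta `|` w by move=> x [[_ ?]|?]; [left|right].
  have hW := smono_sub WS hm.
  have WE : h @` W = W'.
    apply/seteqP; split=> [_ [x [[W'x xz]|wx] <-]|x W'x].
    - by rewrite hz.
    - by apply: wW'; exists x.
    have [xz|zx] := ltP x zeta; first by exists x; [left|exact: hz].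
    by have [v wv <-] := W'z x W'x zx; exists v => //; right.
  have [c0 [H0 [HB0 c0c HH0 DS]]] := (Dd D DDD).2.
  have c0z := le_trans c0c cz.
  have [|q qW qE] := img_surj hW (r := q'); first by rewrite WE.
  have hq := smono_sub qW hW.
  have qzE : restr q zeta = restr q' zeta by rewrite -qE (img_down hq hz zh).
  have sW : small W.
    by apply: smallU => //; apply: small_sub sW' => x [].
  have dd1 : in_ddom (L := L) u W.
    by split; [move=> x /uw; right|split].
  have dd2 : in_ddom (L := L) (h @` u) W'.
    by split=> //; exact: subset_trans uw' wW'.
  have Hq0 : quot H0 q.
    rewrite -(base_quot_restr HB0 _ c0z) qzE (base_quot_restr HB0 _ c0z).
    exact: quot_anti HH0 Hq'.
  have Wc0 : W `&` below c0 = W' `&` below c0.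
    rewrite -WE; apply/seteqP; split=> [x [Wx xc]|_ [[x Wx <-] hxc]].
      by split=> //; exists x => //; apply: hz; exact: lt_le_trans xc c0z.
    have xz : x < zeta.
      rewrite ltNge; apply/negP => /zh zhx.
      by have := lt_le_trans hxc (le_trans c0z zhx); rewrite ltxx.
    by rewrite hz // in hxc *.
  exists W, q; split=> //.
  - by move=> x wx; right.
  - by move=> x [[_ xz]|//] zx; have := lt_le_trans xz zx; rewrite ltxx.
  - by apply/(gen_quot GG); rewrite qzE; exact: gen_down GG _ _ Gy q'y.
  split=> //.
    apply/(ds_invar DS dd1 dd2 Wc0 (h := h)) => //.
    - by rewrite -WE; exact: smono_iso.
    - exact: imgP.
    - by rewrite qE.
  apply: (le_img_inv hW) => //; last by rewrite qE.
  by move=> x /rw wx; right.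
Qed.

(** * The invariant of the game for countable lambda *)

Record cstage : Type := CStage {
  czt : M; cGG : set P; cgg : P; cDD : set dsys; ccc : M; cHH : set P
}.

Record cinvariant (a : M) (z : M -> cstage) (s : cstage) : Prop := CInvariant {
  cinv_gen : [/\ Gen (czt s) (cGG s), cGG s (cgg s), ccc s <= czt s &
    cHH s `<=` cGG s];
  cinv_mono : forall b, b < a -> czt (z b) <= czt s /\ cGG (z b) `<=` cGG s;
  cinv_base : base (ccc s) (cHH s) /\ cDD s #<= [set: L];
  cinv_dec : fdecisive (czt s) (cGG s);
  cinv_new : forall D, cDD s D -> [/\ dense D (czt s) (cGG s),
    density_system (L := L) code (ccc s) (cHH s) D &
    Defs.meets (L := L) (czt s) (cGG s) D];
  cinv_old : forall b D, b < a -> cDD (z b) D -> dense D (czt s) (cGG s) /\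
    Defs.meets (L := L) (czt s) (cGG s) D
}.

Lemma finite_below (a : M) (zt : M -> M) (w : set M) : finite_set w ->
  (forall b b', b <= b' -> b' < a -> zt b <= zt b') -> below a !=set0 ->
  (forall x, w x -> exists2 b, b < a & x < zt b) ->
  exists2 b, b < a & forall x, w x -> x < zt b.
Proof.
move=> /finite_seqP[s ->] mono [b0 b0a].
elim: s => [|y s IH] h; first by exists b0.
have [|b ba bP] := IH; first by move=> x /= xs; apply: h; rewrite /= inE xs orbT.
have [|b' b'a yb'] := h y; first by rewrite /= inE eqxx.
exists (Order.max b b'); first by rewrite gt_max ba.
have ma : Order.max b b' < a by rewrite gt_max ba.
move=> x /=; rewrite inE => /orP[/eqP->|xs].
  by apply: lt_le_trans yb' _; apply: mono => //; rewrite le_max lexx orbT.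
by apply: (lt_le_trans (bP x xs)); apply: mono => //; rewrite le_max lexx.
Qed.

Lemma cstage_step a z c H g (D0 : set dsys) :
  (forall b, b < a -> cinvariant b z (z b)) -> referee czt cGG a z c H ->
  quot H g -> D0 #<= [set: L] ->
  (forall D, D0 D -> density_system (L := L) code c H D) ->
  exists s, [/\ cinvariant a z s, cgg s = g & cDD s = D0].
Proof.
move=> inv [ub lst H0 HG] gH D0L D0d; have [m0 m0P] := M_bot.
have ne b : b < a -> below a !=set0 by exists b.
have HGen b : b < a -> Gen c H by move=> /ne/HG[].
have sub b : b < a -> cGG (z b) `<=` H.
  by move=> ba; have [_ h] := HG (ne b ba); exact: h.
have HB : base c H.
  have [E0|/set0P] := eqVneq (below a) set0; last by move=> /HG[]; right.
  left; split; first exact: H0.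
  by move=> y; apply: lst => b ba; have : below a b by []; rewrite E0.
have Gb b : b < a -> Gen (czt (z b)) (cGG (z b)).
  by move=> ba; case: (cinv_gen (inv b ba)).
have cof x : x < c -> exists2 b, b < a & x < czt (z b).
  move=> xc; apply: contrapT => no; suff : c <= x by rewrite leNgt xc.
  by apply: lst => b ba; rewrite leNgt; apply/negP => xb; apply: no; exists b.
have mono b b' : b <= b' -> b' < a -> czt (z b) <= czt (z b').
  by move=> /le_eq_lt[->//|bb'] b'a; have [] := cinv_mono (inv b' b'a) bb'.
have reach w b1 : b1 < a -> small w -> exists b, [/\ b1 <= b, b < a &
    forall x, w x -> x < c -> x < czt (z b)].
  move=> b1a sw; have [||||b ba bP] := @finite_below a (fun b => czt (z b)) (w `&` below c).
  - by apply: ctbl; apply: small_sub sw => x [].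
  - exact: mono.
  - exact: ne b1a.
  - by move=> x [_ /cof].
  exists (Order.max b1 b); split; [by rewrite le_max lexx|by rewrite gt_max b1a|].
  move=> x wx xc; apply: (lt_le_trans (bP x (conj wx xc))).
  by apply: mono; rewrite ?gt_max ?b1a // le_max lexx orbT.
(* For a finite domain, restricting to [c] and to a suitable earlier [czt (z b)] is the same;
   questions about [H] are thereby reduced to an earlier ideal. *)
have cut q b : b < a -> (forall x, dom q x -> x < c -> x < czt (z b)) ->
    restr q c = restr q (czt (z b)).
  move=> ba qb; apply/eqP; rewrite eq_le; apply/andP; split.
    exact: restr_le2.
  by apply: restr_le2 => x _ /lt_le_trans; apply; exact: ub.
have dec : H !=set0 -> fdecisive c H.
  move=> Hne A sA; have [E0|/set0P[b1 b1a]] := eqVneq (below a) set0.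
    by case: Hne => x; rewrite H0.
  pose w := \bigcup_(x in A) dom x.
  have [|b [_ ba wb]] := reach w b1 b1a; first by apply: small_bigcup => // x _; exact: dom_small.
  have [n Gn h] := cinv_dec (inv b ba) sA; exists n; first exact: sub ba _ Gn.
  case: h => [[q qub qn]|no]; [left|right].
    have [q0 [q0q ub0 q0w]] := bound_in sA qub; exists q0 => //.
    rewrite (cut q0 b ba); last by move=> x /q0w/wb.
    exact: le_trans (restr_mono _ q0q) qn.
  move=> q qub [m qm nm]; have [q0 [q0q ub0 q0w]] := bound_in sA qub.
  apply: (no q0 ub0); exists m => //; rewrite -(cut q0 b ba); last by move=> x /q0w/wb.
  exact: le_trans (restr_mono _ q0q) qm.
have HN : nice c H.
  have [E0|/set0P[b ba]] := eqVneq (below a) set0; first by rewrite H0 //; exact: nice0.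
  apply: decisive_nice (HGen b ba) _; apply/fdecisive_decisive/dec.
  exact: gen_inh (HGen b ba).
have old b1 D : b1 < a -> cDD (z b1) D -> dense D c H.
  move=> b1a hD u w r sw uw rw Hr; have [b [b1b ba wb]] := reach w b1 b1a sw.
  have Db : dense D (czt (z b)) (cGG (z b)).
    have [e|b1b'] := le_eq_lt b1b; last by have [] := cinv_old (inv b ba) b1b' hD.
    by rewrite -e; have [] := cinv_new (inv b1 b1a) hD.
  have [W [q [wW sW Wb Gq [Dq rq qW]]]] := Db u w r sw uw rw (quot_anti (sub b ba) Hr).
  exists W, q; split=> //.
    by move=> x Wx cx; apply: Wb => //; exact: le_trans (ub b ba) cx.
  apply/(gen_quot (HGen b ba)); rewrite (cut q b ba).
    by apply: sub (ba) _ _; apply/(gen_quot (Gb b ba)).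
  move=> x /qW Wx xc; rewrite ltNge; apply/negP => bx.
  by have := wb x (Wb x Wx bx) xc; rewrite ltNge bx.
have [zeta zP] := M_bounded (leU (dom_small g).1 (small_finite (finite_set1 c)).1).
have cz : c <= zeta by apply/ltW/zP; right.
have gz : dom g `<=` below zeta by move=> x xg; apply: zP; left.
pose Do := \bigcup_(b in below a) cDD (z b).
have [||G [GG' HsG Gg Gm [Gdec Gd]]] := @countable_build c H zeta g D0 Do HB HN dec cz gH gz.
- apply: leU => //; apply: le_bigcup; first exact: below_le.
  by move=> b ba; case: (cinv_base (inv b ba)).
- move=> D [hD|[b ba hD]].
    by split; [exact/own_dense/D0d|exists c, H; split=> //; exact: D0d].
  split; first exact: old ba hD.
  have [_ ds _] := cinv_new (inv b ba) hD; exists (ccc (z b)), (cHH (z b)).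
  have [_ _ bz bG] := cinv_gen (inv b ba); have [bB _] := cinv_base (inv b ba).
  split=> //; first exact: le_trans bz (ub b ba).
  exact: subset_trans bG (sub b ba).
exists (CStage zeta G g D0 c H); split=> //; split=> //=.
- move=> b ba; split; first exact: le_trans (ub b ba) cz.
  exact: subset_trans (sub b ba) HsG.
- by move=> D hD; split; [apply: Gd; left|exact: D0d|apply: Gm; left].
- by move=> b D ba hD; split; [apply: Gd|apply: Gm]; right; exists b.
Qed.

Lemma countable_strategy : exists s : strategyII, winning (L := L) code s.
Proof.
have [m0 _] := M_bot; have [p0 _] := P_bot.
pose s0 := CStage m0 set0 p0 set0 m0 set0.
apply: (@strategy_ex cstage s0 czt cGG cgg cDD cinvariant).
- move=> a z z' s e [h1 h2 h3 h4 h5 h6]; split=> // b.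
    by move=> ba; rewrite -e //; exact: h2.
  by move=> D ba; rewrite -e //; exact: h6.
- move=> a z s [h1 h2 h3 h4 h5 h6]; split=> //; try by case: h1.
    by move=> D /h5[].
  by move=> b D ba /(h6 b D ba)[].
- exact: cstage_step.
Qed.

End Countable.

End Genericity.

Theorem theorem1p9 (dL dM dP : Order.disp_t)
    (L : orderType dL) (M : orderType dM) (P : porderType dP)
    (code : P -> cond L M) :
  infinite_regular L ->
  power_below_eq L ->
  is_successor_cardinal L M ->
  uniform_via code ->
  Dl L ->
  exists s : strategyII, winning code s.
Proof.
move=> HL HP HM HU HD.
have [unctbl|ctbl] := pselect (card_lt [set: nat] [set: L]).
  have [AA [AAs AAg]] := guess HL HP unctbl HD.
  by have [s ?] := uncountable_strategy HL HP HM HU unctbl AAs AAg; exists s.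
have [|s ?] := countable_strategy HL HP HM HU; last by exists s.
(* An infinite small set would contain a copy of the naturals, which lambda does not exceed in this
   case, so it would not be small. *)
move=> T A [_ nA]; apply: contrapT => /infiniteP natA; apply: nA.
apply: card_le_trans natA; apply: contrapT => nL; apply: ctbl; split=> //.
by apply/infiniteP; case: HL.
Qed.
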